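(* Let $\Phi$ be a bounded $m\times n$ matrix function on $\mathbb T$. Suppose that $\|H_\Phi\|_{\rm e}$ is less than the smallest nonzero superoptimal singular value of Nehari's problem for $\Phi$. Then $\Phi$ has a unique superoptimal approximation $Q$ by bounded analytic matrix functions. Moreover, the singular values $s_j(\Phi(\zeta)-Q(\zeta))$ are (almost everywhere) constant on $\mathbb T$.
   Context: $\mathbb T$ is the unit circle; $H^2$ is the Hardy space, $H^2_-=L^2\ominus H^2$, and $H^2(\mathbb C^k)$, $H^2_-(\mathbb C^k)$ are the corresponding spaces of $\mathbb C^k$-valued functions. $L^\infty(M_{m,n})$, $H^\infty(M_{m,n})$ are the spaces of bounded (bounded analytic) $m\times n$ matrix functions, with $\|F\|_\infty=\operatorname{ess\,sup}_{\zeta\in\mathbb T}\|F(\zeta)\|$ (operator norm). For a matrix or operator $A$, $s_j(A)$ ($j\ge0$) is the distance from $A$ to the set of matrices (operators) of rank at most $j$; $\|T\|_{\rm e}=\inf\{\|T-K\|:K\text{ compact}\}$. The Hankel operator $H_\Phi:H^2(\mathbb C^n)\to H^2_-(\mathbb C^m)$ is $H_\Phi f=\mathbb P_-\Phi f$, where $\mathbb P_-$ is the orthogonal projection onto $H^2_-(\mathbb C^m)$. Let $\Omega_0$ be the set of $Q\in H^\infty(M_{m,n})$ minimizing $\|\Phi-Q\|_\infty$ and, inductively, $\Omega_j$ the set of $Q\in\Omega_{j-1}$ minimizing $\operatorname{ess\,sup}_\zeta s_j(\Phi(\zeta)-Q(\zeta))$ over $\Omega_{j-1}$. Elements of $\Omega_{\min\{m,n\}-1}$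 are the superoptimal approximations of $\Phi$ (superoptimal solutions of Nehari's problem). The superoptimal singular values are $t_j=\operatorname{ess\,sup}_\zeta s_j(\Phi(\zeta)-Q(\zeta))$ for $Q\in\Omega_j$, $0\le j\le\min\{m,n\}-1$. The hypothesis means $\|H_\Phi\|_{\rm e}<t_j$ for every $j\le\min\{m,n\}-1$ with $t_j\neq0$. *)

(* Defs.v *)
From HB Require Import structures.
From mathcomp Require Import all_boot all_order all_algebra.
From mathcomp Require Import complex.
From mathcomp Require Import all_classical all_reals all_analysis.
From mathcomp Require Import measurable_realfun ess_sup_inf.

Set Implicit Arguments.
Unset Strict Implicit.
Unset Printing Implicit Defensive.

Import Order.TTheory GRing.Theory Num.Theory.
Import numFieldNormedType.Exports Normc.

Local Open Scope classical_set_scope.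
Local Open Scope complex_scope.
Local Open Scope ring_scope.

Record circle (R : realType) :=
  Circle { circle_val :> R[i]; _ : normc circle_val == 1 }.

Section Circle.
Variable R : realType.

HB.instance Definition _ := [isSub for @circle_val R].
HB.instance Definition _ := [Choice of circle R by <:].

Lemma expi_subproof (t : R) : normc (cos t +i* sin t) == 1.
Proof. by rewrite /normc cos2Dsin2 sqrtr1. Qed.

Definition expi (t : measurableTypeR R) : circle R := Circle (expi_subproof t).

HB.instance Definition _ := isPointed.Build (circle R) (expi 0).

Definition circle_coord (z : circle R) : R * R :=
  (complex.Re z, complex.Im z).

(* The Borel sets of the circle are the traces of the Borel sets of the
   plane. *)
HB.instance Definition _ :=
  Measurable.copy (circle R) (g_sigma_algebra_preimageType circle_coord).

Lemma measurable_expi : measurable_fun [set: measurableTypeR R] expi.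
Proof.
move=> _ A [B mB <-]; rewrite !setTI.
have mcs : measurable_fun [set: measurableTypeR R] (fun t : measurableTypeR R => (cos t, sin t)).
  apply/measurable_fun_pair => /=.
    by apply: continuous_measurable_fun; exact: continuous_cos.
  by apply: continuous_measurable_fun; exact: continuous_sin.
by have := mcs measurableT _ mB; rewrite setTI.
Qed.

HB.instance Definition _ := isMeasurableFun.Build _ _ _ _ expi measurable_expi.

Lemma tau_gt0 : (0 : R) < pi *+ 2.
Proof. by rewrite mulrn_wgt0 ?pi_gt0. Qed.

(* The law of e^{it} for t uniformly distributed on [0, 2 pi]. *)
Definition circle_measure : probability (circle R) R :=
  distribution (uniform_prob tau_gt0) expi.

End Circle.

Notation mfunT R m n := (circle R -> 'M[R[i]]_(m, n)).
Notation vfunT R n := (circle R -> 'cV[R[i]]_n).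

Section Matrices.
Variable R : realType.

Definition enorm n (x : 'cV[R[i]]_n) : R :=
  Num.sqrt (\sum_(i < n) normc (x i ord0) ^+ 2).

Definition mxopnorm m n (A : 'M[R[i]]_(m, n)) : R :=
  sup [set enorm (A *m x) | x in [set x : 'cV[R[i]]_n | enorm x <= 1]].

Definition mxsing m n (j : nat) (A : 'M[R[i]]_(m, n)) : R :=
  inf [set mxopnorm (A - B) | B in [set B : 'M[R[i]]_(m, n) |
                                    (\rank B <= j)%N]].

End Matrices.

(* Elements of L^p are represented by Borel functions; equality in L^p is
   equality almost everywhere. Boundary functions of the Hardy classes are
   the functions whose Fourier coefficients of negative index vanish. *)

Section FunctionSpaces.
Variable R : realType.
Local Notation mu := (circle_measure R).

Definition mx_measurable m n (F : mfunT R m n) : Prop :=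
  forall i j, measurable_fun setT (fun z => complex.Re (F z i j)) /\
              measurable_fun setT (fun z => complex.Im (F z i j)).

Definition cintegral (f : circle R -> R[i]) : R[i] :=
  (\int[mu]_(z in setT) complex.Re (f z))%R +i*
  (\int[mu]_(z in setT) complex.Im (f z))%R.

(* On the circle, z ^ (- k) is the conjugate of z ^ k. *)
Definition fourier (f : circle R -> R[i]) (k : int) : R[i] :=
  cintegral (fun z => f z * (z : R[i]) ^ (- k)).

Definition normoo m n (F : mfunT R m n) : \bar R :=
  ess_sup mu (fun z => (mxopnorm (F z))%:E).

Definition Linf m n : set (mfunT R m n) :=
  [set F | mx_measurable F /\ (normoo F < +oo)%E].

Definition Hinf m n : set (mfunT R m n) :=
  [set F | Linf F /\
    forall i j (k : int), k < 0 -> fourier (fun z => F z i j) k = 0].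

Definition norm2 n (f : vfunT R n) : \bar R :=
  Lnorm mu 2%:E (fun z => (enorm (f z))%:E).

Definition L2 n : set (vfunT R n) :=
  [set f | mx_measurable f /\ (norm2 f < +oo)%E].

Definition inner n (f g : vfunT R n) : R[i] :=
  cintegral (fun z => \sum_(i < n) f z i ord0 * conjc (g z i ord0)).

Definition H2 n : set (vfunT R n) :=
  [set f | L2 f /\
    forall i (k : int), k < 0 -> fourier (fun z => f z i ord0) k = 0].

Definition H2minus n : set (vfunT R n) :=
  [set f | L2 f /\ forall g, H2 g -> inner f g = 0].

(* Orthogonal projection of f onto the closed subspace V of L^2, determined
   up to almost everywhere equality. *)
Definition orthproj n (V : set (vfunT R n)) (f : vfunT R n) : vfunT R n :=
  xget (fun=> 0)
    [set g | V g /\ forall h, V h -> inner (fun z => f z - g z) h = 0].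

End FunctionSpaces.

(* Operators from H^2(C^n) to H^2_-(C^m) are given on representatives; only the values on [H2] matter. *)

Section Operators.
Variable R : realType.
Local Notation mu := (circle_measure R).

Definition is_operator m n (T : vfunT R n -> vfunT R m) : Prop :=
  [/\ forall f, H2 f -> H2minus (T f),
      forall f g, H2 f -> H2 g ->
        {ae mu, forall z, f z = g z} -> {ae mu, forall z, T f z = T g z}
    & forall (a : R[i]) f g, H2 f -> H2 g ->
        {ae mu, forall z,
           T (fun w => a *: f w + g w) z = a *: T f z + T g z}].

Definition opnorm m n (T : vfunT R n -> vfunT R m) : \bar R :=
  ereal_sup [set norm2 (T f) | f in [set f | H2 f /\ (norm2 f <= 1)%E]].

(* Boundedness of K follows from the sequential condition. *)
Definition is_compact m n (K : vfunT R n -> vfunT R m) : Prop :=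
  is_operator K /\
  forall u : nat -> vfunT R n,
    (forall k, H2 (u k)) ->
    (exists c : R, forall k, (norm2 (u k) <= c%:E)%E) ->
    exists phi : nat -> nat, {homo phi : a b / (a < b)%N} /\
      exists2 g, H2minus g &
        (fun k => norm2 (fun z => K (u (phi k)) z - g z)) @ \oo --> 0%E.

Definition essnorm m n (T : vfunT R n -> vfunT R m) : \bar R :=
  ereal_inf [set opnorm (fun f z => T f z - K f z)
            | K in @is_compact m n].

Definition hankel m n (Phi : mfunT R m n) (f : vfunT R n) : vfunT R m :=
  orthproj (@H2minus R m) (fun z => Phi z *m f z).

End Operators.

Section Superoptimal.
Variables (R : realType) (m n : nat).

Definition minimizers (F : mfunT R m n -> \bar R) (S : set (mfunT R m n)) :
    set (mfunT R m n) :=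
  [set Q | S Q /\ forall P, S P -> (F Q <= F P)%E].

Definition sup_sing (j : nat) (F : mfunT R m n) : \bar R :=
  ess_sup (circle_measure R) (fun z => (mxsing j (F z))%:E).

Fixpoint Omega (Phi : mfunT R m n) (j : nat) : set (mfunT R m n) :=
  match j with
  | 0%N => minimizers (fun Q => normoo (fun z => Phi z - Q z)) (@Hinf R m n)
  | j'.+1 =>
      minimizers (fun Q => sup_sing j'.+1 (fun z => Phi z - Q z))
                 (Omega Phi j')
  end.

Definition superoptimal (Phi : mfunT R m n) : set (mfunT R m n) :=
  Omega Phi (minn m n).-1.

(* [superopt_value Phi j t] means that t is the superoptimal singular value
   t_j; the value does not depend on the element Q of Omega_j. *)
Definition superopt_value (Phi : mfunT R m n) (j : nat) (t : \bar R) : Prop :=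
  exists2 Q, Omega Phi j Q & t = sup_sing j (fun z => Phi z - Q z).

End Superoptimal.

(* Main.v *)
(** If the norm t of the Hankel operator H_Phi exceeds its essential norm, it
    is attained at some f in H^2; for every best approximation Q the vector
    (Phi - Q) f is then H_Phi f and has modulus t |f|. Completing f and the
    conjugate of z H_Phi f by co-inner matrix functions L and X to pointwise
    unitary ones, every best approximation satisfies, with v = f / |f| and
    w = H_Phi f / (t |f|),
      Phi - Q = t w v* + X (Psi - G) L^T
    for a fixed bounded Psi, where G runs over all bounded analytic matrix
    functions with |Psi - G| <= t. Hence s_{j+1}(Phi - Q) = s_j(Psi - G), the
    superoptimal problem for Phi is that for Psi in size (m-1) x (n-1), and
    one concludes by induction on min(m, n) once the essential norm of H_Psi
    is known not to exceed that of H_Phi. That bound is carried through the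
    induction as a dimension count: for some N, no (N+1)-dimensional space of
    analytic vectors has |H_Phi F|^2 uniformly above c |F|^2. When t = 0 the
    function Phi is analytic. Nehari's theorem is proved by
    computing the coefficients of Q one at a time; each exists by Parrott's
    theorem. *)

Require Import Defs.
From mathcomp Require Import all_boot all_order all_algebra.
From mathcomp Require Import complex ring lra zify.
From mathcomp Require Import all_classical all_reals all_analysis.
From mathcomp Require Import measurable_realfun ess_sup_inf.
From HB Require Import structures.

Set Implicit Arguments.
Unset Strict Implicit.
Unset Printing Implicit Defensive.

Import Order.TTheory GRing.Theory Num.Theory.
Import numFieldNormedType.Exports Normc.

Local Open Scope classical_set_scope.
Local Open Scope complex_scope.
Local Open Scope ring_scope.
Local Notation "x ^*" := (conjc x) : ring_scope.
Local Notation Re := complex.Re.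
Local Notation Im := complex.Im.

(** * Complex numbers and sesquilinear forms *)

(** The delicate step is the transfer of the bound c from H_Phi to H_Psi. With E = Phi - Q0 and psi
    = L^T F, the pointwise splitting gives |E F|^2 = t^2 (|F|^2 - |psi|^2) + |Psi psi|^2. Separating
    analytic and co-analytic parts on both sides, |H_Phi F|^2 <= c |F|^2 becomes |H_Psi psi|^2 <= c
    |psi|^2 once F is chosen, among the vectors with the same L^T F, so that the analytic part of E
    F is no larger than that of Psi psi; c <= t^2 disposes of the surplus |F|^2 - |psi|^2. Such an F
    exists only approximately: L^T H^2 is merely dense in H^2, and the minimum over the admissible F
    need not be attained. A statement about finite-dimensional spaces with an arbitrary error e
    survives these approximations, which is why the essential norm is traded for a dimension count.
    Functions are not identified when equal almost everywhere. L^2 therefore carries a semi-definite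
    form, and projections are linear only up to null vectors; this is why the general lemmas are
    about forms. *)

Section ComplexFacts.
Variable R : realType.
Implicit Types (x y : R[i]) (a : R).

Lemma ReD x y : Re (x + y) = Re x + Re y. Proof. by case: x; case: y. Qed.
Lemma ImD x y : Im (x + y) = Im x + Im y. Proof. by case: x; case: y. Qed.
Lemma ReN x : Re (- x) = - Re x. Proof. by case: x. Qed.
Lemma ImN x : Im (- x) = - Im x. Proof. by case: x. Qed.
Lemma ReM x y : Re (x * y) = Re x * Re y - Im x * Im y.
Proof. by case: x; case: y. Qed.
Lemma ImM x y : Im (x * y) = Re x * Im y + Im x * Re y.
Proof. by case: x; case: y => *; rewrite /= addrC. Qed.
Lemma Re_conjc x : Re x^* = Re x. Proof. by case: x. Qed.
Lemma Im_conjc x : Im x^* = - Im x. Proof. by case: x. Qed.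
Definition ReImE := (ReD, ImD, ReN, ImN, ReM, ImM, Re_conjc, Im_conjc).

Lemma Re_sum (I : Type) (r : seq I) (P : pred I) (F : I -> R[i]) :
  Re (\sum_(i <- r | P i) F i) = \sum_(i <- r | P i) Re (F i).
Proof. by apply: (big_morph _ ReD). Qed.

Lemma complex_eq x y : Re x = Re y -> Im x = Im y -> x = y.
Proof. by case: x; case: y => a b c d /= -> ->. Qed.

Lemma normc_sq x : normc x ^+ 2 = Re x ^+ 2 + Im x ^+ 2.
Proof. by case: x => a b /=; rewrite sqr_sqrtr // addr_ge0 ?sqr_ge0. Qed.

Lemma normc_ge0 x : 0 <= normc x.
Proof. by case: x => a b /=; exact: sqrtr_ge0. Qed.

Lemma mul_conjc x : x * x^* = (normc x ^+ 2)%:C.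
Proof. by rewrite normc_sq; apply: complex_eq; rewrite !ReImE /=; ring. Qed.

Lemma conjcM x y : (x * y)^* = x^* * y^*. Proof. exact: rmorphM. Qed.
Lemma conjcD x y : (x + y)^* = x^* + y^*. Proof. exact: rmorphD. Qed.

Lemma conjcB x y : (x - y)^* = x^* - y^*. Proof. exact: rmorphB. Qed.
Lemma normc_conjc x : normc x^* = normc x.
Proof. by case: x => a b /=; rewrite sqrrN. Qed.

Lemma normc_real a : normc a%:C = `|a|.
Proof. by rewrite /normc /= expr0n addr0 sqrtr_sqr. Qed.

Lemma normc_Re x : `|Re x| <= normc x.
Proof.
rewrite -(@ler_pXn2r _ 2) ?nnegrE ?normc_ge0 ?normr_ge0 //.
by rewrite normc_sq real_normK ?num_real // lerDl sqr_ge0.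
Qed.

Lemma normc_Im x : `|Im x| <= normc x.
Proof.
rewrite -(@ler_pXn2r _ 2) ?nnegrE ?normc_ge0 ?normr_ge0 //.
by rewrite normc_sq real_normK ?num_real // lerDr sqr_ge0.
Qed.

Lemma normc_sum (I : Type) (r : seq I) (P : pred I) (F : I -> R[i]) :
  normc (\sum_(i <- r | P i) F i) <= \sum_(i <- r | P i) normc (F i).
Proof.
elim/big_ind2: _ => //; first by rewrite normc0.
by move=> a b c d h1 h2; apply: le_trans (le_normcD _ _) (lerD h1 h2).
Qed.

(** The factor u = conj(x) / |x| rotates x onto the positive real axis; for x = 0 the value u = 1
    gives 0 <= a. *)
Lemma le_normc_unimodular x a :
  (forall u, normc u = 1 -> Re (u * x) <= a) -> normc x <= a.
Proof.
move=> H; have [x0|nx] := eqVneq x 0.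
  by rewrite x0 normc0; have := H 1 (normc1 _); rewrite x0 mulr0.
have n0 : normc x != 0 by apply: contra_neq nx; exact: eq0_normc.
have := H (x^* / (normc x)%:C); rewrite normcM normc_conjc normcV normc_real.
rewrite ger0_norm ?normc_ge0 // divff // => /(_ erefl).
rewrite mulrAC [x^* * x]mulrC mul_conjc -fmorphV -rmorphM /=.
by rewrite expr2 mulfK.
Qed.

Lemma quadratic_discr (a b c : R) : 0 <= a ->
  (forall t, 0 <= a * t ^+ 2 + b * t *+ 2 + c) -> b ^+ 2 <= a * c.
Proof.
rewrite le_eqVlt => /orP[/eqP<-|a0] H.
  have [->|b0] := eqVneq b 0; first by rewrite expr0n mul0r.
  (* With a = 0 the polynomial is affine, and at this point it equals -1. *)
  have := H (- (c + 1) / (b *+ 2)); rewrite mul0r add0r -mulrnAl.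
  rewrite mulrC divfK; last by rewrite mulrn_eq0.
  by lra.
have := H (- b / a).
have -> : a * (- b / a) ^+ 2 + b * (- b / a) *+ 2 + c = (a * c - b ^+ 2) / a.
  by field; rewrite gt_eqF.
by rewrite pmulr_lge0 ?invr_gt0 // subr_ge0.
Qed.

End ComplexFacts.

(** * Cauchy sequences of real and complex numbers *)

Section Completeness.
Variable R : realType.

Lemma mul_div_addr1_le (e a : R) : 0 <= e -> 0 <= a -> e / (a + 1) * a <= e.
Proof.
by move=> e0 a0; rewrite mulrAC ler_pdivrMr ?ltr_wpDl // ler_wpM2l // lerDl.
Qed.

Lemma invS_small (e : R) : 0 < e ->
  exists N, forall p, (N <= p)%N -> p.+1%:R^-1 <= e.
Proof.
move=> e0; exists (Num.truncn e^-1) => p Np.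
rewrite -(invrK e) lef_pV2 ?posrE ?invr_gt0 //.
by apply: le_trans (ltW (truncnS_gt _)) _; rewrite ler_nat.
Qed.

Lemma real_cauchy_cvg (u : nat -> R) :
  (forall e, 0 < e -> exists N, forall p q, (N <= p)%N -> (N <= q)%N ->
     `|u p - u q| <= e) ->
  exists l, forall e, 0 < e -> exists N, forall p, (N <= p)%N -> `|u p - l| <= e.
Proof.
move=> H; have cu : cvgn u.
  apply/cauchy_cvgP/cauchy_exP => e e0.
  have [N HN] := H _ (divr_gt0 e0 (ltr0Sn R 1)).
  exists (u N); exists N => // p Np; rewrite /ball/=.
  by apply: le_lt_trans (HN _ _ (leqnn N) Np) _; rewrite ltr_pdivrMr // ltr_pMr // ltr1n.
exists (limn u) => e e0; have /cvgrPdist_le/(_ e e0)[N _ HN] := cu.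
by exists N => p Np; rewrite distrC; exact: HN.
Qed.

Lemma complex_cauchy_cvg (u : nat -> R[i]) :
  (forall e, 0 < e -> exists N, forall p q, (N <= p)%N -> (N <= q)%N ->
     normc (u p - u q) <= e) ->
  exists l, forall e, 0 < e ->
    exists N, forall p, (N <= p)%N -> normc (u p - l) <= e.
Proof.
move=> H.
have [a Ha] : exists l, forall e, 0 < e ->
    exists N, forall p, (N <= p)%N -> `|Re (u p) - l| <= e.
  apply: real_cauchy_cvg => e /H[N HN]; exists N => p q Np Nq.
  by rewrite -ReN -ReD; apply: le_trans (normc_Re _) (HN _ _ Np Nq).
have [b Hb] : exists l, forall e, 0 < e ->
    exists N, forall p, (N <= p)%N -> `|Im (u p) - l| <= e.
  apply: real_cauchy_cvg => e /H[N HN]; exists N => p q Np Nq.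
  by rewrite -ImN -ImD; apply: le_trans (normc_Im _) (HN _ _ Np Nq).
exists (a +i* b) => e e0.
have [N HN] := Ha _ (divr_gt0 e0 (ltr0Sn _ 1)).
have [M HM] := Hb _ (divr_gt0 e0 (ltr0Sn _ 1)).
exists (maxn N M) => p Np.
have := HN p (leq_trans (leq_maxl _ _) Np).
have := HM p (leq_trans (leq_maxr _ _) Np) => h1 h2.
rewrite -(@ler_pXn2r _ 2) ?nnegrE ?normc_ge0 // ?(ltW e0) //.
rewrite normc_sq !ReImE /= -[(Re _ - _) ^+ 2]real_normK ?num_real //.
rewrite -[(Im _ - _) ^+ 2]real_normK ?num_real //.
have := normr_ge0 (Im (u p) - b); have := normr_ge0 (Re (u p) - a).
by move: h1 h2; move: `|_| `|_| => s t; nra.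
Qed.

End Completeness.

(** * Hermitian forms and approximate projections *)

Section SesquilinearForms.
Variables (R : realType) (V : lmodType R[i]).
Implicit Types (B : V -> V -> R[i]) (K : set V).

Record hermitian B : Prop := Hermitian {
  hermD : forall x y z, B (x + y) z = B x z + B y z;
  hermZ : forall a x z, B (a *: x) z = a * B x z;
  hermC : forall x y, B y x = (B x y)^* }.

Definition qf B x : R := Re (B x x).

Definition subspace K :=
  [/\ K 0, forall x y, K x -> K y -> K (x + y)
    & forall a x, K x -> K (a *: x)].

Lemma subspaceB K x y : subspace K -> K x -> K y -> K (x - y).
Proof. by case=> k0 kD kZ kx ky; apply: kD => //; rewrite -scaleN1r; apply: kZ. Qed.

Lemma subspaceT : subspace setT. Proof. by []. Qed.

Lemma subspace_sum K (I : Type) (r : seq I) (P : pred I) (F : I -> V) :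
  subspace K -> (forall i, P i -> K (F i)) -> K (\sum_(i <- r | P i) F i).
Proof. by move=> [k0 kD _] kF; elim/big_ind: _. Qed.

Section Herm.
Variables (B : V -> V -> R[i]) (hB : hermitian B).

Lemma herm0l z : B 0 z = 0.
Proof. by rewrite -(scale0r (0 : V)) (hermZ hB) mul0r. Qed.
Lemma hermNl x z : B (- x) z = - B x z.
Proof. by rewrite -scaleN1r (hermZ hB) mulN1r. Qed.
Lemma hermBl x y z : B (x - y) z = B x z - B y z.
Proof. by rewrite (hermD hB) hermNl. Qed.
Lemma hermDr x y z : B z (x + y) = B z x + B z y.
Proof. by rewrite (hermC hB) (hermD hB) rmorphD /= -!(hermC hB). Qed.
Lemma hermZr a x z : B z (a *: x) = a^* * B z x.
Proof. by rewrite (hermC hB) (hermZ hB) rmorphM /= -!(hermC hB). Qed.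
Lemma hermNr x z : B z (- x) = - B z x.
Proof. by rewrite -scaleN1r hermZr rmorphN1 mulN1r. Qed.
Lemma hermBr x y z : B z (x - y) = B z x - B z y.
Proof. by rewrite hermDr hermNr. Qed.
Lemma herm0r z : B z 0 = 0.
Proof. by rewrite (hermC hB) herm0l rmorph0. Qed.
Lemma herm_suml (I : Type) (r : seq I) (P : pred I) (F : I -> V) z :
  B (\sum_(i <- r | P i) F i) z = \sum_(i <- r | P i) B (F i) z.
Proof. by apply: (big_morph (B^~ z)) => [x y|]; rewrite ?(hermD hB) ?herm0l. Qed.
Lemma herm_sumr (I : Type) (r : seq I) (P : pred I) (F : I -> V) z :
  B z (\sum_(i <- r | P i) F i) = \sum_(i <- r | P i) B z (F i).
Proof. by apply: (big_morph (B z)) => [x y|]; rewrite ?hermDr ?herm0r. Qed.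

Lemma hermE x : B x x = (qf B x)%:C.
Proof.
apply: complex_eq => //=; have /(congr1 (@Im R)) := hermC hB x x.
by rewrite Im_conjc; lra.
Qed.

Lemma qfD x y : qf B (x + y) = qf B x + qf B y + Re (B x y) *+ 2.
Proof.
rewrite /qf (hermD hB) !hermDr (hermC hB x y) !ReImE; ring.
Qed.

Lemma qfN x : qf B (- x) = qf B x.
Proof. by rewrite /qf hermNl hermNr opprK. Qed.

Lemma qfB x y : qf B (x - y) = qf B x + qf B y - Re (B x y) *+ 2.
Proof. by rewrite qfD qfN hermNr ReN mulNrn. Qed.

Lemma qfZ a x : qf B (a *: x) = normc a ^+ 2 * qf B x.
Proof.
by rewrite /qf (hermZ hB) hermZr mulrA mul_conjc !ReImE /= mul0r subr0.
Qed.

Lemma qf0 : qf B 0 = 0. Proof. by rewrite /qf herm0l. Qed.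

(** Positivity is asked on K alone because the form in Parrott's theorem is known to be positive on
    two subspaces but not on their sum. *)
Lemma cauchy_schwarz_on K : subspace K -> (forall x, K x -> 0 <= qf B x) ->
  forall x y, K x -> K y -> normc (B x y) ^+ 2 <= qf B x * qf B y.
Proof.
move=> [k0 kD kZ] K0 x y Kx Ky; set w := B x y.
have [->|nw] := eqVneq w 0.
  by rewrite normc0 expr0n mulr_ge0 ?K0.
have n0 : 0 < normc w ^+ 2.
  by rewrite exprn_gt0 // lt0r normc_ge0 andbT; apply: contra_neq nw; exact: eq0_normc.
(* The form at t x + w y; its discriminant gives the claim after cancelling one factor |w|^2. *)
have H (t : R) : 0 <= qf B x * t ^+ 2 + normc w ^+ 2 * t *+ 2 + normc w ^+ 2 * qf B y.
  have := K0 _ (kD _ _ (kZ t%:C _ Kx) (kZ w _ Ky)).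
  rewrite qfD !qfZ (hermZ hB) hermZr normc_real real_normK ?num_real //.
  rewrite -/w [w^* * w]mulrC mul_conjc -rmorphM /=.
  by congr (0 <= _); ring.
have := quadratic_discr (K0 _ Kx) H.
by rewrite expr2 [X in _ <= X]mulrCA ler_pM2l.
Qed.

(* k nearly minimizes the distance from u to K. *)
Lemma almost_projection K u : subspace K ->
  (forall x, K x -> 0 <= qf B x) -> (forall x, K x -> 0 <= qf B (u - x)) ->
  forall e : R, 0 < e -> exists2 k, K k &
    forall y, K y -> normc (B (u - k) y) ^+ 2 <= e * qf B y.
Proof.
move=> [k0 kD kZ] K0 uK e e0; set S := [set qf B (u - x) | x in K].
have hi : has_inf S.
  split; first by exists (qf B (u - 0)), 0.
  by exists 0 => _ [x Kx <-]; exact: uK.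
have [_ [k Kk <-] lk] := inf_adherent e0 hi; exists k => // y Ky.
set w := B (u - k) y; have [->|nw] := eqVneq w 0.
  by rewrite normc0 expr0n mulr_ge0 ?K0 // ltW.
have n0 : 0 < normc w ^+ 2.
  by rewrite exprn_gt0 // lt0r normc_ge0 andbT; apply: contra_neq nw; exact: eq0_normc.
(* Moving k by t w y can lower the value of the form at u - k by at most e; the discriminant of this
   quadratic is the claim up to the factor |w|^2. *)
have H (t : R) : 0 <= (normc w ^+ 2 * qf B y) * t ^+ 2 + (- normc w ^+ 2) * t *+ 2 + e.
  have : inf S <= qf B (u - (k + (t%:C * w) *: y)).
    by apply: ge_inf; [case: hi|exists (k + (t%:C * w) *: y) => //; apply: kD => //; exact: kZ].
  rewrite opprD addrA qfB qfZ hermZr conjcM -mulrA [w^* * _]mulrC -/w.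
  rewrite mul_conjc conjc_real -rmorphM normcM normc_real exprMn real_normK ?num_real //=.
  by move=> h; lra.
have := quadratic_discr (mulr_ge0 (sqr_ge0 _) (K0 _ Ky)) H.
by move=> h; rewrite -(ler_pM2l n0); lra.
Qed.

End Herm.

Definition psd B := hermitian B /\ forall x, 0 <= qf B x.

Section Psd.
Variables (B : V -> V -> R[i]) (hB : psd B).

Lemma cauchy_schwarz x y : normc (B x y) ^+ 2 <= qf B x * qf B y.
Proof.
by apply: (cauchy_schwarz_on hB.1 subspaceT) => // z _; exact: hB.2.
Qed.

Definition nrm B x : R := Num.sqrt (qf B x).

Lemma nrm_ge0 x : 0 <= nrm B x. Proof. exact: sqrtr_ge0. Qed.
Lemma nrm_le (e : R) x : 0 <= e -> qf B x <= e ^+ 2 -> nrm B x <= e.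
Proof.
by move=> e0 h; rewrite /nrm -[e]ger0_norm // -sqrtr_sqr ler_sqrt ?sqr_ge0.
Qed.
Lemma nrm_sq x : nrm B x ^+ 2 = qf B x. Proof. by rewrite sqr_sqrtr // hB.2. Qed.

Lemma normc_form_le x y : normc (B x y) <= nrm B x * nrm B y.
Proof.
rewrite -(@ler_pXn2r _ 2) ?nnegrE ?normc_ge0 ?mulr_ge0 ?nrm_ge0 //.
by rewrite exprMn !nrm_sq cauchy_schwarz.
Qed.

Lemma Re_form_le x y : `|Re (B x y)| <= nrm B x * nrm B y.
Proof. exact: le_trans (normc_Re _) (normc_form_le _ _). Qed.

Lemma nrmD x y : nrm B (x + y) <= nrm B x + nrm B y.
Proof.
rewrite -(@ler_pXn2r _ 2) ?nnegrE ?addr_ge0 ?nrm_ge0 // nrm_sq.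
rewrite (qfD hB.1) sqrrD !nrm_sq addrAC lerD2r lerD2l lerMn2r /=.
exact: le_trans (ler_norm _) (Re_form_le _ _).
Qed.

Lemma nrmN x : nrm B (- x) = nrm B x. Proof. by rewrite /nrm (qfN hB.1). Qed.

Lemma nrmB x y : nrm B (x - y) <= nrm B x + nrm B y.
Proof. by rewrite -(nrmN y) nrmD. Qed.

Lemma nrmZ a x : nrm B (a *: x) = normc a * nrm B x.
Proof. by rewrite /nrm (qfZ hB.1) sqrtrM ?sqr_ge0 // sqrtr_sqr ger0_norm ?normc_ge0. Qed.

Lemma nrm0 : nrm B 0 = 0. Proof. by rewrite /nrm (qf0 hB.1) sqrtr0. Qed.

Lemma nrm_sum (I : Type) (r : seq I) (P : pred I) (F : I -> V) :
  nrm B (\sum_(i <- r | P i) F i) <= \sum_(i <- r | P i) nrm B (F i).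
Proof.
elim/big_ind2: _ => //; first by rewrite nrm0.
by move=> a b c d h1 h2; apply: le_trans (nrmD _ _) (lerD h1 h2).
Qed.

Lemma nrm_dist x y : `|nrm B x - nrm B y| <= nrm B (x - y).
Proof.
rewrite ler_norml; apply/andP; split.
  have := nrmD (y - x) x; rewrite subrK -(nrmN (y - x)) opprB; lra.
have := nrmD (x - y) y; rewrite subrK; lra.
Qed.

Lemma qf_nrm0 x : qf B x = 0 -> nrm B x = 0.
Proof. by rewrite /nrm => ->; rewrite sqrtr0. Qed.

Lemma form0l x y : qf B x = 0 -> B x y = 0.
Proof.
move=> h; apply: eq0_normc; apply/eqP; rewrite eq_le normc_ge0 andbT.
by apply: le_trans (normc_form_le _ _) _; rewrite (qf_nrm0 h) mul0r.
Qed.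

End Psd.

Definition cauchy_form B (u : nat -> V) :=
  forall e : R, 0 < e -> exists N, forall a b, (N <= a)%N -> (N <= b)%N ->
    nrm B (u a - u b) <= e.

Definition cvg_form B (u : nat -> V) l :=
  forall e : R, 0 < e -> exists N, forall a, (N <= a)%N -> nrm B (u a - l) <= e.

Definition complete_form B := forall u, cauchy_form B u -> exists l, cvg_form B u l.

Definition orth B (S : set V) : set V := [set x | forall s, S s -> B x s = 0].

Lemma orth_subspace B S : hermitian B -> subspace (orth B S).
Proof.
move=> hB; split=> [s _|x y Sx Sy s Ss|a x Sx s Ss].
- exact: herm0l.
- by rewrite (hermD hB) Sx ?Sy ?addr0.
- by rewrite (hermZ hB) Sx ?mulr0.
Qed.

Lemma cvg_form_orth B S u l : psd B -> cvg_form B u l ->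
  (forall k, orth B S (u k)) -> orth B S l.
Proof.
move=> hB ul Su s Ss; apply: eq0_normc; apply/eqP; rewrite eq_le normc_ge0 andbT.
apply/ler_addgt0Pr => e e0; rewrite add0r.
have c0 : 0 < nrm B s + 1 by rewrite ltr_wpDl ?nrm_ge0.
have [N HN] := ul (e / (nrm B s + 1)) (divr_gt0 e0 c0).
have -> : B l s = - B (u N - l) s by rewrite (hermBl hB.1) Su // sub0r opprK.
rewrite normcN; apply: le_trans (normc_form_le hB _ _) _.
apply: le_trans (ler_wpM2r (nrm_ge0 _ s) (HN _ (leqnn _))) _.
by apply: mul_div_addr1_le; rewrite ?nrm_ge0 ?ltW.
Qed.

(** Neither completeness nor positivity on the whole space is available, so near-minimizers k p
    replace the projection of u. Testing the residuals u - k p and u - k q on k p - k q, which lies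
    in K, controls their mutual distance. *)
Lemma projection_seq B K u : hermitian B -> subspace K ->
  (forall x, K x -> 0 <= qf B x) -> (forall x, K x -> 0 <= qf B (u - x)) ->
  exists k : nat -> V, [/\ forall p, K (k p),
    forall p y, K y -> normc (B (u - k p) y) <= p.+1%:R^-1 * nrm B y &
    forall p q, nrm B (k p - k q) <= p.+1%:R^-1 + q.+1%:R^-1].
Proof.
move=> hB sK K0 uK.
have /choice[k kP] : forall p : nat, exists k, K k /\
    forall y, K y -> normc (B (u - k) y) <= p.+1%:R^-1 * nrm B y.
  move=> p; have e0 : (0 : R) < p.+1%:R^-1 ^+ 2 by rewrite exprn_gt0 ?invr_gt0 ?ltr0n.
  have [k Kk kP] := almost_projection hB sK K0 uK e0.
  exists k; split=> // y Ky.
  rewrite -(@ler_pXn2r _ 2) ?nnegrE ?normc_ge0 ?mulr_ge0 ?nrm_ge0 ?invr_ge0 //.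
  by rewrite exprMn [nrm B y ^+ 2]sqr_sqrtr ?K0 //; exact: kP.
exists k; split=> [p|p y|p q]; [exact: (kP p).1|exact: (kP p).2|].
set d := _ - _; have Kd : K d by apply: (subspaceB sK); [exact: (kP p).1|exact: (kP q).1].
have [->|nd] := eqVneq (nrm B d) 0; first by rewrite addr_ge0 ?invr_ge0.
have nd0 : 0 < nrm B d by rewrite lt0r nd nrm_ge0.
rewrite -(ler_pM2r nd0) -expr2 [nrm B d ^+ 2]sqr_sqrtr ?K0 // /qf.
have -> : B d d = B (u - k q) d - B (u - k p) d.
  by rewrite -(hermBl hB); congr (B _ d); rewrite opprB addrC addrA subrK.
apply: le_trans (ler_norm _) (le_trans (normc_Re _) (le_trans (le_normcD _ _) _)).
rewrite normcN mulrDl addrC; apply: lerD; [exact: (kP p).2|exact: (kP q).2].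
Qed.

(** K need not be closed, so the projection l is only a limit of elements of K. *)
Lemma projection_lim B K u : psd B -> complete_form B -> subspace K ->
  exists k l, [/\ forall p : nat, K (k p), cvg_form B k l &
    forall y, K y -> B (u - l) y = 0].
Proof.
move=> hB cB sK.
have [k [Kk kP kk]] := projection_seq hB.1 sK (fun x _ => hB.2 x) (fun x _ => hB.2 (u - x)).
have [|l lP] := cB k.
  move=> e e0; have [N NP] := invS_small (divr_gt0 e0 (ltr0Sn R 1)).
  by exists N => a b Na Nb; apply: le_trans (kk a b) _; rewrite (splitr e) lerD // NP.
exists k, l; split=> // y Ky; apply: eq0_normc; apply/eqP; rewrite eq_le normc_ge0 andbT.
apply/ler_addgt0Pr => e e0; rewrite add0r.
have e1 : 0 < e / 2%:R / (nrm B y + 1) by rewrite !divr_gt0 // ltr_wpDl ?nrm_ge0.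
have [N NP] := lP _ e1; have [M MP] := invS_small e1.
set p := maxn N M; have -> : u - l = (u - k p) + (k p - l) by rewrite addrA subrK.
rewrite (hermD hB.1); apply: le_trans (le_normcD _ _) _; rewrite (splitr e).
have key x : x <= e / 2%:R / (nrm B y + 1) -> x * nrm B y <= e / 2%:R.
  move=> xe; apply: le_trans (ler_wpM2r (nrm_ge0 _ _) xe) _.
  by apply: mul_div_addr1_le; rewrite ?nrm_ge0 // divr_ge0 // ltW.
apply: lerD; first by apply: le_trans (kP _ _ Ky) (key _ _); rewrite MP // leq_maxr.
by apply: le_trans (normc_form_le hB _ _) (key _ _); rewrite NP // leq_maxl.
Qed.

Lemma projection_orth B S : psd B -> complete_form B -> forall x,
  exists2 p, orth B S p & forall y, orth B S y -> B (x - p) y = 0.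
Proof.
move=> hB cB x; have [k [l [Kk kl xl]]] := projection_lim x hB cB (orth_subspace S hB.1).
by exists l => //; exact: cvg_form_orth kl Kk.
Qed.

(** The residual u - l is orthogonal to K, hence to the limit l; by hypothesis it is then orthogonal
    to u as well, so it is null. *)
Lemma orth_dense B K u : psd B -> complete_form B -> subspace K ->
  (forall w, orth B K w -> B u w = 0) ->
  forall e : R, 0 < e -> exists2 k, K k & nrm B (u - k) <= e.
Proof.
move=> hB cB sK uK e e0; have [k [l [Kk kl ul]]] := projection_lim u hB cB sK.
have ul0 : qf B (u - l) = 0.
  have lul : orth B [set u - l] l.
    by apply: cvg_form_orth kl _ => // p _ ->; rewrite (hermC hB.1) ul ?rmorph0.
  by rewrite /qf (hermBl hB.1) (uK _ ul) lul // subr0.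
have [N NP] := kl _ e0; exists (k N); first exact: Kk.
have -> : u - k N = (u - l) - (k N - l) by rewrite opprB addrA subrK.
by apply: le_trans (nrmB hB _ _) _; rewrite (qf_nrm0 ul0) add0r NP.
Qed.

End SesquilinearForms.

(** * Parrott's theorem *)

Section Parrott.
Variables (R : realType) (V : lmodType R[i]) (B : V -> V -> R[i]).
Hypothesis hB : hermitian B.
Variables (K : set V) (n m : nat) (e : 'I_n -> V) (f : 'I_m -> V).
Hypothesis sK : subspace K.
Local Notation comb g x := (\sum_i x i *: g i).
Hypothesis Ke_ge0 : forall k x, K k -> 0 <= qf B (k + comb e x).
Hypothesis Kf_ge0 : forall k x, K k -> 0 <= qf B (k + comb f x).

Let K_ge0 k : K k -> 0 <= qf B k.
Proof.
move=> Kk; have := Ke_ge0 (fun=> 0) Kk; rewrite big1 ?addr0 // => i _.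
by rewrite scale0r.
Qed.

Let approx : exists k : nat -> 'I_n -> V,
  [/\ forall p i, K (k p i),
      forall p i y, K y -> normc (B (e i - k p i) y) <= p.+1%:R^-1 * nrm B y &
      forall p q i, nrm B (k p i - k q i) <= p.+1%:R^-1 + q.+1%:R^-1].
Proof.
have eK i x : K x -> 0 <= qf B (e i - x).
  move=> Kx; have ec : e i = comb e (fun j => (j == i)%:R).
    rewrite (bigD1 i) //= eqxx scale1r big1 ?addr0 // => j /negbTE ->.
    by rewrite scale0r.
  rewrite addrC [e i]ec; apply: Ke_ge0.
  by rewrite -scaleN1r; case: sK => _ _; apply.
have /choice[k kP] := fun i => projection_seq hB sK K_ge0 (eK i).
exists (fun p i => k i p); split=> [p i|p i|p q i]; have [k1 k2 k3] := kP i;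
  [exact: k1|exact: k2|exact: k3].
Qed.

Let approxE (k : 'I_n -> V) p x y :
  (forall i y, K y -> normc (B (e i - k i) y) <= p.+1%:R^-1 * nrm B y) -> K y ->
  normc (B (comb e x - comb k x) y) <= p.+1%:R^-1 * (\sum_i normc (x i)) * nrm B y.
Proof.
move=> Hk Ky; rewrite -sumrB herm_suml //.
apply: le_trans (normc_sum _ _ _) _; rewrite mulr_sumr mulr_suml.
apply: ler_sum => i _; rewrite -scalerBr (hermZ hB) normcM.
by rewrite [p.+1%:R^-1 * _]mulrC -mulrA ler_wpM2l ?normc_ge0 //; exact: Hk.
Qed.

(* The corrected value of B(e_i, f_j) is B(P e_i, f_j), where P is the projection
   onto K for B; P exists only approximately, hence the limit in the proof. *)
Lemma parrott : exists X : 'M[R[i]]_(n, m), forall k x y, K k ->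
  0 <= qf B (k + comb e x + comb f y)
       + Re (\sum_i \sum_j x i * (y j)^* * X i j) *+ 2.
Proof.
have [k [Kk Hk Hd]] := approx.
(* The form is positive on K + span f, and Cauchy-Schwarz there makes B(k p i, f j) a Cauchy
   sequence in p. *)
pose KF : set V := [set v | exists2 a, K a & exists y, v = a + comb f y].
have sKF : subspace KF.
  have [k0 kD kZ] := sK; split.
  - by exists 0 => //; exists (fun=> 0); rewrite big1 ?addr0 // => i _; rewrite scale0r.
  - move=> _ _ [a Ka [y ->]] [b Kb [z ->]]; exists (a + b); first exact: kD.
    exists (fun i => y i + z i); rewrite addrACA -big_split /=; congr (_ + _).
    by apply: eq_bigr => i _; rewrite scalerDl.
  - move=> c _ [a Ka [y ->]]; exists (c *: a); first exact: kZ.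
    exists (fun i => c * y i); rewrite scalerDr scaler_sumr; congr (_ + _).
    by apply: eq_bigr => i _; rewrite scalerA.
have KF_ge0 v : KF v -> 0 <= qf B v by move=> [a Ka [y ->]]; exact: Kf_ge0.
have KFf j : KF (f j).
  exists 0; first by case: sK.
  exists (fun l => (l == j)%:R); rewrite add0r (bigD1 j) //= eqxx scale1r.
  by rewrite big1 ?addr0 // => l /negbTE ->; rewrite scale0r.
have KFk a : K a -> KF a.
  move=> Ka; exists a => //; exists (fun=> 0).
  by rewrite big1 ?addr0 // => i _; rewrite scale0r.
have Xl i j : exists l, forall e0, 0 < e0 -> exists N, forall p, (N <= p)%N ->
    normc (B (k p i) (f j) - l) <= e0.
  apply: complex_cauchy_cvg => e0 e0_gt0.
  set c := nrm B (f j) + 1; have c0 : 0 < c by rewrite ltr_wpDl ?nrm_ge0.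
  have e1 : 0 < e0 / c / 2 by rewrite !divr_gt0.
  have [N HN] := invS_small e1; exists N => p q Np Nq.
  rewrite -(hermBl hB).
  have h : normc (B (k p i - k q i) (f j)) <= nrm B (k p i - k q i) * nrm B (f j).
    rewrite -(@ler_pXn2r _ 2) ?nnegrE ?normc_ge0 ?mulr_ge0 ?nrm_ge0 //.
    have Kd : KF (k p i - k q i) by apply: KFk; apply: (subspaceB sK).
    rewrite exprMn ![nrm B _ ^+ 2]sqr_sqrtr ?KF_ge0 //.
    exact: (cauchy_schwarz_on hB sKF KF_ge0).
  apply: le_trans h _; apply: le_trans (_ : e0 / c * c <= _); last first.
    by rewrite divfK // gt_eqF.
  apply: ler_pM; rewrite ?nrm_ge0 //; last by rewrite lerDl.
  apply: le_trans (Hd p q i) _; move: (HN p Np) (HN q Nq).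
  by move: (p.+1%:R^-1) (q.+1%:R^-1) (e0 / c) => r s t; lra.
have [X0 HX0] : exists X0 : 'I_n -> 'I_m -> R[i], forall i j e0, 0 < e0 ->
    exists N, forall p, (N <= p)%N -> normc (B (k p i) (f j) - X0 i j) <= e0.
  have [X0 HX] := choice (fun ij : 'I_n * 'I_m => Xl ij.1 ij.2).
  by exists (fun i j => X0 (i, j)) => i j; exact: (HX (i, j)).
(* [X0 i j] is the limit of B(k p i, f j). The conclusion adds X to the given form, so the present
   value B(e i, f j) is subtracted. *)
exists (\matrix_(i, j) (X0 i j - B (e i) (f j))) => a x y Ka.
set ex := comb e x; set fy := comb f y; set D := Re (\sum_i _).
pose cx := \sum_i normc (x i); pose cy := \sum_j normc (y j).
have cx0 : 0 <= cx by apply: sumr_ge0 => i _; exact: normc_ge0.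
have cy0 : 0 <= cy by apply: sumr_ge0 => i _; exact: normc_ge0.
have ex0 : 0 <= qf B ex.
  by rewrite -(add0r ex); apply: Ke_ge0; case: sK.
(* The total error will be 2 d M; the summand [qf B ex + 3] bounds the norm of [kap], the
   approximate projection of [ex] on K. *)
pose M := nrm B a + qf B ex + 3%:R + cy.
have M0 : 0 <= M by rewrite !addr_ge0 ?nrm_ge0.
apply/ler_addgt0Pr => eps eps0.
pose d := Num.min 1 (eps / (2%:R * (M + 1))).
have d0 : 0 < d.
  by rewrite lt_min ltr01 divr_gt0 // mulr_gt0 // ltr_wpDl.
have d1 : 0 < d / (cx + 1) by rewrite divr_gt0 // ltr_wpDl.
have [N1 HN1] := invS_small d1.
have [N2 HN2] : exists N, forall p, (N <= p)%N -> forall i j,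
    normc (B (k p i) (f j) - X0 i j) <= d / (cx + 1).
  have /choice[N HN] : forall ij : 'I_n * 'I_m, exists N, forall p, (N <= p)%N ->
    normc (B (k p ij.1) (f ij.2) - X0 ij.1 ij.2) <= d / (cx + 1) by move=> ij; exact: HX0.
  exists (\max_ij N ij) => p Np i j; apply: (HN (i, j)).
  exact: leq_trans (leq_bigmax _) Np.
pose p := maxn N1 N2; pose kap := comb (k p) x.
have Kkap : K kap.
  have [_ _ kZ] := sK.
  exact: (@subspace_sum R V K _ _ xpredT _ sK (fun i _ => kZ _ _ (Kk p i))).
set r := ex - kap.
have dc : d / (cx + 1) * cx <= d.
  by rewrite -mulrA ger_pMr // mulrC ler_pdivrMr ?mul1r ?lerDl // ltr_wpDl.
have hp : p.+1%:R^-1 * cx <= d.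
  exact: le_trans (ler_wpM2r cx0 (HN1 p (leq_maxl _ _))) dc.
have Hr v : K v -> normc (B r v) <= d * nrm B v.
  move=> Kv; apply: le_trans (approxE x (Hk p) Kv) _.
  by apply: ler_wpM2r => //; exact: nrm_ge0.
have r0 : 0 <= qf B r.
  rewrite /r addrC; apply: Ke_ge0; rewrite -scaleN1r.
  by case: sK => _ _; apply.
have nk : nrm B kap <= qf B ex + 3%:R.
  have := Hr _ Kkap; have dle1 : d <= 1 by rewrite ge_min lexx.
  have := normc_Re (B r kap); have := qfD hB r kap; rewrite /r subrK -/r.
  have := sqr_sqrtr (K_ge0 Kkap); have := nrm_ge0 B kap.
  rewrite -[Num.sqrt _]/(nrm B kap) => t0 <-.
  move: ex0 r0 => + + -> /[!ler_norml] /andP[+ _].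
  move: (qf B r) (Re _) (normc _) (nrm B kap) t0 => qr rb nb t t0.
  move=> h1 h2 h3 h4; rewrite leNgt; apply/negP => ht.
  have dt : d * t <= t by rewrite ger_pMl //; nra.
  by move: (sqr_ge0 (t *+ 2 - 3%:R)) h2 h3 h4 ht dt; move: (d * t) => dt; nra.
have shuffle (u v w z : V) : u + v + w = (v - z) + (u + z + w).
  by rewrite addrA [v - z + _]addrC -[u + z + _]addrA [z + _]addrC subrK.
(* The residual [r] is nearly orthogonal to K, and its pairing with [fy] is nearly cancelled by X.
   What remains is the sum of the nonnegative values of the form at [r] and at [a + kap + fy]. *)
rewrite (shuffle a ex fy kap) -/r.
rewrite (qfD hB) !(hermDr hB).
have w0 : 0 <= qf B (a + kap + fy).
  by apply: Kf_ge0; case: sK => _ kD _; apply: kD.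
have hD : `|D + Re (B r fy)| <= d * cy.
  rewrite /D -ReD; apply: le_trans (normc_Re _) _.
  have -> : B r fy =
      \sum_i \sum_j x i * (y j)^* * (B (e i) (f j) - B (k p i) (f j)).
    rewrite /r -sumrB herm_suml //; apply: eq_bigr => i _.
    rewrite herm_sumr //; apply: eq_bigr => j _.
    by rewrite -scalerBr (hermZ hB) (hermZr hB) (hermBl hB); ring.
  rewrite -big_split /=; apply: le_trans (normc_sum _ _ _) _.
  apply: le_trans (_ : \sum_i d / (cx + 1) * (normc (x i) * cy) <= _); last first.
    by rewrite -mulr_sumr -mulr_suml mulrA ler_wpM2r.
  apply: ler_sum => i _; rewrite -big_split /=.
  apply: le_trans (normc_sum _ _ _) _; rewrite /cy mulrA mulr_sumr.
  apply: ler_sum => j _; rewrite mxE.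
  have -> : x i * (y j)^* * (X0 i j - B (e i) (f j))
      + x i * (y j)^* * (B (e i) (f j) - B (k p i) (f j))
    = x i * (y j)^* * - (B (k p i) (f j) - X0 i j) by ring.
  rewrite !normcM normcN normc_conjc mulrC mulrA ler_wpM2r ?normc_ge0 //.
  by rewrite ler_wpM2r ?normc_ge0 // HN2 // leq_maxr.
have b1 := Hr _ Ka; have b2 := Hr _ Kkap.
have b3 := normc_Re (B r a); have b4 := normc_Re (B r kap).
rewrite !ReD.
have dM : d * M *+ 2 <= eps.
  have : d <= eps / (2%:R * (M + 1)) by rewrite ge_min lexx orbT.
  by rewrite ler_pdivlMr ?mulr_gt0 ?ltr_wpDl //; lra.
have dk : d * nrm B kap <= d * (qf B ex + 3%:R) by rewrite ler_wpM2l // ltW.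
move: dM hD b3 b4; rewrite /M !ler_norml => dM /andP[? ?] /andP[? ?] /andP[? ?].
lra.
Qed.

End Parrott.

(** * Attaining the norm of a form *)

Section MaximizingVector.
Variable R : realType.

Lemma bounded_subseq (u : nat -> R) (M : R) : (forall p, `|u p| <= M) ->
  exists2 g : nat -> nat, (forall p q, (p <= q)%N -> (g p <= g q)%N) /\
    (forall p, (p <= g p)%N) &
    exists l, forall e, 0 < e -> exists N, forall p, (N <= p)%N ->
      `|u (g p) - l| <= e.
Proof.
move=> uM; have [|g /increasing_seqP gi cg] := @bolzano_weierstrass R u.
  exists M; split; first exact: num_real.
  by move=> y My x _ /=; apply: le_trans (uM x) (ltW My).
have gm p q : (p <= q)%N -> (g p <= g q)%N.
  elim: q => [|q IH]; first by rewrite leqn0 => /eqP->.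
  rewrite leq_eqVlt => /orP[/eqP->//|]; rewrite ltnS => /IH h.
  exact: leq_trans h (ltnW (gi q)).
exists g; first split=> //.
  by elim=> // p IH; exact: leq_ltn_trans IH (gi p).
exists (limn (u \o g)) => e e0.
have /cvgrPdist_le/(_ e e0)[N _ HN] := cg.
by exists N => p Np; rewrite distrC; exact: HN.
Qed.

Lemma bounded_subseq_complex (k : nat) (s : nat -> 'I_k -> R[i]) (M : R) :
  (forall p i, normc (s p i) <= M) ->
  exists2 g : nat -> nat, (forall p q, (p <= q)%N -> (g p <= g q)%N) /\
    (forall p, (p <= g p)%N) &
    forall e, 0 < e -> exists N, forall p q i, (N <= p)%N -> (N <= q)%N ->
      normc (s (g p) i - s (g q) i) <= e.
Proof.
elim: k s => [|k IH] s sM.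
  by exists id => // e e0; exists 0 => p q [].
have [g1 [g1m g1i] H1] := IH (fun p i => s p (lift ord0 i)) (fun p i => sM p _).
have [p|g2 [g2m g2i] [a Ha]] := @bounded_subseq (fun p => Re (s (g1 p) ord0)) M.
  exact: le_trans (normc_Re _) (sM _ _).
have [p|g3 [g3m g3i] [b Hb]] := @bounded_subseq (fun p => Im (s (g1 (g2 p)) ord0)) M.
  exact: le_trans (normc_Im _) (sM _ _).
exists (g1 \o g2 \o g3) => /=; first split.
- by move=> p q pq; apply/g1m/g2m/g3m.
- by move=> p; apply: leq_trans (g1i _); apply: leq_trans (g2i _).
move=> e e0; have e4 : 0 < e / 4%:R by rewrite divr_gt0.
have [N1 HN1] := H1 _ e0; have [N2 HN2] := Ha _ e4; have [N3 HN3] := Hb _ e4.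
exists (maxn N1 (maxn N2 N3)) => p q i.
rewrite !geq_max => /and3P[p1 p2 p3] /and3P[q1 q2 q3].
case: (unliftP ord0 i) => [j ->|->].
  apply: HN1.
    by apply: leq_trans p1 _; apply: leq_trans (g3i _) (g2i _).
  by apply: leq_trans q1 _; apply: leq_trans (g3i _) (g2i _).
set z := _ - _; rewrite (_ : z = Re z +i* Im z); last by case: z.
have -> : Re z +i* Im z = (Re z)%:C + 0 +i* Im z.
  by apply: complex_eq; rewrite !ReImE /= ?addr0 ?add0r.
apply: le_trans (le_normcD _ _) _; rewrite normc_real.
have -> : normc (0 +i* Im z) = `|Im z| by rewrite /= expr0n add0r sqrtr_sqr.
have := HN2 _ (leq_trans p2 (g3i p)); have := HN2 _ (leq_trans q2 (g3i q)).
have := HN3 _ p3; have := HN3 _ q3.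
have -> : Re z = Re (s (g1 (g2 (g3 p))) ord0) - Re (s (g1 (g2 (g3 q))) ord0).
  by rewrite /z !ReImE.
have -> : Im z = Im (s (g1 (g2 (g3 p))) ord0) - Im (s (g1 (g2 (g3 q))) ord0).
  by rewrite /z !ReImE.
set x1 := Re (s (g1 (g2 (g3 p))) ord0); set x2 := Re (s (g1 (g2 (g3 q))) ord0).
set y1 := Im (s (g1 (g2 (g3 p))) ord0); set y2 := Im (s (g1 (g2 (g3 q))) ord0).
move=> h1 h2 h3 h4.
have hr : `|x1 - x2| <= e / 2%:R.
  rewrite -(subrKA a); apply: le_trans (ler_normD _ _) _.
  by rewrite [`|a - x2|]distrC; move: h3 h4; move: `|_| `|_| => ? ?; lra.
have hi : `|y1 - y2| <= e / 2%:R.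
  rewrite -(subrKA b); apply: le_trans (ler_normD _ _) _.
  by rewrite [`|b - y2|]distrC; move: h1 h2; move: `|_| `|_| => ? ?; lra.
by move: hr hi; move: `|_| `|_| => ? ?; lra.
Qed.

Variables (V : lmodType R[i]) (B H : V -> V -> R[i]).

(* A dimension-count form of the bound c on the essential spectrum of H with
   respect to B: no (N+1)-dimensional space on which H > c B. *)
Definition dim_bound (c : R) (N : nat) := forall (F : 'I_N.+1 -> V) (e : R), 0 < e ->
  exists2 x : 'I_N.+1 -> R[i], \sum_i normc (x i) ^+ 2 = 1 &
    qf H (\sum_i x i *: F i) <= c * qf B (\sum_i x i *: F i) + e.

Hypotheses (hB : psd B) (hH : psd H).

Definition excess (c : R) x y := H x y - c%:C * B x y.

Lemma excess_herm c : hermitian (excess c).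
Proof.
have [hB1 _] := hB; have [hH1 _] := hH; rewrite /excess; split=> *.
- by rewrite (hermD hB1) (hermD hH1); ring.
- by rewrite (hermZ hB1) (hermZ hH1); ring.
- by rewrite (hermC hB1) (hermC hH1) conjcB conjcM conjc_real.
Qed.

Lemma qf_excess c x : qf (excess c) x = qf H x - c * qf B x.
Proof. by rewrite /qf /excess !ReImE /= mul0r subr0. Qed.

(* A maximal family orthonormal for the form [excess c], where H exceeds c B, has
   at most N members; orthogonally to it H <= c B. *)
Lemma dim_bound_functionals c N : dim_bound c N ->
  exists k (y : 'I_k -> V), forall x,
    qf H x <= c * qf B x + \sum_i normc (excess c x (y i)) ^+ 2.
Proof.
move=> D; have hX := excess_herm c.
pose P k := exists y : 'I_k -> V, forall i j, excess c (y i) (y j) = (i == j)%:R.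
have qfsum k (y : 'I_k -> V) (x : 'I_k -> R[i]) :
    (forall i j, excess c (y i) (y j) = (i == j)%:R) ->
    qf (excess c) (\sum_i x i *: y i) = \sum_i normc (x i) ^+ 2.
  move=> Hy; rewrite /qf (herm_suml hX) Re_sum; apply: eq_bigr => i _.
  rewrite (hermZ hX) (herm_sumr hX) (bigD1 i) //= (hermZr hX) Hy eqxx mulr1.
  rewrite big1 ?addr0 ?mul_conjc // => j ji.
  by rewrite (hermZr hX) Hy eq_sym (negbTE ji) mulr0.
have [k [Pk nPk]] : exists k, P k /\ ~ P k.+1.
  apply: contrapT => nk.
  have PA k : P k.
    elim: k => [|k IH]; first by exists (fun=> 0) => -[].
    by apply: contrapT => nP; apply: nk; exists k.
  (* On an orthonormal family of N + 1 vectors [excess c] equals 1 at every unit combination,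
     whereas [dim_bound] provides one where it is at most 1/2. *)
  have [y Hy] := PA N.+1; have e0 : (0 : R) < 2^-1 by rewrite invr_gt0.
  have [x x1 Hx] := D y _ e0; have := qfsum _ y x Hy.
  by rewrite qf_excess x1; lra.
have [y Hy] := Pk; exists k, y => x.
pose z := \sum_i excess c x (y i) *: y i; pose x' := x - z.
have x'y j : excess c x' (y j) = 0.
  rewrite (hermBl hX) (herm_suml hX) (bigD1 j) //= (hermZ hX) Hy eqxx mulr1.
  rewrite big1 ?addr0 ?subrr // => i ij.
  by rewrite (hermZ hX) Hy (negbTE ij) mulr0.
(* Otherwise x', once normalized, would enlarge the family. *)
have q0 : qf (excess c) x' <= 0.
  rewrite leNgt; apply/negP => q0; apply: nPk.
  pose s := (Num.sqrt (qf (excess c) x'))^-1.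
  have sq : s ^+ 2 * qf (excess c) x' = 1.
    by rewrite exprVn sqr_sqrtr ?mulVf // ?ltW // gt_eqF.
  exists (fun i => if unlift ord0 i is Some j then y j else s%:C *: x') => i j.
  case: (unliftP ord0 i) => [i' ->|->]; case: (unliftP ord0 j) => [j' ->|->].
  - by rewrite Hy (inj_eq (@lift_inj _ _)).
  - by rewrite (hermZr hX) (hermC hX) x'y rmorph0 mulr0 eq_sym (negbTE (neq_lift _ _)).
  - by rewrite (hermZ hX) x'y mulr0 (negbTE (neq_lift _ _)).
  - rewrite (hermZ hX) (hermZr hX) (hermE hX) conjc_real -!rmorphM mulrA -expr2 sq.
    by rewrite eqxx.
have : qf (excess c) x = qf (excess c) x' + \sum_i normc (excess c x (y i)) ^+ 2.
  rewrite -[in LHS](subrK z x) -/x' (qfD hX) qfsum //.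
  have -> : excess c x' z = 0.
    by rewrite (herm_sumr hX) big1 // => i _; rewrite (hermZr hX) x'y mulr0.
  by rewrite mul0rn addr0.
by rewrite qf_excess; lra.
Qed.

(* Along a maximizing sequence tB - H tends to 0, and the finitely many functionals
   of [dim_bound_functionals] converge after extraction; together they dominate
   (t - c) B, so the extracted sequence is Cauchy for B. *)
Lemma form_attains (c t : R) N : complete_form B -> c < t ->
  (forall x, qf H x <= t * qf B x) ->
  (forall e, 0 < e -> exists2 a, qf B a = 1 & t - e <= qf H a) ->
  dim_bound c N -> exists2 a, qf B a = 1 & qf H a = t.
Proof.
move=> cB ct Ht Hmax D.
have [k [y Hy]] := dim_bound_functionals D.
have /choice[a Ha] : forall p : nat, exists a, qf B a = 1 /\ t - p.+1%:R^-1 <= qf H a.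
  move=> p; have e0 : (0 : R) < p.+1%:R^-1 by rewrite invr_gt0.
  by have [a a1 a2] := Hmax _ e0; exists a.
pose q x y := t%:C * B x y - H x y.
have hq : psd q.
  split; last by move=> x; rewrite /qf /q !ReImE /= mul0r subr0 subr_ge0; exact: Ht.
  have [hB1 _] := hB; have [hH1 _] := hH; rewrite /q; split=> *.
  - by rewrite (hermD hB1) (hermD hH1); ring.
  - by rewrite (hermZ hB1) (hermZ hH1); ring.
  - by rewrite (hermC hB1) (hermC hH1) conjcB conjcM conjc_real.
have qfq x : qf q x = t * qf B x - qf H x.
  by rewrite /qf /q !ReImE /= mul0r subr0.
have qa p : qf q (a p) <= p.+1%:R^-1.
  by have [a1 a2] := Ha p; rewrite qfq a1; move: a2; move: (_%:R^-1) => r; lra.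
have nBa p : nrm B (a p) = 1 by rewrite /nrm (Ha p).1 sqrtr1.
have hX := excess_herm c.
pose M := \sum_i (nrm H (y i) * nrm H (y i) + `|t| + `|c| * nrm B (y i) + nrm H (y i) ^+ 2).
have Hle p : nrm H (a p) ^+ 2 <= `|t|.
  by rewrite nrm_sq //; have := Ht (a p); rewrite (Ha p).1 mulr1 => /le_trans; apply; exact: ler_norm.
have sM p i : normc (excess c (a p) (y i)) <= M.
  apply: le_trans (_ : nrm H (y i) * nrm H (y i) + `|t| + `|c| * nrm B (y i) + nrm H (y i) ^+ 2 <= M).
    rewrite /excess; apply: le_trans (le_normcD _ _) _; rewrite normcN normcM normc_real.
    have h1 := normc_form_le hH (a p) (y i); have h2 := normc_form_le hB (a p) (y i).
    rewrite nBa mul1r in h2.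
    have h3 : `|c| * normc (B (a p) (y i)) <= `|c| * nrm B (y i) by rewrite ler_wpM2l.
    have h4 := sqr_ge0 (nrm H (a p) - nrm H (y i)).
    have := Hle p; have := nrm_ge0 H (a p); have := nrm_ge0 H (y i).
    by move: h1 h3 h4; move: (normc _) (nrm H _) (nrm H _) (`|c| * _) (`|c| * _) `|t| => *; nra.
  rewrite /M (bigD1 i) //= lerDl; apply: sumr_ge0 => j _.
  by rewrite !addr_ge0 ?mulr_ge0 ?sqr_ge0 ?nrm_ge0.
have [g [gm gi] Hg] := bounded_subseq_complex sM.
pose b p := a (g p).
have qb p : qf q (b p) <= p.+1%:R^-1.
  apply: le_trans (qa _) _; rewrite lef_pV2 ?posrE //.
  by rewrite ler_nat ltnS; exact: gi.
have cb : cauchy_form B b.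
  move=> e e0; set d := (t - c) * e ^+ 2.
  have d0 : 0 < d by rewrite mulr_gt0 ?exprn_gt0 ?subr_gt0.
  have [N1 HN1] := invS_small (divr_gt0 d0 (ltr0Sn _ 7)).
  have k0 : 0 < Num.min 1 (d / 2 / (k%:R + 1)).
    by rewrite lt_min ltr01 !divr_gt0 // ltr_wpDl.
  have [N2 HN2] := Hg _ k0.
  exists (maxn N1 N2) => i j.
  rewrite !geq_max => /andP[i1 i2] /andP[j1 j2].
  (* Parallelogram bound: q is nonnegative at the sum, so at the difference it is at most twice the
     sum of its values at b i and b j. *)
  have hqd : qf q (b i - b j) <= d / 2.
    have := hq.2 (b i + b j); rewrite (qfD hq.1) (qfB hq.1).
    have := qb i; have := qb j; have := HN1 i i1; have := HN1 j j1.
    by move: (_%:R^-1) (_%:R^-1) => r s; lra.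
  have hs : \sum_l normc (excess c (b i - b j) (y l)) ^+ 2 <= d / 2.
    apply: le_trans (_ : \sum_(l < k) (d / 2 / (k%:R + 1)) <= _).
      apply: ler_sum => l _; rewrite (hermBl hX).
      have := HN2 _ _ l i2 j2; rewrite le_min => /andP[h1 h2].
      by apply: le_trans h2; rewrite expr2 ler_piMl ?normc_ge0.
    rewrite sumr_const card_ord -(mulr_natr (d / 2 / (k%:R + 1))) -mulrA ger_pMr ?divr_gt0 //.
    by rewrite mulrC ler_pdivrMr ?mul1r ?lerDl // ltr_wpDl.
  (* From H <= c B + (sum of squared functionals), the value of q = t B - H at b i - b j is at least
     (t - c) |b i - b j|^2 minus that sum. *)
  have := Hy (b i - b j); move: hqd; rewrite qfq => h1 h2.
  apply: nrm_le; first exact: ltW.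
  by rewrite -(ler_pM2l (_ : 0 < t - c)) ?subr_gt0 // -/d; lra.
have [l Hl] := cB _ cb.
have t0 : 0 <= t by apply: le_trans (hH.2 (a 0)) _; have := Ht (a 0); rewrite (Ha 0).1 mulr1.
have nl : nrm B l = 1.
  apply/eqP; rewrite -subr_eq0 -normr_le0; apply/ler_addgt0Pr => e e0; rewrite add0r.
  have [N1 HN1] := Hl _ e0; rewrite -(nBa (g N1)) distrC.
  exact: le_trans (nrm_dist hB _ _) (HN1 _ (leqnn _)).
have ql : nrm q l = 0.
  apply/eqP; rewrite eq_le nrm_ge0 andbT; apply/ler_addgt0Pr => e e0; rewrite add0r.
  have e2 : 0 < e / 2 by rewrite divr_gt0.
  have s0 : 0 < Num.sqrt t + 1 by rewrite ltr_wpDl ?sqrtr_ge0.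
  have [N1 HN1] := Hl _ (divr_gt0 e2 s0).
  have [N2 HN2] := invS_small (exprn_gt0 2 e2).
  pose r := maxn N1 N2.
  have -> : l = b r - (b r - l) by rewrite opprB addrC subrK.
  apply: le_trans (nrmB hq _ _) _.
  have h1 : nrm q (b r) <= e / 2.
    apply: nrm_le; first exact: ltW.
    exact: le_trans (qb r) (HN2 _ (leq_maxr _ _)).
  have h2 : nrm q (b r - l) <= Num.sqrt t * nrm B (b r - l).
    apply: nrm_le; first by rewrite mulr_ge0 ?sqrtr_ge0 ?nrm_ge0.
    rewrite exprMn nrm_sq // sqr_sqrtr // qfq.
    by have := hH.2 (b r - l); lra.
  have h3 := HN1 r (leq_maxl _ _).
  have h4 : Num.sqrt t * nrm B (b r - l) <= e / 2.
    apply: le_trans (ler_wpM2l (sqrtr_ge0 t) h3) _.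
    by rewrite mulrCA ger_pMr // ler_pdivrMr ?mul1r ?lerDl.
  by move: h1 h2 h4; move: (nrm _ _) (nrm _ _) (_ * nrm _ _) => *; lra.
have qB : qf B l = 1 by rewrite -nrm_sq // nl expr1n.
exists l => //; have := nrm_sq hq l; rewrite ql qfq qB; lra.
Qed.

End MaximizingVector.

(** * Matrices and singular values *)

Section Euclidean.
Variable R : realType.
Local Notation C := R[i].

Lemma conjc_sum (I : Type) (r : seq I) (P : pred I) (F : I -> C) :
  (\sum_(i <- r | P i) F i)^* = \sum_(i <- r | P i) (F i)^*.
Proof. by apply: (big_morph _ (@conjcD R)); exact: rmorph0. Qed.

Definition adjmx m n (A : 'M[C]_(m, n)) : 'M[C]_(n, m) := map_mx conjc A^T.

Lemma adjmxE m n (A : 'M[C]_(m, n)) i j : adjmx A i j = (A j i)^*.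
Proof. by rewrite !mxE. Qed.

Lemma adjmxK m n (A : 'M[C]_(m, n)) : adjmx (adjmx A) = A.
Proof. by apply/matrixP => i j; rewrite !mxE conjcK. Qed.

Lemma adjmxM m n p (A : 'M[C]_(m, n)) (B : 'M[C]_(n, p)) :
  adjmx (A *m B) = adjmx B *m adjmx A.
Proof.
apply/matrixP => i j; rewrite adjmxE !mxE conjc_sum; apply: eq_bigr => k _.
by rewrite !adjmxE conjcM mulrC.
Qed.

Lemma adjmxZ m n a (A : 'M[C]_(m, n)) : adjmx (a *: A) = a^* *: adjmx A.
Proof. by apply/matrixP => i j; rewrite !mxE conjcM. Qed.

Lemma adjmx0 m n : adjmx (0 : 'M[C]_(m, n)) = 0.
Proof. by apply/matrixP => i j; rewrite !mxE rmorph0. Qed.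

Lemma adjmx1 n : adjmx (1%:M : 'M[C]_n) = 1%:M.
Proof. by apply/matrixP => i j; rewrite !mxE eq_sym; case: eqP; rewrite ?rmorph1 ?rmorph0. Qed.

Definition dotc n (x y : 'cV[C]_n) : C := \sum_i x i ord0 * (y i ord0)^*.

Lemma dotcE n (x y : 'cV[C]_n) : dotc x y = (adjmx y *m x) ord0 ord0.
Proof. by rewrite mxE; apply: eq_bigr => i _; rewrite adjmxE mulrC. Qed.

Lemma dotc_mx n (x y : 'cV[C]_n) : adjmx y *m x = (dotc x y)%:M.
Proof. by rewrite dotcE -mx11_scalar. Qed.

Lemma dotc_herm n : hermitian (@dotc n).
Proof.
split=> *; rewrite /dotc.
- by rewrite -big_split; apply: eq_bigr => i _; rewrite mxE mulrDl.
- by rewrite mulr_sumr; apply: eq_bigr => i _; rewrite mxE mulrA.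
- by rewrite conjc_sum; apply: eq_bigr => i _; rewrite /= conjcM conjcK mulrC.
Qed.

Lemma qf_dotc n (x : 'cV[C]_n) : qf (@dotc n) x = \sum_i normc (x i ord0) ^+ 2.
Proof. by rewrite /qf Re_sum; apply: eq_bigr => i _; rewrite mul_conjc. Qed.

Lemma dotc_psd n : psd (@dotc n).
Proof.
split; first exact: dotc_herm.
by move=> x; rewrite qf_dotc; apply: sumr_ge0 => i _; exact: sqr_ge0.
Qed.

Lemma enormE n (x : 'cV[C]_n) : enorm x = nrm (@dotc n) x.
Proof. by rewrite /nrm qf_dotc. Qed.

Lemma enorm_ge0 n (x : 'cV[C]_n) : 0 <= enorm x.
Proof. exact: sqrtr_ge0. Qed.

Lemma enorm_sq n (x : 'cV[C]_n) : enorm x ^+ 2 = Re (dotc x x).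
Proof. by rewrite enormE nrm_sq //; exact: dotc_psd. Qed.

Lemma dotcxx n (x : 'cV[C]_n) : dotc x x = (enorm x ^+ 2)%:C.
Proof. by rewrite enorm_sq (hermE (dotc_herm n)). Qed.

Lemma enorm_sqE n (x : 'cV[C]_n) : enorm x ^+ 2 = \sum_i normc (x i ord0) ^+ 2.
Proof. by rewrite enorm_sq -qf_dotc. Qed.

Lemma enormD n (x y : 'cV[C]_n) : enorm (x + y) <= enorm x + enorm y.
Proof. by rewrite !enormE; apply: nrmD; exact: dotc_psd. Qed.

Lemma enormN n (x : 'cV[C]_n) : enorm (- x) = enorm x.
Proof. by rewrite !enormE nrmN //; exact: dotc_psd. Qed.

Lemma enormZ n a (x : 'cV[C]_n) : enorm (a *: x) = normc a * enorm x.
Proof. by rewrite !enormE nrmZ //; exact: dotc_psd. Qed.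

Lemma enorm0 n : enorm (0 : 'cV[C]_n) = 0.
Proof. by rewrite enormE nrm0 //; exact: dotc_psd. Qed.

Lemma enorm_eq0 n (x : 'cV[C]_n) : enorm x = 0 -> x = 0.
Proof.
move=> h; have : enorm x ^+ 2 = 0 by rewrite h expr0n.
rewrite enorm_sqE => /eqP; rewrite psumr_eq0 => [/allP h2|i _]; last exact: sqr_ge0.
apply/matrixP => i j; rewrite ord1 mxE; apply: eq0_normc.
by have := h2 i (mem_index_enum _); rewrite sqrf_eq0 => /eqP.
Qed.

Lemma enorm_gt0 n (x : 'cV[C]_n) : x != 0 -> 0 < enorm x.
Proof.
by move=> x0; rewrite lt0r enorm_ge0 andbT; apply: contra_neq x0; exact: enorm_eq0.
Qed.

Lemma normc_dotc n (x y : 'cV[C]_n) : normc (dotc x y) <= enorm x * enorm y.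
Proof. by rewrite !enormE; apply: normc_form_le; exact: dotc_psd. Qed.

Lemma le_normc_enorm n (x : 'cV[C]_n) i : normc (x i ord0) <= enorm x.
Proof.
rewrite -(@ler_pXn2r _ 2) ?nnegrE ?normc_ge0 ?enorm_ge0 // enorm_sqE.
by rewrite (bigD1 i) //= lerDl; apply: sumr_ge0 => j _; exact: sqr_ge0.
Qed.

Lemma enorm_sum n (I : Type) (r : seq I) (P : pred I) (F : I -> 'cV[C]_n) :
  enorm (\sum_(i <- r | P i) F i) <= \sum_(i <- r | P i) enorm (F i).
Proof.
elim/big_ind2: _ => //; first by rewrite enorm0.
by move=> a b c d h1 h2; apply: le_trans (enormD _ _) (lerD h1 h2).
Qed.

Lemma enorm_le_sum n (x : 'cV[C]_n) : enorm x <= \sum_i normc (x i ord0).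
Proof.
have {1}-> : x = \sum_i x i ord0 *: delta_mx i ord0.
  apply/matrixP => i j; rewrite ord1 summxE (bigD1 i) //= big1 => [|k ki].
    by rewrite !mxE !eqxx mulr1 addr0.
  by rewrite !mxE eq_sym (negbTE ki) mulr0.
apply: le_trans (enorm_sum _ _ _) _; apply: ler_sum => i _.
rewrite enormZ ler_piMr ?normc_ge0 // /enorm (bigD1 i) //= mxE !eqxx normc1 big1 => [|k ki].
  by rewrite addr0 expr1n sqrtr1.
by rewrite mxE (negbTE ki) normc0 expr0n.
Qed.

Lemma enorm11 (x : 'M[C]_1) : enorm x = normc (x ord0 ord0).
Proof. by rewrite /enorm big_ord1 sqrtr_sqr ger0_norm // normc_ge0. Qed.

Lemma dotc_adj m n (A : 'M[C]_(m, n)) x y : dotc (A *m x) y = dotc x (adjmx A *m y).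
Proof. by rewrite !dotcE adjmxM adjmxK mulmxA. Qed.

Lemma enorm_isometry m n (A : 'M[C]_(m, n)) x :
  adjmx A *m A = 1%:M -> enorm (A *m x) = enorm x.
Proof.
move=> AA; have : enorm (A *m x) ^+ 2 = enorm x ^+ 2.
  by rewrite !enorm_sq dotc_adj mulmxA AA mul1mx.
by move/eqP; rewrite eqrXn2 ?enorm_ge0 // => /eqP.
Qed.

(** A crude bound for the operator norm, first of all to show that its supremum is finite. *)
Definition mxabs m n (A : 'M[C]_(m, n)) : R := \sum_j enorm (col j A).

Lemma mxabs_ge0 m n (A : 'M[C]_(m, n)) : 0 <= mxabs A.
Proof. by apply: sumr_ge0 => i _; exact: enorm_ge0. Qed.

Lemma enorm_mul_mxabs m n (A : 'M[C]_(m, n)) x : enorm (A *m x) <= mxabs A * enorm x.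
Proof.
have -> : A *m x = \sum_j x j ord0 *: col j A.
  by apply/matrixP => i j; rewrite ord1 summxE !mxE; apply: eq_bigr => k _; rewrite !mxE mulrC.
apply: le_trans (enorm_sum _ _ _) _; rewrite mulr_suml; apply: ler_sum => j _.
by rewrite enormZ mulrC ler_wpM2l ?enorm_ge0 // le_normc_enorm.
Qed.

(** * Operator norm and singular values of a matrix *)

Section OpNorm.
Variables m n : nat.
Implicit Type A : 'M[C]_(m, n).

Lemma mxopnorm_has_sup A :
  has_sup [set enorm (A *m x) | x in [set x : 'cV[C]_n | enorm x <= 1]].
Proof.
split; first by exists (enorm (A *m 0)), 0 => //=; rewrite enorm0.
exists (mxabs A) => _ [x /= x1 <-]; apply: le_trans (enorm_mul_mxabs _ _) _.
by rewrite ler_piMr // mxabs_ge0.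
Qed.

Lemma enorm_mulmx A x : enorm (A *m x) <= mxopnorm A * enorm x.
Proof.
have [->|x0] := eqVneq x 0; first by rewrite mulmx0 !enorm0 mulr0.
have n0 := enorm_gt0 x0; have n1 : enorm x != 0 by rewrite gt_eqF.
have : enorm (A *m ((enorm x)^-1%:C *: x)) <= mxopnorm A.
  apply: (ub_le_sup (mxopnorm_has_sup A).2); exists ((enorm x)^-1%:C *: x) => //=.
  by rewrite enormZ normc_real ger0_norm ?invr_ge0 ?enorm_ge0 // mulVf.
rewrite -scalemxAr enormZ normc_real ger0_norm ?invr_ge0 ?enorm_ge0 //.
by rewrite ler_pdivrMl // mulrC.
Qed.

Lemma mxopnorm_le A c : 0 <= c -> (forall x, enorm (A *m x) <= c * enorm x) ->
  mxopnorm A <= c.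
Proof.
move=> c0 H; apply: ge_sup; first exact: (mxopnorm_has_sup A).1.
by move=> _ [x /= x1 <-]; apply: le_trans (H x) _; rewrite ler_piMr.
Qed.

Lemma mxopnorm_ge0 A : 0 <= mxopnorm A.
Proof.
apply: (ub_le_sup (mxopnorm_has_sup A).2); exists 0 => /=; first by rewrite enorm0.
by rewrite mulmx0 enorm0.
Qed.

Lemma mxopnorm_le_mxabs A : mxopnorm A <= mxabs A.
Proof. by apply: mxopnorm_le (mxabs_ge0 _) _ => x; exact: enorm_mul_mxabs. Qed.

Lemma normc_le_mxopnorm A i j : normc (A i j) <= mxopnorm A.
Proof.
have -> : A i j = (A *m delta_mx j ord0 : 'cV_m) i ord0 by rewrite -colE !mxE.
apply: le_trans (le_normc_enorm _ _) _; apply: le_trans (enorm_mulmx _ _) _.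
rewrite ler_piMr ?mxopnorm_ge0 //.
rewrite /enorm (bigD1 j) //= mxE !eqxx normc1 big1 => [|k kj]; last first.
  by rewrite mxE (negbTE kj) normc0 expr0n.
by rewrite addr0 expr1n sqrtr1.
Qed.

Lemma mxopnorm0 : mxopnorm (0 : 'M[C]_(m, n)) = 0.
Proof.
apply/eqP; rewrite eq_le mxopnorm_ge0 andbT; apply: mxopnorm_le => // x.
by rewrite mul0mx enorm0 mul0r.
Qed.

Lemma mxopnorm_eq0 A : mxopnorm A = 0 -> A = 0.
Proof.
move=> h; apply/matrixP => i j; rewrite mxE; apply: eq0_normc; apply/eqP.
by rewrite eq_le normc_ge0 andbT -h normc_le_mxopnorm.
Qed.

Lemma enorm_adjmx A y : enorm (adjmx A *m y) <= mxopnorm A * enorm y.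
Proof.
set z := adjmx A *m y; have [->|z0] := eqVneq (enorm z) 0.
  by rewrite mulr_ge0 ?mxopnorm_ge0 ?enorm_ge0.
have zp : 0 < enorm z by rewrite lt0r z0 enorm_ge0.
rewrite -(ler_pM2r zp) -expr2 enorm_sq {1}/z.
have -> : dotc (adjmx A *m y) z = dotc y (A *m z) by rewrite dotc_adj adjmxK.
apply: le_trans (ler_norm _) _; apply: le_trans (normc_Re _) _.
apply: le_trans (normc_dotc _ _) _.
by rewrite [mxopnorm A * _]mulrC -mulrA ler_wpM2l ?enorm_ge0 ?enorm_mulmx.
Qed.

Lemma mxopnormD A A' : mxopnorm (A + A') <= mxopnorm A + mxopnorm A'.
Proof.
apply: mxopnorm_le => [|x]; first by rewrite addr_ge0 ?mxopnorm_ge0.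
rewrite mulmxDl mulrDl; apply: le_trans (enormD _ _) _.
by rewrite lerD ?enorm_mulmx.
Qed.

Lemma mxopnormN A : mxopnorm (- A) = mxopnorm A.
Proof.
suff le A' : mxopnorm (- A') <= mxopnorm A'.
  by have := le (- A); rewrite (opprK A) => h; apply: le_anti; rewrite (le A) h.
apply: mxopnorm_le => [|x]; first exact: mxopnorm_ge0.
by rewrite mulNmx enormN enorm_mulmx.
Qed.

Lemma mxsing_has_inf j A :
  has_inf [set mxopnorm (A - B) | B in [set B : 'M[C]_(m, n) | (\rank B <= j)%N]].
Proof.
split; first by exists (mxopnorm (A - 0)), 0 => //=; rewrite mxrank0.
by exists 0 => _ [B _ <-]; exact: mxopnorm_ge0.
Qed.

Lemma mxsing_le j A B : (\rank B <= j)%N -> mxsing j A <= mxopnorm (A - B).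
Proof. by move=> rB; apply: (ge_inf (mxsing_has_inf j A).2); exists B. Qed.

Lemma le_mxsing j A c : (forall B, (\rank B <= j)%N -> c <= mxopnorm (A - B)) ->
  c <= mxsing j A.
Proof.
move=> H; apply: lb_le_inf; first exact: (mxsing_has_inf j A).1.
by move=> _ [B rB <-]; exact: H.
Qed.

Lemma mxsing_ge0 j A : 0 <= mxsing j A.
Proof. by apply: le_mxsing => B _; exact: mxopnorm_ge0. Qed.

Lemma mxsing_le_opnorm j A : mxsing j A <= mxopnorm A.
Proof. by rewrite -[in leRHS](subr0 A); apply: mxsing_le; rewrite mxrank0. Qed.

Lemma mxsing0 A : mxsing 0 A = mxopnorm A.
Proof.
apply/eqP; rewrite eq_le mxsing_le_opnorm; apply: le_mxsing => B.
by rewrite leqn0 mxrank_eq0 => /eqP ->; rewrite subr0.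
Qed.

End OpNorm.

Section RankOneDeflation.
Variables (m n : nat) (v : 'cV[C]_n) (w : 'cV[C]_m).

(* Wedderburn's rank reduction; deflating by v and w is how a competitor of rank
   j+1 for the split matrix yields one of rank j for its lower block. *)
Lemma mxrank_deflate (B : 'M[C]_(m, n)) (b := dotc (B *m v) w) : b != 0 ->
  (\rank (B - b^-1 *: (B *m v *m (adjmx w *m B)))%R < \rank B)%N.
Proof.
move=> b0; set S := B - _.
have SB : S = (1%:M - b^-1 *: (B *m v *m adjmx w)) *m B.
  by rewrite /S mulmxBl mul1mx -scalemxAl !mulmxA.
have Sv : S *m v = 0.
  rewrite mulmxBl -scalemxAl -!mulmxA dotc_mx -/b mul_mx_scalar -scalemxAr.
  by rewrite scalerA mulVf // scale1r subrr.
apply: rank_ltmx; rewrite ltmxE {1}SB submxMl; apply/negP => /submxP[D BD].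
have : adjmx w *m (B *m v) = 0 by rewrite BD -!mulmxA Sv !mulmx0.
rewrite dotc_mx -/b => /matrixP/(_ ord0 ord0); rewrite !mxE eqxx mulr1n => /eqP.
by rewrite (negbTE b0).
Qed.

End RankOneDeflation.

(* The columns of [row_mx v V] form an orthonormal basis. *)
Definition unitary_split n (v : 'cV[C]_n.+1) (V : 'M[C]_(n.+1, n)) :=
  [/\ adjmx V *m V = 1%:M, adjmx V *m v = 0 & adjmx v *m v = 1%:M].

(** For the square matrix [v V] a left inverse is also a right inverse. *)
Lemma unitary_splitP n (v : 'cV[C]_n.+1) (V : 'M[C]_(n.+1, n)) :
  unitary_split v V -> v *m adjmx v + V *m adjmx V = 1%:M.
Proof.
move=> [VV Vv vv]; pose U : 'M[C]_(n.+1, 1 + n) := row_mx v V.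
have vV : adjmx v *m V = 0 by rewrite -[LHS]adjmxK adjmxM adjmxK Vv adjmx0.
have aU : adjmx U = col_mx (adjmx v) (adjmx V).
  by rewrite /adjmx tr_row_mx map_col_mx.
have : adjmx U *m U = 1%:M.
  by rewrite aU mul_col_row VV Vv vv vV -scalar_mx_block.
by move/mulmx1C; rewrite aU mul_row_col.
Qed.

Lemma enorm_split n (v : 'cV[C]_n.+1) (V : 'M[C]_(n.+1, n)) x : unitary_split v V ->
  enorm x ^+ 2 = normc (dotc x v) ^+ 2 + enorm (adjmx V *m x) ^+ 2.
Proof.
move=> h; rewrite -{1}(mul1mx x) -(unitary_splitP h).
have [VV Vv vv] := h.
have -> : normc (dotc x v) ^+ 2 = enorm (adjmx v *m x) ^+ 2.
  by rewrite enorm11 dotcE.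
rewrite !enorm_sq mulmxDl; set y := _ *m _; set y' := _ *m _ *m _.
rewrite (hermD (dotc_herm n.+1) y) !(hermDr (dotc_herm n.+1) y) !ReD {}/y {}/y'.
rewrite -!mulmxA; move: (adjmx v *m x) (adjmx V *m x) => y1 y2.
rewrite !dotc_adj !mulmxA vv VV Vv !mul1mx !mul0mx.
have -> : adjmx v *m V = 0 by rewrite -[LHS]adjmxK adjmxM adjmxK Vv adjmx0.
by rewrite !mul0mx !(herm0r (dotc_herm _)) /= addr0 add0r.
Qed.

Lemma enorm_adj_split_le n (v : 'cV[C]_n.+1) (V : 'M[C]_(n.+1, n)) x :
  unitary_split v V -> enorm (adjmx V *m x) <= enorm x.
Proof.
move=> sV; rewrite -(@ler_pXn2r _ 2) ?nnegrE ?enorm_ge0 // (enorm_split x sV) lerDr.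
exact: sqr_ge0.
Qed.

Lemma adj_mul0 m n p (A : 'M[C]_(m, n)) (B : 'M[C]_(m, p)) :
  adjmx A *m B = 0 -> adjmx B *m A = 0.
Proof. by move=> h; rewrite -[LHS]adjmxK adjmxM adjmxK h adjmx0. Qed.

(** * Singular values of t w v* + W E1 V* *)

Section SplitMatrix.
Variables (m n : nat) (v : 'cV[C]_n.+1) (V : 'M[C]_(n.+1, n)).
Variables (w : 'cV[C]_m.+1) (W : 'M[C]_(m.+1, m)).
Hypotheses (sV : unitary_split v V) (sW : unitary_split w W).
Variables (t : R) (E1 : 'M[C]_(m, n)).
Hypotheses (t0 : 0 <= t) (E1t : mxopnorm E1 <= t).
Let E := t%:C *: (w *m adjmx v) + W *m E1 *m adjmx V.

Let VV : adjmx V *m V = 1%:M. Proof. by case: sV. Qed.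
Let Vv : adjmx V *m v = 0. Proof. by case: sV. Qed.
Let vv : adjmx v *m v = 1%:M. Proof. by case: sV. Qed.
Let vV : adjmx v *m V = 0. Proof. exact: adj_mul0. Qed.
Let WW : adjmx W *m W = 1%:M. Proof. by case: sW. Qed.
Let Ww : adjmx W *m w = 0. Proof. by case: sW. Qed.
Let ww : adjmx w *m w = 1%:M. Proof. by case: sW. Qed.
Let wW : adjmx w *m W = 0. Proof. exact: adj_mul0. Qed.
Let nv1 : enorm v = 1. Proof. by rewrite -[v]mulmx1 enorm_isometry // enorm11 mxE normc1. Qed.
Let nw1 : enorm w = 1. Proof. by rewrite -[w]mulmx1 enorm_isometry // enorm11 mxE normc1. Qed.

Let WE : adjmx W *m E = E1 *m adjmx V.
Proof.
by rewrite mulmxDr -scalemxAr !mulmxA Ww WW mul0mx scaler0 add0r mul1mx.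
Qed.

Let wE : adjmx w *m E = t%:C *: adjmx v.
Proof.
by rewrite mulmxDr -scalemxAr !mulmxA ww wW !mul0mx addr0 mul1mx.
Qed.

Lemma split_mul_vec : E *m v = t%:C *: w.
Proof.
by rewrite mulmxDl -scalemxAl -!mulmxA vv Vv !mulmx0 addr0 mulmx1.
Qed.

Lemma split_enorm x : enorm (E *m x) ^+ 2 =
  t ^+ 2 * normc (dotc x v) ^+ 2 + enorm (E1 *m (adjmx V *m x)) ^+ 2.
Proof.
rewrite (enorm_split _ sW) mulmxA WE mulmxA; congr (_ + _).
rewrite dotcE mulmxA wE -scalemxAl mxE -dotcE normcM normc_real.
by rewrite ger0_norm // exprMn.
Qed.

Lemma split_opnorm : mxopnorm E = t.
Proof.
apply/eqP; rewrite eq_le; apply/andP; split.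
  apply: mxopnorm_le => // x; rewrite -(@ler_pXn2r _ 2) ?nnegrE ?mulr_ge0 ?enorm_ge0 //.
  rewrite split_enorm exprMn (enorm_split x sV) mulrDr lerD2l -exprMn.
  rewrite ler_pXn2r ?nnegrE ?mulr_ge0 ?enorm_ge0 //.
  by apply: le_trans (enorm_mulmx _ _) _; rewrite ler_wpM2r ?enorm_ge0.
have := enorm_mulmx E v.
by rewrite split_mul_vec enormZ nw1 nv1 !mulr1 normc_real ger0_norm.
Qed.

(** A competitor for E1 is completed by the same rank-one term, which cancels in the difference. *)
Let mxsing_split_le j : mxsing j.+1 E <= mxsing j E1.
Proof.
apply: le_mxsing => B rB; pose B' := t%:C *: (w *m adjmx v) + W *m B *m adjmx V.
have rB' : (\rank B' <= j.+1)%N.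
  apply: leq_trans (mxrank_add _ _) _; rewrite -[j.+1]add1n; apply: leq_add.
    apply: leq_trans (mxrank_scale _ _) _.
    by apply: leq_trans (mxrankM_maxl _ _) (rank_leq_col _).
  by apply: leq_trans (mxrankM_maxl _ _) _; apply: leq_trans (mxrankM_maxr _ _) rB.
apply: le_trans (mxsing_le E rB') _; rewrite /E /B' opprD addrACA subrr add0r.
rewrite -mulmxBl -mulmxBr; apply: mxopnorm_le; first exact: mxopnorm_ge0.
move=> x; rewrite -!mulmxA enorm_isometry //.
apply: le_trans (enorm_mulmx _ _) _; apply: ler_wpM2l; first exact: mxopnorm_ge0.
rewrite -(@ler_pXn2r _ 2) ?nnegrE ?enorm_ge0 // (enorm_split x sV).
by rewrite lerDr sqr_ge0.
Qed.

(** A competitor B of rank j + 1 with error d < t is deflated to S, and W* S V competes for E1. Each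
    y is lifted to some z with |z|^2 = |a|^2 + |y|^2 and |(E - B) z|^2 = t^2 |a|^2 + |(E1 - B1)
    y|^2. The bound d^2 |z|^2 on the latter, together with d < t, leaves |(E1 - B1) y| <= d |y|. *)
Let le_mxsing_split j : mxsing j E1 <= mxsing j.+1 E.
Proof.
apply: le_mxsing => B rB; set d := mxopnorm _.
have [td|dt] := leP t d.
  by apply: le_trans (mxsing_le_opnorm _ _) _; exact: le_trans E1t td.
have d0 : 0 <= d by exact: mxopnorm_ge0.
set b := dotc (B *m v) w.
(* If <B v, w> vanished, (E - B) v would have component t along w, more than the error d allows. *)
have b0 : b != 0.
  apply: contraTneq dt => b0; rewrite -leNgt.
  have := normc_dotc ((E - B) *m v) w.
  rewrite mulmxBl (hermBl (dotc_herm _)) -/b b0 subr0 split_mul_vec nw1 mulr1.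
  rewrite (hermZ (dotc_herm _)) dotcxx nw1 expr1n mulr1 normc_real ger0_norm //.
  move=> /le_trans; apply; rewrite -split_mul_vec -mulmxBl.
  by apply: le_trans (enorm_mulmx _ _) _; rewrite nv1 mulr1.
set S := B - b^-1 *: (B *m v *m (adjmx w *m B)).
have rS : (\rank S <= j)%N by rewrite -ltnS; exact: leq_trans (mxrank_deflate b0) rB.
have wS : adjmx w *m S = 0.
  rewrite mulmxBr -scalemxAr mulmxA [adjmx w *m (B *m v)]dotc_mx -/b.
  by rewrite mul_scalar_mx scalerA mulVf // scale1r subrr.
pose B1 := adjmx W *m S *m V.
have rB1 : (\rank B1 <= j)%N.
  by apply: leq_trans (mxrankM_maxl _ _) _; apply: leq_trans (mxrankM_maxr _ _) rS.
apply: le_trans (mxsing_le E1 rB1) _; apply: mxopnorm_le => // y.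
(* The multiple of v to be removed from V y so that B acts on the result z as the deflated S acts on
   V y. *)
pose a := b^-1 *: (adjmx w *m B *m V *m y); pose z := V *m y - v *m a.
have Bz : B *m z = S *m (V *m y).
  rewrite mulmxBr mulmxBl; congr (_ - _).
  by rewrite -scalemxAl /a -2!scalemxAr !mulmxA.
have Vz : adjmx V *m z = y by rewrite mulmxBr !mulmxA VV Vv mul1mx mul0mx subr0.
have vz : adjmx v *m z = - a by rewrite mulmxBr !mulmxA vV vv mul1mx mul0mx sub0r.
have h1 : enorm z ^+ 2 = enorm a ^+ 2 + enorm y ^+ 2.
  by rewrite (enorm_split z sV) Vz dotcE vz !enorm11 mxE normcN.
have h2 : enorm ((E - B) *m z) ^+ 2 = t ^+ 2 * enorm a ^+ 2 + enorm ((E1 - B1) *m y) ^+ 2.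
  rewrite (enorm_split _ sW) mulmxBl Bz; congr (_ + _ ^+ 2).
    rewrite dotcE mulmxBr !mulmxA wE wS !mul0mx subr0 -scalemxAl vz mxE mxE.
    by rewrite normcM normcN exprMn normc_real ger0_norm // enorm11.
  rewrite mulmxBr; have -> : adjmx W *m (E *m z) = E1 *m y.
    by rewrite mulmxA WE -mulmxA Vz.
  by rewrite (mulmxBl E1) /B1 -!mulmxA.
have h3 := enorm_mulmx (E - B) z; rewrite -/d in h3.
rewrite -(@ler_pXn2r _ 2) ?nnegrE ?mulr_ge0 ?enorm_ge0 // exprMn.
have h4 : enorm ((E - B) *m z) ^+ 2 <= d ^+ 2 * enorm z ^+ 2.
  by rewrite -exprMn ler_pXn2r ?nnegrE ?mulr_ge0 ?enorm_ge0.
have h5 : d ^+ 2 * enorm a ^+ 2 <= t ^+ 2 * enorm a ^+ 2.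
  by apply: ler_wpM2r; rewrite ?sqr_ge0 // ler_pXn2r ?nnegrE // ltW.
by move: h4; rewrite h1 h2 mulrDr; lra.
Qed.

Lemma split_mxsingS j : mxsing j.+1 E = mxsing j E1.
Proof. by apply/eqP; rewrite eq_le mxsing_split_le le_mxsing_split. Qed.

End SplitMatrix.

(** Equality case of the norm bound: expanding |A* A f - t^2 f|^2 gives at most (t^4 - 2 t^4 + t^4)
    |f|^2. *)
Lemma attaining_adj m n (A : 'M[C]_(m, n)) (t : R) f : 0 <= t -> mxopnorm A <= t ->
  enorm (A *m f) = t * enorm f -> adjmx A *m (A *m f) = (t ^+ 2)%:C *: f.
Proof.
move=> t0 At Af; apply/eqP; rewrite -subr_eq0; apply/eqP; apply: enorm_eq0.
apply/eqP; rewrite -sqrf_eq0 eq_le sqr_ge0 andbT enorm_sq.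
set g := adjmx A *m _; have hd := dotc_herm n.
have := qfB hd g ((t ^+ 2)%:C *: f); rewrite -/(qf _ _) => ->.
have h1 : enorm g <= t ^+ 2 * enorm f.
  apply: le_trans (enorm_adjmx _ _) _; rewrite Af mulrA expr2 -!mulrA.
  by rewrite ler_wpM2r ?mulr_ge0 ?enorm_ge0.
rewrite (qfZ hd) (hermZr hd) conjc_real dotc_adj adjmxK dotcxx Af.
rewrite normc_real ger0_norm ?sqr_ge0 // -rmorphM /=.
rewrite /qf -!enorm_sq; have := enorm_ge0 g; have := enorm_ge0 f.
have : enorm g ^+ 2 <= (t ^+ 2 * enorm f) ^+ 2.
  by rewrite ler_pXn2r ?nnegrE ?mulr_ge0 ?enorm_ge0 ?sqr_ge0.
by rewrite !exprMn; lra.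
Qed.

(** * Splitting a matrix along a vector that attains its norm *)

Section AttainingSplit.
Variables (m n : nat) (A : 'M[C]_(m.+1, n.+1)) (t : R).
Variables (f : 'cV[C]_n.+1) (V : 'M[C]_(n.+1, n)) (W : 'M[C]_(m.+1, m)).
Hypotheses (t0 : 0 < t) (f0 : f != 0).
Hypotheses (VV : adjmx V *m V = 1%:M) (Vf : adjmx V *m f = 0).

Let nf0 : enorm f != 0. Proof. by rewrite gt_eqF // enorm_gt0. Qed.

Lemma normalize_split k (g : 'cV[C]_k.+1) (U : 'M[C]_(k.+1, k)) (s : R) : s != 0 ->
  enorm g = s -> adjmx U *m U = 1%:M -> adjmx U *m g = 0 ->
  unitary_split (s^-1%:C *: g) U.
Proof.
move=> s0 gs UU Ug; split=> //; first by rewrite -scalemxAr Ug scaler0.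
rewrite adjmxZ -scalemxAl -scalemxAr dotc_mx dotcxx gs conjc_real scalerA.
rewrite scale_scalar_mx -!rmorphM /= (_ : _ * _ = 1) //.
by rewrite -expr2 -exprMn mulVf ?expr1n.
Qed.

Hypotheses (At : mxopnorm A <= t) (Af : enorm (A *m f) = t * enorm f).
Hypotheses (WW : adjmx W *m W = 1%:M) (Wg : adjmx W *m (A *m f) = 0).
Let v := (enorm f)^-1%:C *: f.
Let w := (t * enorm f)^-1%:C *: (A *m f).

Lemma attaining_unitary_split : unitary_split v V /\ unitary_split w W.
Proof.
split; first exact: normalize_split.
by apply: normalize_split => //; rewrite mulf_neq0 // gt_eqF.
Qed.

(** A maps v to t w and, by [attaining_adj], A* maps w to t v, so both off-diagonal blocks in the
    bases [v V] and [w W] vanish. *)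
Lemma attaining_split :
  A = t%:C *: (w *m adjmx v) + W *m (adjmx W *m A *m V) *m adjmx V.
Proof.
have [sV sW] := attaining_unitary_split.
rewrite -[LHS]mulmx1 -(unitary_splitP sV) mulmxDr; congr (_ + _).
  rewrite mulmxA scalemxAl; congr (_ *m _).
  rewrite /v /w -scalemxAr scalerA; congr (_ *: _).
  by rewrite -rmorphM invfM mulrA divff ?mul1r // gt_eqF.
rewrite -{1}[A]mul1mx -(unitary_splitP sW) mulmxDl mulmxDl.
suff -> : w *m adjmx w *m A *m (V *m adjmx V) = 0.
  by rewrite add0r !mulmxA.
rewrite -!mulmxA [A *m _]mulmxA [adjmx w *m _]mulmxA [adjmx w *m _]mulmxA.
suff -> : adjmx w *m A *m V = 0 by rewrite mul0mx mulmx0.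
rewrite -[adjmx w *m A]adjmxK adjmxM adjmxK /w -scalemxAr.
rewrite (attaining_adj (ltW t0) At Af) scalerA adjmxZ -scalemxAl.
by rewrite (adj_mul0 Vf) scaler0.
Qed.

End AttainingSplit.

End Euclidean.

(** * Integration and Fourier coefficients on the circle *)

Section ComplexIntegral.
Variable R : realType.
Local Notation C := R[i].
Local Notation T := (circle R).
Local Notation mu := (circle_measure R).
Implicit Types f g : T -> C.

Definition cmeas f := measurable_fun setT (fun z => Re (f z)) /\
                      measurable_fun setT (fun z => Im (f z)).

Lemma cmeas_cst c : cmeas (fun=> c).
Proof. by split; exact: measurable_cst. Qed.

Lemma cmeasD f g : cmeas f -> cmeas g -> cmeas (fun z => f z + g z).
Proof.
move=> [f1 f2] [g1 g2]; split.
  by under eq_fun do rewrite ReD; exact: measurable_funD.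
by under eq_fun do rewrite ImD; exact: measurable_funD.
Qed.

Lemma cmeasN f : cmeas f -> cmeas (fun z => - f z).
Proof.
move=> [f1 f2]; split.
  by under eq_fun do rewrite ReN; exact: measurable_funN.
by under eq_fun do rewrite ImN; exact: measurable_funN.
Qed.

Lemma cmeas_conj f : cmeas f -> cmeas (fun z => (f z)^*).
Proof.
move=> [f1 f2]; split.
  by under eq_fun do rewrite Re_conjc.
by under eq_fun do rewrite Im_conjc; exact: measurable_funN.
Qed.

Lemma cmeasM f g : cmeas f -> cmeas g -> cmeas (fun z => f z * g z).
Proof.
move=> [f1 f2] [g1 g2]; split.
  by under eq_fun do rewrite ReM; apply: measurable_funB; exact: measurable_funM.
by under eq_fun do rewrite ImM; apply: measurable_funD; exact: measurable_funM.
Qed.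

Lemma cmeas_sum (I : Type) (r : seq I) (F : I -> T -> C) :
  (forall i, cmeas (F i)) -> cmeas (fun z => \sum_(i <- r) F i z).
Proof.
move=> mF; elim: r => [|i r IH].
  by under eq_fun do rewrite big_nil; exact: cmeas_cst.
by under eq_fun do rewrite big_cons; apply: cmeasD.
Qed.

Lemma cmeas_real (f : T -> R) : measurable_fun setT f -> cmeas (fun z => (f z)%:C).
Proof. by move=> mf; split=> //=; exact: measurable_cst. Qed.

Lemma measurable_normc_sq f : cmeas f -> measurable_fun setT (fun z => normc (f z) ^+ 2).
Proof.
move=> [f1 f2]; under eq_fun do rewrite normc_sq.
by apply: measurable_funD; exact: measurable_funX.
Qed.

Lemma measurable_normc f : cmeas f -> measurable_fun setT (fun z => normc (f z)).
Proof.
move=> mf; have -> : (fun z => normc (f z)) = (fun z => Num.sqrt (normc (f z) ^+ 2)).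
  by apply/funext => z; rewrite sqrtr_sqr ger0_norm ?normc_ge0.
apply: measurableT_comp (measurable_normc_sq mf).
by apply: continuous_measurable_fun; exact: sqrt_continuous.
Qed.

Lemma measurable_circle_coord : measurable_fun setT (@circle_coord R).
Proof. by move=> _ B mB; rewrite setTI; exists B => //; rewrite setTI. Qed.

Lemma cmeas_id : cmeas (fun z => z).
Proof.
split.
  exact: (measurableT_comp measurable_fst measurable_circle_coord).
exact: (measurableT_comp measurable_snd measurable_circle_coord).
Qed.

Lemma normc_circle (z : T) : normc z = 1.
Proof. by case: z => z /= /eqP. Qed.

Lemma circle_neq0 (z : T) : (z : C) != 0.
Proof.
apply/eqP => z0; have := normc_circle z; rewrite z0 normc0.
by move/esym/eqP; rewrite oner_eq0.
Qed.

Lemma circle_inv (z : T) : (z : C)^-1 = (z : C)^*.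
Proof.
apply: (mulfI (circle_neq0 z)); rewrite divff ?circle_neq0 //.
by rewrite mul_conjc normc_circle expr1n.
Qed.

Lemma cmeasX f n : cmeas f -> cmeas (fun z => f z ^+ n).
Proof.
move=> mf; elim: n => [|n IH]; first by under eq_fun do rewrite expr0; exact: cmeas_cst.
by under eq_fun do rewrite exprS; exact: cmeasM.
Qed.

Lemma cmeas_zpow (k : int) : cmeas (fun z : T => (z : C) ^ k).
Proof.
case: k => n; first exact: cmeasX cmeas_id.
under eq_fun => z do rewrite NegzE -exprz_inv circle_inv.
exact: cmeasX (cmeas_conj cmeas_id).
Qed.

Lemma conjc_zpow (z : T) (k : int) : ((z : C) ^ k)^* = (z : C) ^ (- k).
Proof.
rewrite -exprz_inv circle_inv; case: k => n.
  exact: rmorphXn.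
by rewrite !NegzE -!exprz_inv -conjc_inv; exact: rmorphXn.
Qed.

Lemma normc_zpow (z : T) (k : int) : normc ((z : C) ^ k) = 1.
Proof.
apply/eqP; rewrite -(@eqrXn2 _ 2) ?normc_ge0 // expr1n; apply/eqP/complexI.
rewrite -mul_conjc conjc_zpow -expfzDr ?circle_neq0 // subrr expr0z.
by [].
Qed.

Definition cintble f := mu.-integrable setT (fun z => (Re (f z))%:E) /\
                        mu.-integrable setT (fun z => (Im (f z))%:E).

Lemma cintble_cmeas f : cintble f -> cmeas f.
Proof.
by move=> [f1 f2]; split; apply/measurable_EFinP;
  [exact: measurable_int f1|exact: measurable_int f2].
Qed.

Lemma cintble_le f (g : T -> R) : cmeas f -> mu.-integrable setT (fun z => (g z)%:E) ->
  (forall z, normc (f z) <= g z) -> cintble f.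
Proof.
move=> [f1 f2] ig fg; split; apply: le_integrable ig => //;
  try exact/measurable_EFinP; move=> z _ /=; rewrite lee_fin.
  by apply: le_trans (normc_Re _) _; apply: le_trans (fg z) _; exact: ler_norm.
by apply: le_trans (normc_Im _) _; apply: le_trans (fg z) _; exact: ler_norm.
Qed.

Lemma integrable_cst (c : R) : mu.-integrable setT (fun=> c%:E).
Proof. exact: finite_measure_integrable_cst. Qed.

Lemma cintble_bounded f (M : R) : cmeas f -> (forall z, normc (f z) <= M) -> cintble f.
Proof. by move=> mf fM; apply: cintble_le mf (integrable_cst M) fM. Qed.

Lemma cintble_norm f : cintble f -> mu.-integrable setT (fun z => (normc (f z))%:E).
Proof.
move=> fi; have mf := cintble_cmeas fi; case: fi => [f1 f2].
have h := integrableD measurableT (integrable_abse f1) (integrable_abse f2).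
apply: le_integrable h => //.
  by apply/measurable_EFinP; exact: measurable_normc.
move=> z _ /=; rewrite lee_fin ger0_norm ?normc_ge0 //.
rewrite ger0_norm ?addr_ge0 ?normr_ge0 //.
rewrite -(@ler_pXn2r _ 2) ?nnegrE ?addr_ge0 ?normr_ge0 ?normc_ge0 //.
rewrite normc_sq sqrrD !real_normK ?num_real // -addrA lerD2l lerDr.
by rewrite mulrn_wge0 // mulr_ge0.
Qed.

Lemma cintbleD f g : cintble f -> cintble g -> cintble (fun z => f z + g z).
Proof.
move=> [f1 f2] [g1 g2]; split.
  by under eq_fun do rewrite ReD EFinD; exact: integrableD.
by under eq_fun do rewrite ImD EFinD; exact: integrableD.
Qed.

Lemma cintbleM_bounded f g (M : R) : cintble f -> cmeas g -> (forall z, normc (g z) <= M) ->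
  cintble (fun z => f z * g z).
Proof.
move=> fi mg gM.
have := integrableZl measurableT M (cintble_norm fi).
move/cintble_le; apply.
  by apply: cmeasM => //; exact: cintble_cmeas.
by move=> z; rewrite normcM mulrC ler_wpM2r ?normc_ge0.
Qed.

Lemma cintbleZ c f : cintble f -> cintble (fun z => c * f z).
Proof.
move=> fi; under eq_fun do rewrite mulrC.
by apply: cintbleM_bounded fi (cmeas_cst c) (fun=> lexx _).
Qed.

Lemma cintble0 : cintble (fun=> 0).
Proof. by apply: (@cintble_bounded _ 0) => [|z]; [exact: cmeas_cst|rewrite normc0]. Qed.

Lemma cintD f g : cintble f -> cintble g ->
  cintegral (fun z => f z + g z) = cintegral f + cintegral g.
Proof.
move=> [f1 f2] [g1 g2]; rewrite /cintegral.
under [X in X +i* _]eq_Rintegral do rewrite ReD.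
under [X in _ +i* X]eq_Rintegral do rewrite ImD.
by rewrite !RintegralD.
Qed.

Lemma cintZ c f : cintble f -> cintegral (fun z => c * f z) = c * cintegral f.
Proof.
move=> [f1 f2]; rewrite /cintegral.
have h r (g : T -> R) : mu.-integrable setT (fun z => (g z)%:E) ->
    mu.-integrable setT (fun z => (r * g z)%:E).
  by move=> ig; under eq_fun do rewrite EFinM; exact: integrableZl.
under [X in X +i* _]eq_Rintegral do rewrite ReM.
under [X in _ +i* X]eq_Rintegral do rewrite ImM.
rewrite RintegralB ?RintegralD ?RintegralZl //; try exact: h.
by apply: complex_eq; rewrite !ReImE.
Qed.

Lemma cint0 : cintegral (fun _ : T => 0) = 0.
Proof. by rewrite -[RHS](mul0r (cintegral (fun _ : T => 0))) -cintZ ?mul0r //; exact: cintble0. Qed.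

Lemma cint_conj f : cintble f -> cintegral (fun z => (f z)^*) = (cintegral f)^*.
Proof.
move=> [f1 f2]; rewrite /cintegral.
under [X in X +i* _]eq_Rintegral do rewrite Re_conjc.
under [X in _ +i* X]eq_Rintegral do rewrite Im_conjc -mulN1r.
by rewrite RintegralZl //= mulN1r.
Qed.

Lemma cint_ae f g : cmeas f -> cmeas g -> {ae mu, forall z, f z = g z} ->
  cintegral f = cintegral g.
Proof.
move=> [f1 f2] [g1 g2] fg; rewrite /cintegral /Rintegral; congr (fine _ +i* fine _).
  apply: ae_eq_integral => //; try exact/measurable_EFinP.
  by apply: filterS fg => z -> _.
apply: ae_eq_integral => //; try exact/measurable_EFinP.
by apply: filterS fg => z -> _.
Qed.

End ComplexIntegral.

(** * Orthogonality of the powers of z and uniqueness of Fourier coefficients *)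

Section FourierUniqueness.
Variable R : realType.
Local Notation C := R[i].
Local Notation T := (circle R).
Local Notation mu := (circle_measure R).
Implicit Types f : T -> C.

Lemma expi_pow (t : R) n :
  ((expi t : C) ^+ n) = cos (n%:R * t) +i* sin (n%:R * t).
Proof.
elim: n => [|n IH]; first by rewrite expr0 mul0r cos0 sin0.
rewrite exprS IH -natr1 mulrDl mul1r cosD sinD.
by apply: complex_eq; rewrite !ReImE /=; ring.
Qed.

Lemma integral_circle (f : T -> R) : measurable_fun setT f -> (forall z, 0 <= f z) ->
  (\int[mu]_z (f z)%:E =
   (pi *+ 2)^-1%:E * \int[lebesgue_measure]_(t in `[0%R, (pi *+ 2)%R]) (f (expi t))%:E)%E.
Proof.
move=> mf f0.
have mfe : measurable_fun setT (fun t => (f (expi t))%:E).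
  apply/measurable_EFinP.
  by apply: (measurableT_comp mf); exact: measurable_expi.
rewrite [LHS](@ge0_integral_pushforward _ _ _ _ _ (@expi R)) //=.
- rewrite preimage_setT integral_uniform //=; last by move=> t; rewrite lee_fin.
  by rewrite subr0.
- exact/measurable_EFinP.
- by move=> z _; rewrite lee_fin.
Qed.

Lemma integral_trig (g F : R -> R) : continuous g ->
  (forall t : R, is_derive t (1 : R) F (g t)) -> F (pi *+ 2) - F 0 = pi *+ 2 ->
  (\int[lebesgue_measure]_(t in `[0%R, (pi *+ 2)%R]) (g t)%:E = (pi *+ 2)%:E)%E.
Proof.
move=> cg dF F2.
have cF : continuous F.
  by move=> t; apply/differentiable_continuous/derivable1_diffP; have [] := dF t.
rewrite (@continuous_FTC2 _ g F) //.
- by rewrite -EFinB F2.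
- exact: tau_gt0.
- exact: continuous_subspaceT.
- split.
  + by move=> t _; have [] := dF t.
  + exact: cvg_at_right_filter (cF _).
  + exact: cvg_at_left_filter (cF _).
- by move=> t _; rewrite derive1E; exact: derive_val.
Qed.

Lemma cint_zpow_nat n : cintegral (fun z : T => (z : C) ^+ n.+1) = 0.
Proof.
have [m1 m2] := cmeasX n.+1 (cmeas_id R).
have bz (z : T) : normc ((z : C) ^+ n.+1) = 1 by exact: normc_zpow z n.+1.
have ib : cintble (fun z : T => (z : C) ^+ n.+1).
  by apply: (@cintble_bounded _ _ 1) => [|z]; [exact: cmeasX (cmeas_id R)|rewrite bz].
(* [integral_circle] is for nonnegative functions; adding 1 to a function bounded by 1 makes it
   applicable, and F is a primitive of 1 + g along the circle. *)
have key (g : T -> R) (F : R -> R) : measurable_fun setT g ->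
    mu.-integrable setT (fun z => (g z)%:E) -> (forall z, `|g z| <= 1) ->
    continuous (fun t => 1 + g (expi t)) ->
    (forall t : R, is_derive t (1 : R) F (1 + g (expi t))) -> F (pi *+ 2) - F 0 = pi *+ 2 ->
    (\int[mu]_(z in setT) g z)%R = 0.
  move=> mg ig g1 cg dF F2.
  have h : (\int[mu]_(z in setT) (1 + g z))%R = 1.
    rewrite /Rintegral integral_circle.
    - by rewrite (integral_trig cg dF F2) -EFinM mulVf //= gt_eqF // tau_gt0.
    - by apply: measurable_funD => //; exact: measurable_cst.
    - by move=> z; have := g1 z; rewrite ler_norml; lra.
  move: h; rewrite RintegralD //; last exact: integrable_cst.
  rewrite Rintegral_cst //= probability_setT /= mulr1; lra.
have n0 : (n.+1%:R : R) != 0 by rewrite pnatr_eq0.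
have cont_cos : continuous (fun t : R => cos (n.+1%:R * t) : R).
  move=> t; apply: (continuous_comp (f := fun t : R => n.+1%:R * t) (g := @cos R)).
    exact: mulrl_continuous.
  exact: continuous_cos.
have cont_sin : continuous (fun t : R => sin (n.+1%:R * t) : R).
  move=> t; apply: (continuous_comp (f := fun t : R => n.+1%:R * t) (g := @sin R)).
    exact: mulrl_continuous.
  exact: continuous_sin.
rewrite /cintegral; apply: complex_eq => /=.
- apply: (key _ (fun t => t + n.+1%:R^-1 * sin (n.+1%:R * t))) => //; first exact: ib.1.
  + by move=> z; rewrite -(bz z); exact: normc_Re.
  + under eq_fun do rewrite expi_pow /=.
    move=> t; apply: cvgD; [exact: cvg_cst|exact: cont_cos].
  + move=> t; rewrite expi_pow /=.
    apply: is_derive_eq; rewrite ?scaler0 ?addr0 /GRing.scale /=.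
    by rewrite mulr1 mulrCA mulVf // mulr1.
  + have sin2 k : sin (k%:R * (pi *+ 2)) = 0 :> R.
      elim: k => [|k IH]; first by rewrite mul0r sin0.
      by rewrite -natr1 mulrDl mul1r sinD2pi.
    by rewrite sin2 !mulr0 sin0 mulr0 !addr0 subr0.
- apply: (key _ (fun t => t - n.+1%:R^-1 * cos (n.+1%:R * t))) => //; first exact: ib.2.
  + by move=> z; rewrite -(bz z); exact: normc_Im.
  + under eq_fun do rewrite expi_pow /=.
    move=> t; apply: cvgD; [exact: cvg_cst|exact: cont_sin].
  + move=> t; rewrite expi_pow /=.
    apply: is_derive_eq; rewrite ?scaler0 ?addr0 /GRing.scale /=.
    by rewrite mulr1 mulNr mulrN opprK mulrCA mulVf // mulr1.
  + have cos2 k : cos (k%:R * (pi *+ 2)) = 1 :> R.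
      elim: k => [|k IH]; first by rewrite mul0r cos0.
      by rewrite -natr1 mulrDl mul1r cosD2pi.
    by rewrite cos2 mulr0 cos0 mulr1; ring.
Qed.

Lemma cint_zpow (k : int) : cintegral (fun z : T => (z : C) ^ k) = (k == 0)%:R.
Proof.
case: k => [[|n]|n].
- rewrite /cintegral; apply: complex_eq => /=.
    by rewrite Rintegral_cst //= probability_setT mulr1.
  by rewrite Rintegral_cst //= mul0r.
- exact: cint_zpow_nat.
- rewrite -[LHS]conjcK -cint_conj; last first.
    by apply: (@cintble_bounded _ _ 1) => [|z]; [exact: cmeas_zpow|rewrite normc_zpow].
  under eq_fun do rewrite conjc_zpow NegzE opprK.
  by rewrite cint_zpow_nat rmorph0.
Qed.

Lemma cint_dominated (h : nat -> T -> C) (h0 : T -> C) (G : T -> R) :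
  (forall n, cmeas (h n)) -> cmeas h0 -> mu.-integrable setT (fun z => (G z)%:E) ->
  (forall n z, normc (h n z) <= G z) ->
  (forall z, Re (h n z) @[n --> \oo] --> Re (h0 z)) ->
  (forall z, Im (h n z) @[n --> \oo] --> Im (h0 z)) ->
  (forall n, cintegral (h n) = 0) -> cintegral h0 = 0.
Proof.
move=> mh mh0 iG hG hRe hIm h0E.
have key (u : nat -> T -> R) (v : T -> R) : (forall n, measurable_fun setT (u n)) ->
    measurable_fun setT v -> (forall n z, `|u n z| <= G z) ->
    (forall z, u n z @[n --> \oo] --> v z) -> (forall n, \int[mu]_z u n z = 0) ->
    \int[mu]_z v z = 0.
  move=> mu_ mv uG uv u0.
  have [|||||iv _ hl] := @dominated_convergence _ _ _ mu setT measurableT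
    (fun n z => (u n z)%:E) (fun z => (v z)%:E) (fun z => (G z)%:E).
  - by move=> n; exact/measurable_EFinP.
  - exact/measurable_EFinP.
  - by apply: aeW => z _; apply/cvg_EFin; [exact: nearW|exact: uv].
  - exact: iG.
  - by apply: aeW => z n _; rewrite lee_fin.
  have iu n : mu.-integrable setT (fun z => (u n z)%:E).
    apply: le_integrable iG => //; first exact/measurable_EFinP.
    by move=> z _ /=; rewrite lee_fin; apply: le_trans (uG n z) (ler_norm _).
  have u0' n : (\int[mu]_z (u n z)%:E = 0)%E.
    by rewrite -(fineK (integrable_fin_num measurableT (iu n))) -[fine _]/(Rintegral _ _ _) u0.
  rewrite /Rintegral; move/cvg_lim : hl => <- //.
  under eq_fun do rewrite u0'.
  by rewrite lim_cst.
rewrite /cintegral; apply: complex_eq => /=.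
  apply: (key (fun n z => Re (h n z))) => //; first by move=> n; case: (mh n).
  - by case: mh0.
  - by move=> n z; exact: le_trans (normc_Re _) (hG n z).
  - by move=> n; have := h0E n => /(congr1 (@complex.Re R)).
apply: (key (fun n z => Im (h n z))) => //; first by move=> n; case: (mh n).
- by case: mh0.
- by move=> n z; exact: le_trans (normc_Im _) (hG n z).
- by move=> n; have := h0E n => /(congr1 (@complex.Im R)).
Qed.

Definition zero_coefs f :=
  cintble f /\ forall k : int, cintegral (fun z => f z * (z : C) ^ k) = 0.

Lemma cintble_zpow f (k : int) : cintble f -> cintble (fun z => f z * (z : C) ^ k).
Proof.
move=> fi; apply: (@cintbleM_bounded _ _ _ 1) => //; first exact: cmeas_zpow.
by move=> z; rewrite normc_zpow.
Qed.

Lemma zero_coefsD f g : zero_coefs f -> zero_coefs g -> zero_coefs (fun z => f z + g z).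
Proof.
move=> [fi f0] [gi g0]; split; first exact: cintbleD.
move=> k; under eq_fun do rewrite mulrDl.
by rewrite cintD ?f0 ?g0 ?addr0 //; exact: cintble_zpow.
Qed.

Lemma zero_coefsZ c f : zero_coefs f -> zero_coefs (fun z => c * f z).
Proof.
move=> [fi f0]; split; first exact: cintbleZ.
move=> k; under eq_fun do rewrite -mulrA.
by rewrite cintZ ?f0 ?mulr0 //; exact: cintble_zpow.
Qed.

Lemma zero_coefsX f k : zero_coefs f -> zero_coefs (fun z => f z * (z : C) ^ k).
Proof.
move=> [fi f0]; split; first exact: cintble_zpow.
move=> j; under eq_fun => z do rewrite -mulrA -expfzDr ?circle_neq0 //.
exact: f0.
Qed.

(* The multipliers will be seen to contain the indicators of all Borel sets, so
   that a function without Fourier coefficients has zero integral over each. *)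
Definition multiplier (u : T -> R) :=
  [/\ measurable_fun setT u, (exists M, forall z, `|u z| <= M) &
     forall f, zero_coefs f -> zero_coefs (fun z => f z * (u z)%:C)].

Lemma multiplier_cst c : multiplier (fun=> c).
Proof.
split; [exact: measurable_cst|by exists `|c| |move=> f /(zero_coefsZ c%:C)].
by under eq_fun do rewrite mulrC.
Qed.

Lemma multiplierD u v : multiplier u -> multiplier v -> multiplier (fun z => u z + v z).
Proof.
move=> [mu_ [M uM] hu] [mv [N vN] hv]; split; first exact: measurable_funD.
  by exists (M + N) => z; apply: le_trans (ler_normD _ _) (lerD (uM z) (vN z)).
move=> f zf; under eq_fun do rewrite rmorphD mulrDr.
by apply: zero_coefsD; [exact: hu|exact: hv].
Qed.

Lemma multiplierM u v : multiplier u -> multiplier v -> multiplier (fun z => u z * v z).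
Proof.
move=> [mu_ [M uM] hu] [mv [N vN] hv]; split; first exact: measurable_funM.
  by exists (M * N) => z; rewrite normrM; apply: ler_pM.
by move=> f zf; under eq_fun do rewrite rmorphM mulrA; apply/hv/hu.
Qed.

Lemma multiplier_Re : multiplier (fun z => Re (z : C)).
Proof.
split; first by case: (cmeas_id R).
  by exists 1 => z; rewrite -(normc_circle z); exact: normc_Re.
move=> f zf.
have -> : (fun z : T => f z * (Re z)%:C) =
    (fun z => (1 / 2%:R) * (f z * (z : C) ^ 1) + (1 / 2%:R) * (f z * (z : C) ^ (-1))).
  apply/funext => z; rewrite ReJ_add expr1z -circle_inv; by rewrite exprN1; ring.
by apply: zero_coefsD; apply: zero_coefsZ; exact: zero_coefsX.
Qed.

Lemma multiplier_Im : multiplier (fun z => Im (z : C)).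
Proof.
split; first by case: (cmeas_id R).
  by exists 1 => z; rewrite -(normc_circle z); exact: normc_Im.
move=> f zf.
have -> : (fun z : T => f z * (Im z)%:C) =
    (fun z => ('i%C / 2%:R) * (f z * (z : C) ^ (-1)) + (- ('i%C / 2%:R)) * (f z * (z : C) ^ 1)).
  by apply/funext => z; rewrite ImJ_sub expr1z -circle_inv exprN1; ring.
by apply: zero_coefsD; apply: zero_coefsZ; exact: zero_coefsX.
Qed.

(** Dominated convergence, with M |f| as the dominating function. *)
Lemma multiplier_lim (u : nat -> T -> R) (v : T -> R) M : (forall n, multiplier (u n)) ->
  (forall n z, `|u n z| <= M) -> measurable_fun setT v ->
  (forall z, u n z @[n --> \oo] --> v z) -> multiplier v.
Proof.
move=> mu_ uM mv uv.
have vM z : `|v z| <= M.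
  have /cvg_norm h := uv z; move/cvg_lim : (h) => <- //.
  by apply: limr_le; [apply/cvg_ex; exists `|v z| |apply: nearW].
split=> //; first by exists M.
move=> f [fi f0]; have mf := cintble_cmeas fi.
have ib : cintble (fun z => f z * (v z)%:C).
  apply: (@cintbleM_bounded _ f (fun z => (v z)%:C) M fi (cmeas_real mv)).
  by move=> z; rewrite normc_real.
split=> // k.
have iG := integrableZl measurableT M (cintble_norm fi).
apply: (@cint_dominated (fun n z => f z * (u n z)%:C * (z : C) ^ k) _
  (fun z => M * normc (f z))) => //.
- move=> n; have [m _ _] := mu_ n.
  apply: cmeasM; last exact: cmeas_zpow.
  by apply: cmeasM => //; exact: cmeas_real.
- apply: cmeasM; last exact: cmeas_zpow.
  by apply: cmeasM => //; exact: cmeas_real.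
- move=> n z; rewrite !normcM normc_zpow mulr1 normc_real mulrC.
  by rewrite ler_wpM2r ?normc_ge0.
- move=> z.
  have E (r : R) : Re (f z * r%:C * (z : C) ^ k) = r * Re (f z * (z : C) ^ k).
    by rewrite !ReImE /=; ring.
  under eq_fun do rewrite E; rewrite E; apply: cvgM; [exact: uv|exact: cvg_cst].
- move=> z.
  have E (r : R) : Im (f z * r%:C * (z : C) ^ k) = r * Im (f z * (z : C) ^ k).
    by rewrite !ReImE /=; ring.
  under eq_fun do rewrite E; rewrite E; apply: cvgM; [exact: uv|exact: cvg_cst].
- by move=> n; have [_ _ h] := mu_ n; have [_] := h f (conj fi f0).
Qed.

(* Iterating this polynomial drives [0, 1/2[ to 0 and ]1/2, 1] to 1, so that
   indicators of superlevel sets are bounded limits of multipliers. *)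
Definition smoothstep (t : R) : R := t ^+ 2 * (3%:R - t *+ 2).

Lemma smoothstepC t : smoothstep (1 - t) = 1 - smoothstep t.
Proof. by rewrite /smoothstep; ring. Qed.

Lemma iter_smoothstepC n t : iter n smoothstep (1 - t) = 1 - iter n smoothstep t.
Proof. by elim: n => // n IH; rewrite !iterS IH smoothstepC. Qed.

(** Each iteration multiplies x by x (3 - 2 x), which increases with x on [0, 1/2[. The iterates
    stay below t, so every factor is at most t (3 - 2 t), a number below 1. *)
Lemma iter_smoothstep_lt n t : 0 <= t -> t < 2^-1 ->
  0 <= iter n smoothstep t <= (t * (3%:R - t *+ 2)) ^+ n * t.
Proof.
move=> t0 t1; set q := t * _.
have q0 : 0 <= q by rewrite /q mulr_ge0 //; lra.
have q1 : q <= 1 by rewrite /q; nra.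
elim: n => [|n /andP[IH0 IH1]]; first by rewrite expr0 mul1r t0 lexx.
rewrite iterS /smoothstep; move: (iter n smoothstep t) IH0 IH1 => x x0 xq.
have qn : q ^+ n * t <= t by rewrite ler_piMl // exprn_ile1.
have xt := le_trans xq qn.
apply/andP; split; first by rewrite mulr_ge0 ?sqr_ge0 //; lra.
have h : x * (3%:R - x *+ 2) <= q by rewrite /q; nra.
have -> : q ^+ n.+1 * t = q * (q ^+ n * t) by rewrite exprS mulrA.
rewrite [leLHS](_ : _ = x * (3%:R - x *+ 2) * x); last by ring.
apply: ler_pM => //; rewrite mulr_ge0 //; lra.
Qed.

Lemma cvg_iter_smoothstep_lt t : 0 <= t -> t < 2^-1 ->
  iter n smoothstep t @[n --> \oo] --> (0 : R).
Proof.
move=> t0 t1; apply: (@squeeze_cvgr _ _ _ _ (fun=> 0) (fun n => (t * (3%:R - t *+ 2)) ^+ n * t)).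
- by apply: nearW => n; exact: iter_smoothstep_lt.
- exact: cvg_cst.
- rewrite -[X in _ --> X](mul0r t); apply: cvgMl; apply: cvg_expr.
  by rewrite ger0_norm ?mulr_ge0 //; nra.
Qed.

Definition smooth_limit (t : R) : R :=
  if t < 2^-1 then 0 else if t == 2^-1 then 2^-1 else 1.

Lemma cvg_iter_smoothstep t : 0 <= t <= 1 ->
  iter n smoothstep t @[n --> \oo] --> smooth_limit t.
Proof.
move=> /andP[t0 t1]; rewrite /smooth_limit; case: ltP => ht.
  exact: cvg_iter_smoothstep_lt.
case: eqP => [->|/eqP hne].
  rewrite [X in X @ _ --> _](_ : _ = fun=> 2^-1); first exact: cvg_cst.
  by apply/funext => n; elim: n => // n IH; rewrite iterS IH /smoothstep; field.
have E : (fun n => iter n smoothstep t) = (fun n => 1 - iter n smoothstep (1 - t)).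
  by apply/funext => n; rewrite iter_smoothstepC opprB addrC subrK.
rewrite E -[X in _ --> X]subr0; apply: cvgB; first exact: cvg_cst.
by apply: cvg_iter_smoothstep_lt; [lra|move: ht; rewrite le_eqVlt eq_sym (negbTE hne) /=; lra].
Qed.

Lemma multiplier_iter_smoothstep n u : multiplier u -> multiplier (fun z => iter n smoothstep (u z)).
Proof.
move=> mu_; elim: n => // n IH.
have -> : (fun z => iter n.+1 smoothstep (u z)) = (fun z =>
   (iter n smoothstep (u z) * iter n smoothstep (u z)) *
   (3%:R + (- 2%:R) * iter n smoothstep (u z))).
  by apply/funext => z; rewrite iterS /smoothstep; ring.
apply: multiplierM; first exact: multiplierM.
apply: multiplierD; first exact: multiplier_cst.
by apply: multiplierM => //; exact: multiplier_cst.
Qed.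

Lemma iter_smoothstep01 n t : 0 <= t <= 1 -> 0 <= iter n smoothstep t <= 1.
Proof.
move=> t01; elim: n => // n; rewrite iterS /smoothstep; move: (iter _ _ _) => x /andP[x0 x1].
apply/andP; split; first by rewrite mulr_ge0 ?sqr_ge0 //; lra.
have h : 0 <= 1 + x *+ 2 by lra.
by have := mulr_ge0 (sqr_ge0 (1 - x)) h; nra.
Qed.

Lemma multiplier_superlevel u c : multiplier u ->
  multiplier (fun z => (c < u z)%R%:R : R).
Proof.
move=> mu_; have [mmu [M uM] _] := mu_.
have M0 : 0 <= M by apply: le_trans (uM (expi 0)).
(* The slope is small enough for v to stay in [0, 1], and u = c corresponds to v = 1/2. *)
pose a : R := (2%:R * (M + `|c| + 1))^-1.
have s0 : 0 < M + `|c| + 1 by rewrite ltr_wpDl // addr_ge0.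
have a0 : 0 < a by rewrite invr_gt0 mulr_gt0.
pose v z := 2^-1 + a * (u z - c).
have mv : multiplier v.
  apply: multiplierD; first exact: multiplier_cst.
  apply: multiplierM; first exact: multiplier_cst.
  by apply: multiplierD => //; exact: multiplier_cst.
have v01 z : 0 <= v z <= 1.
  have h : `|a * (u z - c)| <= 2^-1.
    rewrite normrM (gtr0_norm a0) /a invfM -mulrA ger_pMr ?invr_gt0 //.
    rewrite mulrC ler_pdivrMr // mul1r.
    by apply: le_trans (ler_normB _ _) _; have := uM z; lra.
  by move: h; rewrite /v ler_norml => /andP[]; move: (a * _) => x; lra.
have vc z : (c < u z) = (2^-1 < v z) by rewrite /v ltrDl pmulr_rgt0 // subr_gt0.
pose L z := smooth_limit (v z).
have mL : multiplier L.
  have mvv : measurable_fun setT v by case: mv.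
  apply: (@multiplier_lim (fun n z => iter n smoothstep (v z)) _ 1).
  - by move=> n; exact: multiplier_iter_smoothstep.
  - by move=> n z; have := iter_smoothstep01 n (v01 z); rewrite ler_norml; lra.
  - apply: (@measurable_fun_cvg _ _ _ _ (fun n z => iter n smoothstep (v z))) => //.
      by move=> n; case: (multiplier_iter_smoothstep n mv).
    by move=> z _; exact: cvg_iter_smoothstep.
  - by move=> z; exact: cvg_iter_smoothstep.
(* L takes the values 0, 1/2 and 1, which L (2 L - 1) sends to 0, 0 and 1: the boundary value 1/2 is
   sent to 0, as the strict inequality requires. *)
have -> : (fun z => (c < u z)%R%:R : R) = (fun z => L z * (2%:R * L z + (-1))).
  apply/funext => z; rewrite vc /L /smooth_limit.
  by case: ltgtP => _ /=; [ring|ring|field].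
apply: multiplierM => //; apply: multiplierD; last exact: multiplier_cst.
by apply: multiplierM => //; exact: multiplier_cst.
Qed.

(** Stated for preimages under an arbitrary h, to serve both for a real multiplier and for the
    coordinate map of the circle. *)
Lemma multiplier_sigma_algebra (Y : Type) (h : T -> Y) :
  sigma_algebra setT [set B | multiplier (\1_(h @^-1` B) : T -> R)].
Proof.
split=> /=.
- rewrite preimage_set0; have -> : \1_set0 = (fun=> 0) :> (T -> R).
    by apply/funext => z; rewrite indicE in_set0.
  exact: multiplier_cst.
- move=> A mA.
  have -> : \1_(h @^-1` (setT `\` A)) = (fun z => 1 + (-1) * \1_(h @^-1` A) z) :> (T -> R).
    apply/funext => z; rewrite !indicE setTD preimage_setC in_setC.
    by case: (z \in _) => /=; ring.
  apply: multiplierD; first exact: multiplier_cst.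
  by apply: multiplierM => //; exact: multiplier_cst.
(* The indicator of the union of the first n sets, written with products and complements. *)
- move=> A mA; pose u n (z : T) : R := 1 + (-1) * \prod_(k < n) (1 + (-1) * \1_(h @^-1` A k) z).
  have mu_ n : multiplier (u n).
    apply: multiplierD; first exact: multiplier_cst.
    apply: multiplierM; first exact: multiplier_cst.
    elim: n => [|n IH]; first by under eq_fun do rewrite big_ord0; exact: multiplier_cst.
    under eq_fun do rewrite big_ord_recr /=.
    apply: multiplierM => //; apply: multiplierD; first exact: multiplier_cst.
    by apply: multiplierM => //; exact: multiplier_cst.
  have uv z : u n z @[n --> \oo] --> (\1_(h @^-1` (\bigcup_k A k)) z : R).
    have [[k _ Ak]|nA] := pselect ((\bigcup_k A k) (h z)).
      rewrite indicE mem_set; last by exists k.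
      apply: cvg_near_cst; apply: filterS (nbhs_infty_gt k) => n /= kn.
      rewrite /u (bigD1 (Ordinal kn)) //= indicE mem_set //.
      by rewrite mulr1 subrr mul0r mulr0 addr0.
    rewrite indicE memNset //; apply: cvg_near_cst; apply: nearW => n.
    rewrite /u big1 ?mulr1 ?subrr // => k _.
    by rewrite indicE memNset ?mulr0 ?addr0 // => Ak; apply: nA; exists (k : nat).
  have b01 n z : `|u n z| <= 1.
    have : 0 <= \prod_(k < n) (1 + (-1) * \1_(h @^-1` A k) z : R) <= 1.
      apply: (big_ind (fun x : R => 0 <= x <= 1)).
      - by rewrite ler01 lexx.
      - by move=> x y /andP[x0 x1] /andP[y0 y1]; rewrite mulr_ge0 ?mulr_ile1.
      - by move=> k _; rewrite indicE; case: (z \in _) => /=; apply/andP; split; lra.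
    by rewrite /u ler_norml; move: (\prod_(k < n) _) => x; lra.
  apply: (multiplier_lim mu_ b01) => //.
  apply: (@measurable_fun_cvg _ _ _ _ u) => //.
    by move=> n; case: (mu_ n).
Qed.

Lemma multiplier_preimage (u : T -> R) (A : set R) : multiplier u -> measurable A ->
  multiplier (\1_(u @^-1` A) : T -> R).
Proof.
move=> mu_ mA0; have mA : (@RGenOInfty.G R).-sigma.-measurable A.
  by rewrite -RGenOInfty.measurableE.
have := @smallest_sub _ (sigma_algebra setT) (@RGenOInfty.G R) _ (multiplier_sigma_algebra u).
apply=> // _ [c ->] /=.
have -> : \1_(u @^-1` `]c, +oo[%classic) = (fun z => (c < u z)%R%:R) :> (T -> R).
  apply/funext => z; rewrite indicE; congr (_%:R); congr nat_of_bool.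
  by apply/idP/idP; [move/set_mem|move=> h; apply/mem_set]; rewrite /= in_itv /= andbT.
exact: multiplier_superlevel.
Qed.

Lemma multiplier_measurable (A : set T) : measurable A -> multiplier (\1_A : T -> R).
Proof.
move=> [B mB <-]; rewrite setTI; move: mB.
rewrite measurable_prod_measurableType => mB.
have := @smallest_sub _ (sigma_algebra setT) _ _ (multiplier_sigma_algebra (@circle_coord R)).
move=> h; apply: h mB => _ [A1 mA1 [A2 mA2 <-]] /=.
have -> : \1_(@circle_coord R @^-1` (A1 `*` A2)) =
    (fun z => \1_((fun z : T => Re z) @^-1` A1) z * \1_((fun z : T => Im z) @^-1` A2) z) :> (T -> R).
  apply/funext => z; rewrite !indicE -natrM mulnb; congr (_%:R); congr nat_of_bool.
  apply/idP/andP => [/set_mem[h1 h2]|[/set_mem h1 /set_mem h2]].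
    by split; apply/mem_set.
  by apply/mem_set; split.
apply: multiplierM; apply: multiplier_preimage => //.
  exact: multiplier_Re.
exact: multiplier_Im.
Qed.

(** The integral of f over a Borel set is the coefficient of order 0 of f times its indicator, which
    is a multiplier. *)
Lemma fourier_unique f : zero_coefs f -> {ae mu, forall z, f z = 0}.
Proof.
move=> zf; have [[f1 f2] _] := zf.
have key A : measurable A -> cintegral (fun z => f z * (\1_A z)%:C) = 0.
  move=> /multiplier_measurable[_ _ /(_ _ zf)[_ /(_ 0)]].
  by under eq_fun do rewrite expr0z mulr1.
have fin (u : T -> R) A : measurable A -> mu.-integrable setT (fun z => (u z)%:E) ->
    \int[mu]_z (u z * \1_A z) = 0 -> (\int[mu]_(z in A) (u z)%:E = \int[mu]_(z in A) 0%:E)%E.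
  move=> mA iu; rewrite integral0 /Rintegral => h.
  have -> : (\int[mu]_(z in A) (u z)%:E = \int[mu]_z (u z * \1_A z)%:E)%E.
    by rewrite integral_mkcond; apply: eq_integral => z _; rewrite patchE indicE; case: ifP; rewrite ?mulr1 ?mulr0.
  have ii : mu.-integrable setT (fun z => (u z * \1_A z)%:E).
    apply: (le_integrable measurableT _ _ iu).
      apply/measurable_EFinP; apply: measurable_funM; last exact: measurable_indic.
      by apply/measurable_EFinP; exact: measurable_int iu.
    move=> z _ /=; rewrite lee_fin normrM indicE ler_piMr //.
    by case: (z \in A); rewrite ?normr1 ?normr0.
  by rewrite -(fineK (integrable_fin_num measurableT ii)) h.
have f1' : ae_eq mu setT (fun z => (Re (f z))%:E) (fun=> 0%:E).
  apply: integral_ae_eq => // A _ mA; apply: fin => //.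
  have := key A mA => /(congr1 (@complex.Re R)) /= <-.
  by apply: eq_Rintegral => z _; rewrite !ReImE /= mulr0 subr0.
have f2' : ae_eq mu setT (fun z => (Im (f z))%:E) (fun=> 0%:E).
  apply: integral_ae_eq => // A _ mA; apply: fin => //.
  have := key A mA => /(congr1 (@complex.Im R)) /= <-.
  by apply: eq_Rintegral => z _; rewrite !ReImE /= mulr0 add0r.
apply: filterS2 f1' f2' => z /(_ I)[h1] /(_ I)[h2].
exact: complex_eq.
Qed.

End FourierUniqueness.

(** * The space L^2 *)

Section L2Space.
Variable R : realType.
Local Notation C := R[i].
Local Notation T := (circle R).
Local Notation mu := (circle_measure R).

Lemma mx_measurableP m n (F : mfunT R m n) :
  mx_measurable F <-> forall i j, cmeas (fun z => F z i j).
Proof. by []. Qed.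

Lemma measurable_enorm_sq n (f : vfunT R n) : mx_measurable f ->
  measurable_fun setT (fun z => enorm (f z) ^+ 2).
Proof.
move=> mf; under eq_fun do rewrite enorm_sqE.
apply: measurable_sum => i; apply: measurable_normc_sq; exact: mf.
Qed.

Lemma measurable_enorm n (f : vfunT R n) : mx_measurable f ->
  measurable_fun setT (fun z => enorm (f z)).
Proof.
move=> mf; have -> : (fun z => enorm (f z)) = (fun z => Num.sqrt (enorm (f z) ^+ 2)).
  by apply/funext => z; rewrite sqrtr_sqr ger0_norm ?enorm_ge0.
apply: measurableT_comp (measurable_enorm_sq mf).
by apply: continuous_measurable_fun; exact: sqrt_continuous.
Qed.

Lemma norm2E n (f : vfunT R n) : mu.-integrable setT (fun z => (enorm (f z) ^+ 2)%:E) ->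
  norm2 f = (Num.sqrt (\int[mu]_z (enorm (f z) ^+ 2)))%:E.
Proof.
move=> fi; rewrite /norm2 unlock.
have -> : (\int[mu]_z (`|(enorm (f z))%:E| `^ 2) = \int[mu]_z (enorm (f z) ^+ 2)%:E)%E.
  apply: eq_integral => z _; rewrite abse_EFin ger0_norm ?enorm_ge0 // poweR_EFin.
  by rewrite powR_mulrn ?enorm_ge0.
rewrite -(fineK (integrable_fin_num measurableT fi)) poweR_EFin powR12_sqrt //.
by apply: Rintegral_ge0 => z _; exact: sqr_ge0.
Qed.

Lemma L2P n (f : vfunT R n) : L2 f <->
  mx_measurable f /\ mu.-integrable setT (fun z => (enorm (f z) ^+ 2)%:E).
Proof.
split=> [[mf nf]|[mf fi]]; split=> //; last by rewrite norm2E // ltry.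
apply/integrableP; split; first by apply/measurable_EFinP; exact: measurable_enorm_sq.
have := poweR_lty 2 nf; rewrite /norm2 poweR_Lnorm //.
under eq_integral => z _ do
  rewrite abse_EFin ger0_norm ?enorm_ge0 // poweR_EFin powR_mulrn ?enorm_ge0 //.
by under [X in _ -> (X < _)%E]eq_integral => z _ do rewrite abse_EFin ger0_norm ?sqr_ge0 //.
Qed.

Definition L2pred n : {pred vfunT R n} := fun f => `[< L2 f >].

Lemma mx_measurable_lin m n (a : C) (f g : mfunT R m n) :
  mx_measurable f -> mx_measurable g -> mx_measurable (a *: f + g).
Proof.
move=> mf mg i j; have := cmeasD (cmeasM (cmeas_cst a) (mf i j)) (mg i j).
rewrite -/(cmeas (fun z => (a *: f + g) z i j)).
have -> // : (fun z => (a *: f + g) z i j) = (fun z => a * f z i j + g z i j).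
by apply/funext => z; rewrite [LHS](_ : _ = (a *: f z + g z) i j) // !mxE.
Qed.

Lemma L2_submod_closed n : submod_closed (@L2pred n).
Proof.
split.
  apply/asboolP/L2P; split.
    move=> i j; rewrite -/(cmeas (fun z => (0 : vfunT R n) z i j)).
    have -> : (fun z => (0 : vfunT R n) z i j) = (fun=> 0) by apply/funext => z; rewrite mxE.
    exact: cmeas_cst.
  by under eq_fun do rewrite enorm0 expr0n; exact: integrable_cst.
move=> a f g /asboolP/L2P[mf fi] /asboolP/L2P[mg gi]; apply/asboolP/L2P.
have mfg := mx_measurable_lin a mf mg; split=> //.
have h := integrableD measurableT (integrableZl measurableT (2%:R * normc a ^+ 2) fi)
  (integrableZl measurableT 2%:R gi).
apply: le_integrable h => //.
  by apply/measurable_EFinP; exact: measurable_enorm_sq.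
move=> z _ /=; rewrite lee_fin ger0_norm ?sqr_ge0 // ger0_norm; last first.
  by rewrite addr_ge0 // mulr_ge0 ?sqr_ge0 // mulr_ge0 ?sqr_ge0.
have := enormD (a *: f z) (g z); rewrite enormZ => h1.
have : enorm (a *: f z + g z) ^+ 2 <= (normc a * enorm (f z) + enorm (g z)) ^+ 2.
  by rewrite ler_pXn2r ?nnegrE ?addr_ge0 ?mulr_ge0 ?enorm_ge0 ?normc_ge0.
move/le_trans; apply; rewrite -mulrA -exprMn.
by have := sqr_ge0 (normc a * enorm (f z) - enorm (g z)); nra.
Qed.

HB.instance Definition _ n :=
  GRing.isSubmodClosed.Build C (vfunT R n) (@L2pred n) (@L2_submod_closed n).

(** The elements are functions, not classes: the inner product below is only semi-definite, and
    equality in L^2 is expressed by a vanishing [nm] or almost everywhere. *)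
Record L2T n := MkL2T { L2val :> vfunT R n; _ : L2val \in @L2pred n }.
HB.instance Definition _ n := [isSub for @L2val n].
HB.instance Definition _ n := [Choice of L2T n by <:].
HB.instance Definition _ n := [SubChoice_isSubLmodule of L2T n by <:].

Implicit Types (n : nat).

Lemma L2valD n (f g : L2T n) z : (f + g) z = f z + g z. Proof. by []. Qed.
Lemma L2valZ n a (f : L2T n) z : (a *: f) z = a *: f z. Proof. by []. Qed.
Lemma L2valN n (f : L2T n) z : (- f) z = - f z. Proof. by []. Qed.
Lemma L2valB n (f g : L2T n) z : (f - g) z = f z - g z. Proof. by []. Qed.
Lemma L2val0 n z : (0 : L2T n) z = 0. Proof. by []. Qed.

Lemma L2T_P n (f : L2T n) : L2 f.
Proof. by have := valP f => /asboolP. Qed.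

Definition mkL2 n (f : vfunT R n) (Hf : L2 f) : L2T n := @MkL2T n f (asboolT Hf).

Lemma L2T_meas n (f : L2T n) : mx_measurable f.
Proof. by have /L2P[] := L2T_P f. Qed.

Lemma L2T_cmeas n (f : L2T n) i : cmeas (fun z => f z i ord0).
Proof. exact: L2T_meas. Qed.

Lemma L2T_integrable n (f : L2T n) : mu.-integrable setT (fun z => (enorm (f z) ^+ 2)%:E).
Proof. by have /L2P[] := L2T_P f. Qed.

Lemma cintble_dotc n (f g : L2T n) : cintble (fun z => dotc (f z) (g z)).
Proof.
have h := integrableD measurableT (L2T_integrable f) (L2T_integrable g).
apply: (cintble_le (g := fun z => enorm (f z) ^+ 2 + enorm (g z) ^+ 2)).
- apply: cmeas_sum => i; apply: cmeasM; first exact: L2T_cmeas.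
  by apply: cmeas_conj; exact: L2T_cmeas.
- by under eq_fun do rewrite EFinD.
- move=> z; apply: le_trans (normc_dotc _ _) _.
  by have := sqr_ge0 (enorm (f z) - enorm (g z)); have := sqr_ge0 (enorm (f z));
    have := sqr_ge0 (enorm (g z)); nra.
Qed.

(* Sealed behind an opaque proof: conversion would otherwise compare inner
   products through their integrals. *)
Fact ip_subproof : { F : forall n, L2T n -> L2T n -> C | forall n f g, F n f g = inner f g }.
Proof. by exists (fun n f g => inner f g). Qed.

Definition ip n : L2T n -> L2T n -> C := sval ip_subproof n.

Lemma ip_inner n (f g : L2T n) : ip f g = inner f g.
Proof. exact: svalP ip_subproof n f g. Qed.

Lemma ipE n (f g : L2T n) : ip f g = cintegral (fun z => dotc (f z) (g z)).
Proof. exact: ip_inner. Qed.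

Lemma ip_herm n : hermitian (@ip n).
Proof.
split=> [x y z|a x z|x y]; rewrite !ipE.
- rewrite -cintD; try exact: cintble_dotc.
  by congr cintegral; apply/funext => w; rewrite L2valD (hermD (dotc_herm R n)).
- rewrite -cintZ; try exact: cintble_dotc.
  by congr cintegral; apply/funext => w; rewrite L2valZ (hermZ (dotc_herm R n)).
- rewrite -cint_conj; try exact: cintble_dotc.
  by congr cintegral; apply/funext => w; rewrite (hermC (dotc_herm R n)).
Qed.

Lemma qf_ip n (f : L2T n) : qf (@ip n) f = \int[mu]_z (enorm (f z) ^+ 2).
Proof. by rewrite /qf ipE /=; apply: eq_Rintegral => z _; rewrite enorm_sq. Qed.

Lemma ip_psd n : psd (@ip n).
Proof.
split; first exact: ip_herm.
by move=> f; rewrite qf_ip; apply: Rintegral_ge0 => z _; exact: sqr_ge0.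
Qed.

Definition nm n (f : L2T n) : R := nrm (@ip n) f.

Lemma norm2_nm n (f : L2T n) : norm2 f = (nm f)%:E.
Proof. by rewrite norm2E ?/nm ?/nrm ?qf_ip //; exact: L2T_integrable. Qed.

Lemma qf_ip_EFin n (f : L2T n) :
  (qf (@ip n) f)%:E = (\int[mu]_z (enorm (f z) ^+ 2)%:E)%E.
Proof. by rewrite qf_ip /Rintegral fineK // integrable_fin_num //; exact: L2T_integrable. Qed.

Lemma nm_eq0 n (f : L2T n) : nm f = 0 <-> {ae mu, forall z, f z = 0}.
Proof.
split=> [f0|f0].
  have : (\int[mu]_z `|(enorm (f z) ^+ 2)%:E| = 0)%E.
    under eq_integral => z _ do rewrite abse_EFin ger0_norm ?sqr_ge0 //.
    rewrite -qf_ip_EFin -nrm_sq; last exact: ip_psd.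
    by rewrite -/(nm f) f0 expr0n.
  have m2 : measurable_fun setT (fun z => (enorm (f z) ^+ 2)%:E).
    by apply/measurable_EFinP/measurable_enorm_sq; exact: L2T_meas.
  move/(ae_eq_integral_abs mu measurableT m2); apply: filterS => z /(_ I) /= [/eqP].
  by rewrite sqrf_eq0 => /eqP/enorm_eq0.
have : qf (@ip n) f = 0.
  apply: EFin_inj; rewrite qf_ip_EFin.
  rewrite (@ae_eq_integral _ _ _ _ _ (cst 0%E)) ?integral0 //.
    by apply/measurable_EFinP/measurable_enorm_sq; exact: L2T_meas.
  by apply: filterS f0 => z -> _; rewrite enorm0 expr0n.
exact: qf_nrm0.
Qed.

Lemma Linf_boundP m n (F : mfunT R m n) :
  Linf F <-> mx_measurable F /\ exists2 M : R, 0 <= M & {ae mu, forall z, mxopnorm (F z) <= M}.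
Proof.
split=> [[mF nF]|[mF [M M0 FM]]]; split=> //.
  have h := ess_sup_ge mu (fun z => (mxopnorm (F z))%:E).
  rewrite -/(normoo F) in h; case: (normoo F) nF h => [r _ h|//|_ h].
    exists (Num.max 0 r); first by rewrite le_max lexx.
    by apply: filterS h => z; rewrite lee_fin le_max => ->; rewrite orbT.
  exists 0 => //; apply: filterS h => z; by rewrite leeNy_eq.
apply: le_lt_trans (ltry M); apply/ess_supP.
by apply: filterS FM => z; rewrite lee_fin.
Qed.

Lemma L2_mul m n (F : mfunT R m n) (f : L2T n) : Linf F -> L2 (fun z => F z *m f z).
Proof.
move=> /Linf_boundP[mF [M M0 FM]].
have mFf : mx_measurable (fun z => F z *m f z).
  move=> i j; rewrite -/(cmeas (fun z => (F z *m f z) i j)).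
  under eq_fun do rewrite mxE.
  apply: cmeas_sum => k; apply: cmeasM; first exact: mF.
  exact: L2T_meas.
apply/L2P; split=> //; apply/integrableP; split.
  by apply/measurable_EFinP; exact: measurable_enorm_sq.
have iM := integrableZl measurableT (M ^+ 2) (L2T_integrable f).
apply: le_lt_trans (integrable_lty measurableT iM).
apply: ae_ge0_le_integral => //.
- apply/measurableT_comp => //.
  by apply/measurable_EFinP; exact: measurable_enorm_sq.
- by move=> z _; rewrite -EFinM lee_fin mulr_ge0 ?sqr_ge0.
- exact: measurable_int iM.
apply: filterS FM => z FMz _; rewrite abse_EFin ger0_norm ?sqr_ge0 // -EFinM lee_fin.
rewrite -exprMn ler_pXn2r ?nnegrE ?mulr_ge0 ?enorm_ge0 //.
by apply: le_trans (enorm_mulmx _ _) _; rewrite ler_wpM2r ?enorm_ge0.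
Qed.

(** Integrate x <= x^2 / (2 c) + c / 2 over the circle, which has total mass 1. *)
Lemma integral_enorm_le n (f : L2T n) (c : R) : 0 < c -> nm f <= c ->
  (\int[mu]_z (enorm (f z))%:E <= c%:E)%E.
Proof.
move=> c0 fc.
have i1 := integrableD measurableT (integrableZl measurableT (2%:R * c)^-1 (L2T_integrable f))
  (integrable_cst (c / 2%:R)).
apply: (@le_trans _ _ (\int[mu]_z ((2%:R * c)^-1%:E * (enorm (f z) ^+ 2)%:E + (c / 2%:R)%:E))%E).
  apply: ge0_le_integral => //.
  - by move=> z _; rewrite lee_fin enorm_ge0.
  - by apply/measurable_EFinP/measurable_enorm; exact: L2T_meas.
  - exact: measurable_int i1.
  move=> z _; rewrite -EFinM -EFinD lee_fin.
  have := sqr_ge0 (enorm (f z) - c); move: (enorm (f z)) => x h.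
  rewrite -(ler_pM2l (_ : 0 < 2%:R * c)) ?mulr_gt0 // mulrDr mulrA divff; last first.
    by rewrite mulf_neq0 // gt_eqF.
  have -> : 2%:R * c * (c / 2%:R) = c ^+ 2 by field.
  by nra.
rewrite integralD //; last 2 first.
- exact: integrableZl (L2T_integrable f).
- exact: integrable_cst.
rewrite integralZl //; last exact: L2T_integrable.
rewrite -qf_ip_EFin integral_cst //= probability_setT.
rewrite mule1 -EFinM -EFinD lee_fin.
have h : qf (@ip n) f <= c ^+ 2.
  by rewrite -nrm_sq ?ler_pXn2r ?nnegrE ?nrm_ge0 // ?(ltW c0) //; exact: ip_psd.
have h2 : (2%:R * c)^-1 * qf (@ip n) f <= c / 2%:R.
  rewrite mulrC ler_pdivrMr ?mulr_gt0 //; apply: le_trans h _.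
  by rewrite le_eqVlt; apply/orP; left; apply/eqP; field.
by move: h2; move: (_ * qf _ _) => x; lra.
Qed.

(** * Completeness of L^2 *)

Section Completeness.
Variables (n : nat) (v : nat -> L2T n).
Hypothesis vC : forall k, nm (v k.+1 - v k) <= 2%:R^-1 ^+ k.

(** The total variation of the sequence at z; its integral is at most 2, so it is finite almost
    everywhere. *)
Let S z : \bar R := (\sum_(0 <= k <oo) (enorm ((v k.+1 - v k) z))%:E)%E.

Let mS : measurable_fun setT S.
Proof.
apply: ge0_emeasurable_sum => [k z _ _|k _]; first by rewrite lee_fin enorm_ge0.
by apply/measurable_EFinP/measurable_enorm; exact: L2T_meas.
Qed.

Let S_fin : {ae mu, forall z, (S z < +oo)%E}.
Proof.
have S0 z : (0 <= S z)%E by apply: nneseries_ge0 => k _ _; rewrite lee_fin enorm_ge0.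
have iS : mu.-integrable setT S.
  apply/integrableP; split=> //.
  under eq_integral => z _ do rewrite gee0_abs //.
  rewrite integral_nneseries //; last 2 first.
  - by move=> k; apply/measurable_EFinP/measurable_enorm; exact: L2T_meas.
  - by move=> k z _; rewrite lee_fin enorm_ge0.
  apply: (@le_lt_trans _ _ (\sum_(0 <= k <oo) (2%:R^-1 ^+ k)%:E)%E).
    apply: lee_nneseries => [k _ _|k _]; first by apply: integral_ge0 => z _; rewrite lee_fin enorm_ge0.
    by apply: integral_enorm_le => //; rewrite exprn_gt0 ?invr_gt0.
  apply: (@le_lt_trans _ _ 2%:E); last exact: ltry.
  apply: lime_le; first by apply: is_cvg_nneseries => k _ _; rewrite lee_fin exprn_ge0.
  apply: nearW => k; rewrite sumEFin lee_fin.
  have h := @geometric_le_lim R k 1 2^-1 ler01; rewrite /series /= in h.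
  under eq_bigr do rewrite -[_ ^+ _]mul1r.
  have hh : `|2^-1 : R| < 1 by rewrite ger0_norm; lra.
  apply: le_trans (h _ hh) _; first by lra.
  by rewrite (_ : 1 - 2^-1 = 2^-1 :> R) ?div1r ?invrK //; field.
have := integrable_ae measurableT iS; apply: filterS => z /(_ I).
by rewrite ge0_fin_numE.
Qed.

Let A := [set z | (S z < +oo)%E].

Let mA : measurable A.
Proof.
have -> : A = setT `&` S @^-1` (~` [set +oo%E]).
  by rewrite setTI; apply/seteqP; split=> z; rewrite /A /= ltey => /eqP.
by apply: mS => //; apply: measurableC; exact: emeasurable_set1.
Qed.

(** Cutting off where the variation is infinite gives convergence at every point, hence a measurable
    limit. *)
Let x k z : 'cV[C]_n := (\1_A z)%:C *: v k z.

Let x_cauchy z i e : 0 < e -> exists N, forall p q, (N <= p)%N -> (N <= q)%N ->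
  normc (x p z i ord0 - x q z i ord0) <= e.
Proof.
move=> e0; have [Az|nAz] := pselect (A z); last first.
  exists 0 => p q _ _; rewrite /x indicE memNset // !scale0r !mxE subrr normc0.
  exact: ltW.
pose s k : R := \sum_(0 <= j < k) enorm ((v j.+1 - v j) z).
have s_mono p q : (p <= q)%N -> enorm (v q z - v p z) <= s q - s p.
  move=> pq; rewrite -(subnK pq) addnC; elim: (q - p)%N => [|d IH].
    by rewrite addn0 !subrr enorm0.
  rewrite addnS; have -> : v (p + d).+1 z - v p z = (v (p + d).+1 z - v (p + d)%N z) + (v (p + d)%N z - v p z).
    by rewrite addrA subrK.
  apply: le_trans (enormD _ _) _; rewrite -[v (p + d).+1 z - _]L2valB.
  have -> : s (p + d).+1 = s (p + d)%N + enorm ((v (p + d).+1 - v (p + d)%N) z).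
    by rewrite /s big_nat_recr.
  by move: IH; move: (enorm _) (enorm _) => *; lra.
have sS k : s k <= fine (S z).
  rewrite -lee_fin fineK; last first.
    by rewrite ge0_fin_numE //; apply: nneseries_ge0 => j _ _; rewrite lee_fin enorm_ge0.
  rewrite -sumEFin; apply: nneseries_lim_ge => j _ _; by rewrite lee_fin enorm_ge0.
have hS : has_sup (range s) by split; [exists (s 0), 0|exists (fine (S z)) => _ [k _ <-]].
have [_ [N _ <-] HN] := sup_adherent e0 hS.
have sup_ge k : s k <= sup (range s) by apply: ub_le_sup; [case: hS|exists k].
have key p q : (N <= p)%N -> (p <= q)%N -> normc (x p z i ord0 - x q z i ord0) <= e.
  move=> Np pq; rewrite /x indicE mem_set // !scale1r -normcN opprB.
  have -> : v q z i ord0 - v p z i ord0 = (v q z - v p z) i ord0 by rewrite !mxE.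
  apply: le_trans (le_normc_enorm _ _) _; apply: le_trans (s_mono _ _ pq) _.
  have h1 : s N <= s p by rewrite -subr_ge0; apply: le_trans (s_mono _ _ Np); exact: enorm_ge0.
  by have := sup_ge q; lra.
exists N => p q Np Nq; have [pq|qp] := leqP p q; first exact: key.
by rewrite -normcN opprB; apply: key => //; exact: ltnW.
Qed.

Let x_lim : exists l : vfunT R n, forall z i e, 0 < e -> exists N, forall p, (N <= p)%N ->
  normc (x p z i ord0 - l z i ord0) <= e.
Proof.
have /choice[l Hl] : forall zi : T * 'I_n, exists l, forall e, 0 < e -> exists N, forall p, (N <= p)%N ->
    normc (x p zi.1 zi.2 ord0 - l) <= e.
  by move=> [z i]; apply: complex_cauchy_cvg => e /x_cauchy; apply.
exists (fun z => \col_i l (z, i)) => z i e e0.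
by have [N HN] := Hl (z, i) _ e0; exists N => p Np; rewrite [(\col_i0 _) i ord0]mxE; exact: HN.
Qed.

Lemma fast_cauchy_cvg : exists l : L2T n, forall k, nm (v k - l) <= 2%:R * 2%:R^-1 ^+ k.
Proof.
have [l Hl] := x_lim.
have cvgl z i : (Re (x k z i ord0) @[k --> \oo] --> Re (l z i ord0)) /\
    (Im (x k z i ord0) @[k --> \oo] --> Im (l z i ord0)).
  split; apply/cvgrPdist_le => e /(Hl z i)[N HN]; exists N => //= p /HN h.
    by rewrite distrC -ReN -ReD; exact: le_trans (normc_Re _) h.
  by rewrite distrC -ImN -ImD; exact: le_trans (normc_Im _) h.
have ml : mx_measurable l.
  move=> i j; rewrite ord1.
  have mx k : cmeas (fun z => x k z i ord0).
    under eq_fun do rewrite mxE; apply: cmeasM; last exact: L2T_cmeas.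
    by apply: cmeas_real; apply: measurable_indic; exact: mA.
  split.
    apply: (@measurable_fun_cvg _ _ _ _ (fun k z => Re (x k z i ord0))) => [k|z _].
      by case: (mx k).
    by case: (cvgl z i).
  apply: (@measurable_fun_cvg _ _ _ _ (fun k z => Im (x k z i ord0))) => [k|z _].
    by case: (mx k).
  by case: (cvgl z i).
have nmd p q : (p <= q)%N -> nm (v p - v q) <= 2%:R * (2%:R^-1 ^+ p - 2%:R^-1 ^+ q).
  move=> pq; rewrite -(subnK pq) addnC; elim: (q - p)%N => [|d IH].
    by rewrite addn0 !subrr mulr0 /nm nrm0 //; exact: ip_psd.
  rewrite addnS; have -> : v p - v (p + d).+1 = (v p - v (p + d)%N) - (v (p + d).+1 - v (p + d)%N).
    by rewrite opprB addrA subrK.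
  apply: le_trans (nrmB (@ip_psd n) _ _) _; apply: le_trans (lerD IH (vC _)) _.
  by rewrite exprS; lra.
have mvl k : mx_measurable (fun z => v k z - l z).
  have := mx_measurable_lin (-1) ml (L2T_meas (v k)).
  have -> // : -1 *: l + v k = (fun z => v k z - l z).
  by apply/funext => z; rewrite [LHS](_ : _ = -1 *: l z + v k z) // scaleN1r addrC.
have Abig k : (\int[mu]_z (enorm (v k z - l z) ^+ 2)%:E <= ((2%:R * 2%:R^-1 ^+ k) ^+ 2)%:E)%E.
  have mf j : measurable_fun setT (fun z => (enorm ((v k - v j) z) ^+ 2)%:E).
    by apply/measurable_EFinP/measurable_enorm_sq; exact: L2T_meas.
  have f0 j z : setT z -> (0 <= (enorm ((v k - v j) z) ^+ 2)%:E)%E.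
    by move=> _; rewrite lee_fin sqr_ge0.
  have := fatou mu measurableT mf f0 => h.
  apply: le_trans (_ : (\int[mu]_z limn_einf (fun j => (enorm ((v k - v j) z) ^+ 2)%:E) <= _)%E); last first.
    apply: le_trans h _; rewrite limn_einf_lim; apply: lime_le; first exact: is_cvg_einfs.
    apply: nearW => N; apply: (@le_trans _ _ (\int[mu]_z (enorm ((v k - v (maxn N k)) z) ^+ 2)%:E)%E).
      by apply: ereal_inf_lbound; exists (maxn N k) => //=; exact: leq_maxl.
    rewrite -qf_ip_EFin lee_fin -nrm_sq; last exact: ip_psd.
    rewrite ler_pXn2r ?nnegrE ?nrm_ge0 ?mulr_ge0 ?exprn_ge0 //.
    apply: le_trans (nmd _ _ (leq_maxr _ _)) _.
    by rewrite ler_wpM2l // gerBl exprn_ge0.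
  have E : {ae mu, forall z, setT z -> ((enorm (v k z - l z) ^+ 2)%:E = limn_einf (fun j => (enorm ((v k - v j) z) ^+ 2)%:E))%E}.
    apply: filterS S_fin => z Az _.
    suff h1 : (enorm ((v k - v j) z) ^+ 2)%:E @[j --> \oo] --> (enorm (v k z - l z) ^+ 2)%:E.
      by rewrite (cvg_limn_einf_sup h1).1.
    apply: cvg_EFin; first exact: nearW.
    suff h2 : enorm ((v k - v j) z) @[j --> \oo] --> enorm (v k z - l z).
      by rewrite expr2; under eq_fun do rewrite /= expr2; exact: cvgM.
    have h3 : \sum_i normc (x j z i ord0 - l z i ord0) @[j --> \oo] --> (0 : R).
      have s0 : (0 : R) = \sum_(i < n) (0 : R) by rewrite big1.
      rewrite [X in _ --> X]s0.
      elim: (index_enum 'I_n) => [|i r IH].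
        by under eq_fun do rewrite big_nil; rewrite big_nil; exact: cvg_cst.
      under eq_fun do rewrite big_cons; rewrite big_cons; apply: cvgD => //.
      apply/cvgrPdist_le => e /(Hl z i)[N HN]; exists N => //= p /HN.
      by rewrite sub0r normrN ger0_norm ?normc_ge0.
    apply/cvgrPdist_le => e e0; have /cvgrPdist_le/(_ e e0) := h3.
    apply: filterS => j; rewrite sub0r normrN ger0_norm; last first.
      by apply: sumr_ge0 => i _; exact: normc_ge0.
    apply: le_trans; rewrite !enormE; apply: le_trans (nrm_dist (@dotc_psd R n) _ _) _.
    rewrite -enormE L2valB opprB addrC addrA subrK.
    apply: le_trans (enorm_le_sum _) _; apply: ler_sum => i _.
    by rewrite !mxE indicE mem_set // mul1r.
  rewrite (ae_eq_integral (fun z => limn_einf (fun j => (enorm ((v k - v j) z) ^+ 2)%:E))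
    _ measurableT _ _ E) //.
    by apply/measurable_EFinP/measurable_enorm_sq; exact: mvl.
  under eq_fun do rewrite -[limn_einf _]oppeK -limn_esupN.
  apply: measurableT_comp => //; apply: measurable_fun_limn_esup => j.
  exact: measurableT_comp (mf j).
have Lvl k : L2 (fun z => v k z - l z).
  apply/L2P; split; first exact: mvl.
  apply/integrableP; split; first by apply/measurable_EFinP/measurable_enorm_sq; exact: mvl.
  under eq_integral => z _ do rewrite abse_EFin ger0_norm ?sqr_ge0 //.
  by apply: le_lt_trans (Abig k) _; exact: ltry.
(* What is known to be in L^2 is each difference v k - l; the limit is therefore presented as v 0 -
   (v 0 - l). *)
exists (v 0%N - mkL2 (Lvl 0%N)) => k.
have E : nm (v k - (v 0%N - mkL2 (Lvl 0%N))) = nm (mkL2 (Lvl k)).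
  congr nm; apply/val_inj/funext => z /=.
  by rewrite [LHS](_ : _ = v k z - (v 0%N z - (v 0%N z - l z))) // subKr.
rewrite E; apply: nrm_le; first by rewrite mulr_ge0 ?exprn_ge0.
by rewrite -lee_fin qf_ip_EFin; exact: Abig.
Qed.

End Completeness.

Lemma ip_complete n : complete_form (@ip n).
Proof.
move=> u uC.
have hp k : (0 : R) < 2%:R^-1 ^+ k by rewrite exprn_gt0 ?invr_gt0.
have /choice[N HN] : forall k : nat, exists N, forall a b, (N <= a)%N -> (N <= b)%N ->
  nrm (@ip n) (u a - u b) <= 2%:R^-1 ^+ k by move=> k; exact: uC (hp k).
pose phi := fix phi k := if k is k'.+1 then maxn (phi k') (N k) else N 0%N.
have phiN k : (N k <= phi k)%N by case: k => [|k] //=; exact: leq_maxr.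
have phiS k : (phi k <= phi k.+1)%N by exact: leq_maxl.
have [k|l Hl] := @fast_cauchy_cvg n (fun k => u (phi k)).
  apply: HN; last exact: phiN.
  exact: leq_trans (phiN k) (phiS k).
exists l => e e0.
(* Once 2^-k for the distance from u a to u (phi k), and twice 2^-k from there to l. *)
have [k Hk] : exists k, 3%:R * 2%:R^-1 ^+ k <= e :> R.
  have [M HM] := invS_small (divr_gt0 e0 (ltr0Sn R 2)).
  exists M; rewrite mulrC -ler_pdivlMr //; apply: le_trans (HM M (leqnn _)).
  rewrite exprVn lef_pV2 ?posrE ?exprn_gt0 // -natrX ler_nat.
  exact: ltn_expl.
exists (phi k) => a pa.
have -> : u a - l = (u a - u (phi k)) + (u (phi k) - l) by rewrite addrA subrK.
apply: le_trans (nrmD (@ip_psd n) _ _) _.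
have h1 := HN k a (phi k) (leq_trans (phiN k) pa) (phiN k).
have h2 := Hl k; rewrite /nm in h2.
by move: Hk h1 h2; move: (_ ^+ k) (nrm _ _) (nrm _ _) => *; lra.
Qed.

End L2Space.

(** * Hardy spaces *)

Section Hardy.
Variable R : realType.
Local Notation C := R[i].
Local Notation T := (circle R).
Local Notation mu := (circle_measure R).

Record LinfT m n := MkLinfT { Linfval :> mfunT R m n; LinfT_P : Linf Linfval }.

Lemma LinfT_meas m n (A : LinfT m n) i j : cmeas (fun z => A z i j).
Proof. by have /Linf_boundP[h _] := LinfT_P A; exact: h. Qed.

Lemma LinfT_bound m n (A : LinfT m n) :
  exists2 M : R, 0 <= M & {ae mu, forall z, mxopnorm (A z) <= M}.
Proof. by have /Linf_boundP[_] := LinfT_P A. Qed.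

Lemma Linf_mul m n p (A : LinfT m n) (B : LinfT n p) : Linf (fun z => A z *m B z).
Proof.
apply/Linf_boundP; split.
  move=> i j; rewrite -/(cmeas (fun z => (A z *m B z) i j)).
  under eq_fun do rewrite mxE.
  by apply: cmeas_sum => k; apply: cmeasM; exact: LinfT_meas.
have [M M0 AM] := LinfT_bound A; have [N N0 BN] := LinfT_bound B.
exists (M * N); first exact: mulr_ge0.
apply: filterS2 AM BN => z AM BN; apply: mxopnorm_le; first exact: mulr_ge0.
move=> x; rewrite -mulmxA -mulrA; apply: le_trans (enorm_mulmx _ _) _.
apply: ler_pM => //; rewrite ?mxopnorm_ge0 ?enorm_ge0 //.
by apply: le_trans (enorm_mulmx _ _) _; rewrite ler_wpM2r ?enorm_ge0.
Qed.
Definition li_mul m n p (A : LinfT m n) (B : LinfT n p) := MkLinfT (Linf_mul A B).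

Lemma Linf_entry m n (F : mfunT R m n) (M : R) : mx_measurable F ->
  {ae mu, forall z, forall i j, normc (F z i j) <= M} -> Linf F.
Proof.
move=> mF FM; apply/Linf_boundP; split=> //; exists (\sum_(j < n) \sum_(i < m) Num.max 0 M).
  by apply: sumr_ge0 => j _; apply: sumr_ge0 => i _; rewrite le_max lexx.
apply: filterS FM => z FM; apply: le_trans (mxopnorm_le_mxabs _) _; apply: ler_sum => j _.
apply: le_trans (enorm_le_sum _) _; apply: ler_sum => i _.
by rewrite mxE le_max FM orbT.
Qed.

Lemma Linf_adj m n (A : LinfT m n) : Linf (fun z => adjmx (A z)).
Proof.
have [M _ AM] := LinfT_bound A; apply: (@Linf_entry _ _ _ M) => [i j|].
  rewrite -/(cmeas (fun z => adjmx (A z) i j)).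
  by under eq_fun do rewrite adjmxE; apply: cmeas_conj; exact: LinfT_meas.
apply: filterS AM => z AM i j; rewrite mxE mxE normc_conjc.
exact: le_trans (normc_le_mxopnorm _ _ _) AM.
Qed.
Definition li_adj m n (A : LinfT m n) := MkLinfT (Linf_adj A).

Lemma Linf_sub m n (A B : LinfT m n) : Linf (fun z => A z - B z).
Proof.
apply/Linf_boundP; split.
  move=> i j; rewrite -/(cmeas (fun z => (A z - B z) i j)).
  under eq_fun do rewrite !mxE.
  by apply: cmeasD; [|apply: cmeasN]; exact: LinfT_meas.
have [M M0 AM] := LinfT_bound A; have [N N0 BN] := LinfT_bound B.
exists (M + N); first exact: addr_ge0.
apply: filterS2 AM BN => z AM BN; apply: le_trans (mxopnormD _ _) _.
by rewrite mxopnormN lerD.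
Qed.
Definition li_sub m n (A B : LinfT m n) := MkLinfT (Linf_sub A B).

Lemma Linf_cst m n (M : 'M[C]_(m, n)) : Linf (fun=> M : 'M[C]_(m, n)).
Proof.
apply/Linf_boundP; split; first by move=> i j; exact: cmeas_cst.
exists (mxopnorm M); first exact: mxopnorm_ge0.
exact: aeW.
Qed.
Definition li_cst m n (M : 'M[C]_(m, n)) := MkLinfT (Linf_cst M).

Lemma Linf_conj m n (A : LinfT m n) : Linf (fun z => map_mx conjc (A z)).
Proof.
have [M _ AM] := LinfT_bound A; apply: (@Linf_entry _ _ _ M) => [i j|].
  rewrite -/(cmeas (fun z => map_mx conjc (A z) i j)).
  by under eq_fun do rewrite mxE; apply: cmeas_conj; exact: LinfT_meas.
apply: filterS AM => z AM i j; rewrite mxE normc_conjc.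
exact: le_trans (normc_le_mxopnorm _ _ _) AM.
Qed.
Definition li_conj m n (A : LinfT m n) := MkLinfT (Linf_conj A).

Lemma Linf_zpow n k : Linf (fun z : T => (z : C) ^ k *: (1%:M : 'M[C]_n)).
Proof.
apply/Linf_boundP; split.
  move=> i j; rewrite -/(cmeas (fun z : T => ((z : C) ^ k *: (1%:M : 'M[C]_n)) i j)).
  under eq_fun do rewrite mxE.
  by apply: cmeasM; [exact: cmeas_zpow|exact: cmeas_cst].
exists 1 => //; apply: aeW => z; apply: mxopnorm_le => // x.
by rewrite -scalemxAl mul1mx enormZ normc_zpow.
Qed.
Definition li_z n k : LinfT n n := MkLinfT (@Linf_zpow n k).

Definition mulL m n (A : LinfT m n) (f : L2T R n) : L2T R m := mkL2 (L2_mul f (LinfT_P A)).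

Lemma mulLE m n (A : LinfT m n) f z : mulL A f z = A z *m f z. Proof. by []. Qed.

Lemma L2T_ext n (f g : L2T R n) : (forall z, f z = g z) -> f = g.
Proof. by move=> fg; apply/val_inj/funext. Qed.

Lemma mulLD m n (A : LinfT m n) f g : mulL A (f + g) = mulL A f + mulL A g.
Proof. by apply: L2T_ext => z; rewrite L2valD !mulLE L2valD mulmxDr. Qed.

Lemma mulLZ m n (A : LinfT m n) a f : mulL A (a *: f) = a *: mulL A f.
Proof. by apply: L2T_ext => z; rewrite L2valZ !mulLE L2valZ scalemxAr. Qed.

Lemma mulLN m n (A : LinfT m n) f : mulL A (- f) = - mulL A f.
Proof. by apply: L2T_ext => z; rewrite L2valN !mulLE L2valN mulmxN. Qed.

Lemma mulLB m n (A : LinfT m n) f g : mulL A (f - g) = mulL A f - mulL A g.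
Proof. by rewrite mulLD mulLN. Qed.

Lemma mulL0 m n (A : LinfT m n) : mulL A 0 = 0.
Proof. by apply: L2T_ext => z; rewrite mulLE mulmx0. Qed.

Lemma mulL_sum m n (A : LinfT m n) (I : Type) (r : seq I) (F : I -> L2T R n) :
  mulL A (\sum_(i <- r) F i) = \sum_(i <- r) mulL A (F i).
Proof.
apply: (big_morph _ (mulLD A)).
by rewrite -(scale0r 0) mulLZ scale0r.
Qed.

Lemma mulLA m n p (A : LinfT m n) (B : LinfT n p) f :
  mulL A (mulL B f) = mulL (li_mul A B) f.
Proof. by apply: L2T_ext => z; rewrite !mulLE mulmxA. Qed.

Lemma ip_mulL m n (A : LinfT m n) f g : ip (mulL A f) g = ip f (mulL (li_adj A) g).
Proof.
by rewrite !ipE; congr cintegral; apply/funext => z; rewrite dotc_adj.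
Qed.

(* Multiplication by z ^ k; [eb k i] below is z ^ k times the i-th basis vector. *)
Definition zs n (k : int) (f : L2T R n) : L2T R n := mulL (li_z n k) f.

Lemma zsE n k (f : L2T R n) z : zs k f z = (z : C) ^ k *: f z.
Proof. by rewrite mulLE /= -scalemxAl mul1mx. Qed.

Lemma zs_zs n j k (f : L2T R n) : zs j (zs k f) = zs (j + k) f.
Proof.
by apply: L2T_ext => z; rewrite !zsE scalerA expfzDr // circle_neq0.
Qed.

Lemma zs0 n (f : L2T R n) : zs 0 f = f.
Proof. by apply: L2T_ext => z; rewrite zsE expr0z scale1r. Qed.

Lemma zsK n k (f : L2T R n) : zs (- k) (zs k f) = f.
Proof. by rewrite zs_zs addNr zs0. Qed.

Lemma zsD n k (f g : L2T R n) : zs k (f + g) = zs k f + zs k g. Proof. exact: mulLD. Qed.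
Lemma zsZ n k a (f : L2T R n) : zs k (a *: f) = a *: zs k f. Proof. exact: mulLZ. Qed.
Lemma zsB n k (f g : L2T R n) : zs k (f - g) = zs k f - zs k g. Proof. exact: mulLB. Qed.

Lemma mulL_zs m n (A : LinfT m n) k f : mulL A (zs k f) = zs k (mulL A f).
Proof. by apply: L2T_ext => z; rewrite mulLE !zsE mulLE scalemxAr. Qed.

Lemma ip_zs n k (f g : L2T R n) : ip (zs k f) g = ip f (zs (- k) g).
Proof.
rewrite ip_mulL; congr ip; apply: L2T_ext => z; rewrite zsE mulLE /=.
by rewrite adjmxZ adjmx1 conjc_zpow -scalemxAl mul1mx.
Qed.

Lemma ip_zs_zs n k (f g : L2T R n) : ip (zs k f) (zs k g) = ip f g.
Proof. by rewrite ip_zs zsK. Qed.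

Lemma nm_zs n k (f : L2T R n) : nm (zs k f) = nm f.
Proof. by rewrite /nm /nrm /qf ip_zs_zs. Qed.

Lemma ip_zsr n k (f g : L2T R n) : ip f (zs k g) = cintegral (fun z => dotc (f z) (g z) * (z : C) ^ (- k)).
Proof.
rewrite ipE; congr cintegral; apply/funext => z.
by rewrite zsE (hermZr (dotc_herm R n)) conjc_zpow mulrC.
Qed.

Lemma ae_dotc0 n (f g : L2T R n) :
  (forall k, ip f (zs k g) = 0) <-> {ae mu, forall z, dotc (f z) (g z) = 0}.
Proof.
split=> [H|H k].
  apply: fourier_unique; split; first exact: cintble_dotc.
  by move=> k; have := H (- k); rewrite ip_zsr opprK.
rewrite ip_zsr -(@cint0 R); apply: cint_ae; last by apply: filterS H => z ->; rewrite mul0r.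
  by apply: cmeasM; [exact: cintble_cmeas (cintble_dotc _ _)|exact: cmeas_zpow].
exact: cmeas_cst.
Qed.

(** The function <f, g> minus its mean has no Fourier coefficients. *)
Lemma ae_dotc_cst n (f g : L2T R n) : (forall k, k != 0 -> ip f (zs k g) = 0) ->
  {ae mu, forall z, dotc (f z) (g z) = ip f g}.
Proof.
move=> H; suff : {ae mu, forall z, dotc (f z) (g z) + - ip f g = 0}.
  by apply: filterS => z /eqP; rewrite subr_eq0 => /eqP.
have icst : cintble (fun _ : T => - ip f g).
  by apply: (@cintble_bounded _ _ (normc (- ip f g))) => //; exact: cmeas_cst.
apply: fourier_unique; split; first by apply: cintbleD => //; exact: cintble_dotc.
move=> k; under eq_fun do rewrite mulrDl.
rewrite cintD; last 2 first.
- by apply: cintble_zpow; exact: cintble_dotc.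
- exact: cintble_zpow.
have -> : cintegral (fun z => dotc (f z) (g z) * (z : C) ^ k) = ip f (zs (- k) g).
  by rewrite ip_zsr opprK.
rewrite cintZ; last first.
  by apply: (@cintble_bounded _ _ 1) => [|z]; [exact: cmeas_zpow|rewrite normc_zpow].
rewrite cint_zpow; have [->|k0] := eqVneq k 0; first by rewrite oppr0 zs0 mulr1 subrr.
by rewrite H ?oppr_eq0 // mulr0 addr0.
Qed.

Lemma L2_cst n (c : 'cV[C]_n) : L2 (fun=> c : 'cV[C]_n).
Proof. by apply/L2P; split=> [i j|]; [exact: cmeas_cst|exact: integrable_cst]. Qed.
Definition cst2 n (c : 'cV[C]_n) : L2T R n := mkL2 (L2_cst c).

Definition eb n (k : int) (i : 'I_n) : L2T R n := zs k (cst2 (delta_mx i ord0)).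

Lemma dotc_delta n (x : 'cV[C]_n) i : dotc x (delta_mx i ord0) = x i ord0.
Proof.
rewrite /dotc (bigD1 i) //= mxE !eqxx rmorph1 mulr1 big1 ?addr0 // => j ji.
by rewrite mxE (negbTE ji) rmorph0 mulr0.
Qed.

Lemma ip_eb n (f : L2T R n) k i : ip f (eb k i) = fourier (fun z => f z i ord0) k.
Proof.
by rewrite ip_zsr; congr cintegral; apply/funext => z; rewrite dotc_delta.
Qed.

Lemma zs_eb n j k (i : 'I_n) : zs j (eb k i) = eb (j + k) i.
Proof. by rewrite /eb zs_zs. Qed.

Lemma ip_eb_eb n j k (i l : 'I_n) : ip (eb j i) (eb k l) = ((j == k) && (i == l))%:R.
Proof.
rewrite ip_eb /fourier.
have -> : (fun z : T => eb j i z l ord0 * (z : C) ^ (- k)) = (fun z => (i == l)%:R * (z : C) ^ (j - k)).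
  apply/funext => z; rewrite zsE !mxE eqxx andbT eq_sym mulrAC -expfzDr ?circle_neq0 //.
  by rewrite mulrC.
rewrite cintZ; last first.
  by apply: (@cintble_bounded _ _ 1) => [|z]; [exact: cmeas_zpow|rewrite normc_zpow].
by rewrite cint_zpow subr_eq0 -natrM mulnb andbC.
Qed.

Lemma ip_eb_unique n (f : L2T R n) : (forall k i, ip f (eb k i) = 0) -> nm f = 0.
Proof.
move=> H; apply/nm_eq0.
have : {ae mu, forall z, forall i, dotc (f z) (delta_mx i ord0) = 0}.
  by apply: filter_forall => i; apply/(ae_dotc0 f (cst2 (delta_mx i ord0))) => k; exact: H.
apply: filterS => z h; apply/matrixP => i j; rewrite ord1 [RHS]mxE.
by have := h i; rewrite dotc_delta.
Qed.

Definition Hp n : set (L2T R n) := [set f | H2 f].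
Definition Hm n : set (L2T R n) := [set f | H2minus f].

Lemma HpP n (f : L2T R n) : Hp f <-> forall k i, k < 0 -> ip f (eb k i) = 0.
Proof.
split=> [[_ H] k i k0|H]; first by rewrite ip_eb H.
by split; [exact: L2T_P|move=> i k k0; rewrite -ip_eb H].
Qed.

(** Exhibits H^2 as an orthogonal complement, so that it is closed and [projection_orth] applies. *)
Definition negS n : set (L2T R n) := [set eb ki.1 ki.2 | ki in [set ki : int * 'I_n | ki.1 < 0]].

Lemma Hp_orth n : @Hp n = orth (@ip R n) (@negS n).
Proof.
apply/seteqP; split=> f.
  by move/HpP => H _ [[k i] /= k0 <-]; exact: H.
by move=> H; apply/HpP => k i k0; apply: H; exists (k, i).
Qed.

Lemma HmP n (f : L2T R n) : Hm f <-> forall g, Hp g -> ip f g = 0.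
Proof.
split=> [[_ H] g Hg|H]; first by rewrite ip_inner; exact: H.
split; first exact: L2T_P.
by move=> g g2; have := H (mkL2 g2.1) g2; rewrite ip_inner.
Qed.

Lemma Hm_orth n : @Hm n = orth (@ip R n) (@Hp n).
Proof. by apply/seteqP; split=> f /HmP. Qed.

Lemma Hp_sub n : subspace (@Hp n).
Proof. by rewrite Hp_orth; apply: orth_subspace; exact: ip_herm. Qed.
Lemma Hm_sub n : subspace (@Hm n).
Proof. by rewrite Hm_orth; apply: orth_subspace; exact: ip_herm. Qed.

Lemma Hp_eb n (k : int) (i : 'I_n) : 0 <= k -> Hp (eb k i).
Proof.
move=> k0; apply/HpP => j l j0; rewrite ip_eb_eb.
by case: eqP j0 => // <-; rewrite ltNge k0.
Qed.

Lemma Hp_zs n (k : int) (f : L2T R n) : 0 <= k -> Hp f -> Hp (zs k f).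
Proof.
move=> k0 /HpP Hf; apply/HpP => j i j0; rewrite ip_zs zs_eb; apply: Hf.
lia.
Qed.

(* As for ip, the projections are sealed as whole functions. *)
Fact Pp_subproof : { P : forall n, L2T R n -> L2T R n |
  forall n (f : L2T R n), Hp (P n f) /\ Hm (f - P n f) }.
Proof.
suff H n (f : L2T R n) : exists p, Hp p /\ Hm (f - p).
  by exists (fun n f => sval (cid (H n f))) => n f; case: cid.
have [p p1 p2] := @projection_orth _ _ _ (@negS n) (@ip_psd R n) (@ip_complete R n) f.
exists p; rewrite Hp_orth; split=> //.
by apply/HmP => g; rewrite Hp_orth; exact: p2.
Qed.

Definition Pp n : L2T R n -> L2T R n := sval Pp_subproof n.

Fact Pm_subproof : { P : forall n, L2T R n -> L2T R n | forall n (f : L2T R n), P n f = f - Pp f }.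
Proof. by exists (fun n f => f - Pp f). Qed.

Definition Pm n : L2T R n -> L2T R n := sval Pm_subproof n.

Lemma PmE n (f : L2T R n) : Pm f = f - Pp f. Proof. exact: svalP Pm_subproof n f. Qed.

Lemma Pp_Hp n (f : L2T R n) : Hp (Pp f).
Proof. by case: (svalP Pp_subproof n f). Qed.

Lemma Pm_Hm n (f : L2T R n) : Hm (Pm f).
Proof. by rewrite PmE; case: (svalP Pp_subproof n f). Qed.

Lemma ip_HpHm n (f g : L2T R n) : Hp f -> Hm g -> ip f g = 0.
Proof. by move=> Hf /HmP Hg; rewrite (hermC (@ip_herm R n)) Hg // rmorph0. Qed.

Lemma PpPm n (f : L2T R n) : f = Pp f + Pm f. Proof. by rewrite PmE addrC subrK. Qed.

Lemma ip_Pp n (f g : L2T R n) : ip (Pp f) g = ip f (Pp g).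
Proof.
have h := @ip_herm R n.
rewrite {1}(PpPm g) {2}(PpPm f) (hermDr h) (hermD h).
by rewrite (ip_HpHm (Pp_Hp f) (Pm_Hm g)) ((HmP _).1 (Pm_Hm f)) //; exact: Pp_Hp.
Qed.

Lemma ip_Pm n (f g : L2T R n) : ip (Pm f) g = ip f (Pm g).
Proof. by have h := @ip_herm R n; rewrite !PmE (hermBl h) (hermBr h) ip_Pp. Qed.

Lemma qf_PpPm n (f : L2T R n) : qf (@ip R n) f = qf (@ip R n) (Pp f) + qf (@ip R n) (Pm f).
Proof.
rewrite {1}(PpPm f) (qfD (@ip_herm R n)) (ip_HpHm (Pp_Hp f) (Pm_Hm f)) /=.
by rewrite mul0rn addr0.
Qed.

Lemma ip0l n (f g : L2T R n) : nm f = 0 -> ip f g = 0.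
Proof.
move=> f0; apply: (form0l (@ip_psd R n)).
by rewrite -(nrm_sq (@ip_psd R n)) -/(nm f) f0 expr0n.
Qed.

Lemma ip0r n (f g : L2T R n) : nm g = 0 -> ip f g = 0.
Proof. by move=> g0; rewrite (hermC (@ip_herm R n)) ip0l // rmorph0. Qed.

Lemma ae_eq_nm n (f g : L2T R n) : {ae mu, forall z, f z = g z} <-> nm (f - g) = 0.
Proof.
rewrite nm_eq0; split; apply: filterS => z; first by move=> fg; rewrite L2valB fg subrr.
by rewrite L2valB => /eqP; rewrite subr_eq0 => /eqP.
Qed.

Lemma ip_ae n (f f' g : L2T R n) : {ae mu, forall z, f z = f' z} -> ip f g = ip f' g.
Proof.
move=> /ae_eq_nm/(ip0l g); rewrite (hermBl (@ip_herm R n)) => /eqP.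
by rewrite subr_eq0 => /eqP.
Qed.

Lemma nm_ae n (f g : L2T R n) : {ae mu, forall z, f z = g z} -> nm f = nm g.
Proof.
move=> fg; rewrite /nm /nrm /qf (ip_ae f fg) (hermC (@ip_herm R n)) (ip_ae g fg).
by rewrite Re_conjc.
Qed.

Lemma Hp_ae n (f g : L2T R n) : {ae mu, forall z, f z = g z} -> Hp f -> Hp g.
Proof. by move=> fg /HpP H; apply/HpP => k i k0; rewrite -(ip_ae _ fg) H. Qed.

(** Orthogonality to the exponentials of nonnegative frequency already kills every coefficient of
    the analytic part of u. *)
Lemma Hm_eb n (u : L2T R n) :
  (forall k i, 0 <= k -> ip u (eb k i) = 0) <-> Hm u.
Proof.
have h := @ip_herm R n; split=> [H|/HmP H k i k0]; last exact/H/Hp_eb.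
apply/HmP => g Hg; rewrite (PpPm u) (hermD h) ip0l ?add0r.
  by apply: (HmP _).1 => //; exact: Pm_Hm.
apply: ip_eb_unique => k i; case: (ltP k 0) => k0.
  exact: (HpP _).1 (Pp_Hp u) _ _ k0.
have := H k i k0; rewrite {1}(PpPm u) (hermD h) ((HmP _).1 (Pm_Hm u)) ?addr0 //.
exact: Hp_eb.
Qed.

Lemma L2_conj n (f : L2T R n) : L2 (fun z => map_mx conjc (f z)).
Proof.
apply/L2P; split=> [i j|].
  rewrite -/(cmeas (fun z => map_mx conjc (f z) i j)).
  under eq_fun do rewrite mxE.
  by rewrite ord1; apply: cmeas_conj; exact: L2T_cmeas.
have := L2T_integrable f; congr (_.-integrable _ _); apply/funext => z.
by rewrite !enorm_sqE; congr EFin; apply: eq_bigr => i _; rewrite mxE normc_conjc.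
Qed.
Definition cj n (f : L2T R n) : L2T R n := mkL2 (L2_conj f).

Lemma cjE n (f : L2T R n) z : cj f z = map_mx conjc (f z). Proof. by []. Qed.

Lemma cjK n (f : L2T R n) : cj (cj f) = f.
Proof. by apply: L2T_ext => z; apply/matrixP => i j; rewrite !mxE conjcK. Qed.

Lemma ip_cj n (f g : L2T R n) : ip (cj f) g = (ip f (cj g))^*.
Proof.
rewrite !ipE -cint_conj; last exact: cintble_dotc.
congr cintegral; apply/funext => z; rewrite conjc_sum; apply: eq_bigr => i _.
by rewrite conjcM !mxE conjcK.
Qed.

Lemma cj_zs n k (f : L2T R n) : cj (zs k f) = zs (- k) (cj f).
Proof.
apply: L2T_ext => z; rewrite cjE !zsE cjE; apply/matrixP => i j.
by rewrite !mxE conjcM conjc_zpow.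
Qed.

Lemma cj_cst2 n (c : 'cV[C]_n) : cj (cst2 c) = cst2 (map_mx conjc c).
Proof. exact: L2T_ext. Qed.

Lemma cj_eb n k (i : 'I_n) : cj (eb k i) = eb (- k) i.
Proof.
rewrite cj_zs cj_cst2; congr (zs _ (cst2 _)); apply/matrixP => a b.
by rewrite !mxE; case: (_ && _); rewrite ?rmorph0 ?rmorph1.
Qed.

(** Conjugation followed by division by z sends frequency k to -k - 1 and so exchanges negative and
    nonnegative frequencies. This symmetry makes co-analytic vectors accessible to the lemmas on
    H^2. *)
Lemma Hm_cj n (u : L2T R n) : Hm u <-> Hp (zs (-1) (cj u)).
Proof.
rewrite -Hm_eb HpP; split=> H k i k0.
  rewrite ip_zs ip_cj zs_eb cj_eb H ?rmorph0 //; lia.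
have := H (- k - 1) i ltac:(lia); rewrite ip_zs ip_cj zs_eb cj_eb.
have -> : - (- -1 + (- k - 1)) = k by lia.
by move=> /(congr1 (@conjc R)); rewrite conjcK rmorph0.
Qed.

Lemma Hm_zs n (k : int) (f : L2T R n) : k <= 0 -> Hm f -> Hm (zs k f).
Proof.
move=> k0 /Hm_eb H; apply/Hm_eb => j i j0; rewrite ip_zs zs_eb H //; lia.
Qed.

Lemma mulL_cst2 m n (A : LinfT m n) k (i : 'I_m) (j : 'I_n) :
  ip (mulL A (cst2 (delta_mx j ord0))) (eb k i) = fourier (fun z => A z i j) k.
Proof.
rewrite ip_eb; congr fourier; apply/funext => z.
by rewrite mulLE /= -colE mxE.
Qed.

Lemma Hinf_cst2 m n (A : LinfT m n) :
  Hinf A <-> forall j, Hp (mulL A (cst2 (delta_mx j ord0))).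
Proof.
split=> [[_ H] j|H]; first by apply/HpP => k i k0; rewrite mulL_cst2 H.
split; first exact: LinfT_P.
by move=> i j k k0; rewrite -mulL_cst2; exact: (HpP _).1 (H j) _ _ k0.
Qed.

(** By duality it suffices that A* sends exponentials of negative frequency into H^2_-, which is
    read off the coefficients of A. *)
Lemma Hp_mulL m n (A : LinfT m n) (f : L2T R n) : Hinf A -> Hp f -> Hp (mulL A f).
Proof.
move=> [_ HA] Hf; apply/HpP => k i k0; rewrite ip_mulL.
apply: ip_HpHm => //; apply/Hm_eb => j l j0.
have := HA i l (- j + k) ltac:(lia); rewrite -mulL_cst2 -zs_eb -ip_zs -mulL_zs -/(eb j l).
by rewrite ip_mulL (hermC (@ip_herm R n)) => /(congr1 (@conjc R)); rewrite conjcK rmorph0.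
Qed.

Lemma Hinf_mul m n p (A : LinfT m n) (B : LinfT n p) :
  Hinf A -> Hinf B -> Hinf (li_mul A B).
Proof.
move=> HA HB; apply/Hinf_cst2 => j; rewrite -mulLA.
by apply: Hp_mulL => //; move: j; apply/Hinf_cst2.
Qed.

Lemma mulL_sub m n (A B : LinfT m n) f : mulL (li_sub A B) f = mulL A f - mulL B f.
Proof. by apply: L2T_ext => z; rewrite L2valB !mulLE mulmxBl. Qed.

Lemma Hinf_sub m n (A B : LinfT m n) : Hinf A -> Hinf B -> Hinf (li_sub A B).
Proof.
move=> /Hinf_cst2 HA /Hinf_cst2 HB; apply/Hinf_cst2 => j; rewrite mulL_sub.
by apply: subspaceB => //; exact: Hp_sub.
Qed.

Lemma Linf_tr m n (A : LinfT m n) : Linf (fun z => (A z)^T).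
Proof.
have [M _ AM] := LinfT_bound A; apply: (@Linf_entry _ _ _ M) => [i j|].
  rewrite -/(cmeas (fun z => (A z)^T i j)).
  by under eq_fun do rewrite mxE; exact: LinfT_meas.
apply: filterS AM => z AM i j; rewrite mxE.
exact: le_trans (normc_le_mxopnorm _ _ _) AM.
Qed.
Definition li_tr m n (A : LinfT m n) := MkLinfT (Linf_tr A).

Lemma Hinf_tr m n (A : LinfT m n) : Hinf A -> Hinf (li_tr A).
Proof.
case=> _ H; split; first exact: LinfT_P.
by move=> i j k k0; under [X in fourier X]eq_fun do rewrite mxE; exact: H.
Qed.

Lemma Hinf_cst m n (M : 'M[C]_(m, n)) : Hinf (li_cst M).
Proof.
apply/Hinf_cst2 => j; apply: (@Hp_ae _ (\sum_i M i j *: eb 0 i)).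
  apply: aeW => z; rewrite mulLE /= -colE.
  have -> : (\sum_i M i j *: eb 0 i) z = \sum_i M i j *: eb 0 i z.
    by elim/big_ind2: _ => // x1 x2 y1 y2 <- <-.
  apply/matrixP => i k; rewrite ord1 summxE (bigD1 i) //= big1 => [|l li].
    by rewrite mxE expr0z scale1r mul1mx !mxE !eqxx mulr1 addr0.
  by rewrite mxE expr0z scale1r mul1mx !mxE eq_sym (negbTE li) mulr0.
apply: subspace_sum; first exact: Hp_sub.
by case: (Hp_sub m) => _ _ HZ i _; apply: HZ; exact: Hp_eb.
Qed.

End Hardy.

(** * Co-inner completion of an analytic vector *)

Section Beurling.
Variable R : realType.
Local Notation C := R[i].
Local Notation T := (circle R).
Local Notation mu := (circle_measure R).

Lemma ae_exists (P : T -> Prop) : {ae mu, forall z, P z} -> exists z, P z.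
Proof.
move=> aeP; have mu0 : (0 < mu setT)%E by rewrite probability_setT lte01.
have := ae_properfilter_algebraOfSetsType mu0.
by move=> pf; exact: (@filter_ex _ _ pf P aeP).
Qed.

(* Wold: otherwise D would be invariant under division by z, and an analytic
   vector cannot be divided by z indefinitely. *)
Lemma wandering_vector n (S : set (L2T R n)) (D := orth (@ip R n) S) (c : L2T R n) :
  (forall x, D x -> D (zs 1 x)) -> D `<=` @Hp R n -> D c -> nm c != 0 ->
  exists y, [/\ D y, nm y != 0 & forall x, D x -> ip y (zs 1 x) = 0].
Proof.
move=> Dz DHp Dc c0; have h := @ip_herm R n; apply: contrapT => Hno.
have no y : D y -> (forall x, D x -> ip y (zs 1 x) = 0) -> nm y = 0.
  by move=> Dy Hy; apply: contrapT => /eqP y0; apply: Hno; exists y.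
have Dzi x : D x -> D (zs (-1) x).
  (* The complement of z S is z D, so p is the projection of x onto z D; the residual is a vector of
     D orthogonal to z D, hence null. *)
  move=> Dx; have [p Sp pP] := @projection_orth _ _ _ [set zs 1 s | s in S] (@ip_psd R n) (@ip_complete R n) x.
  have Dp' : D (zs (-1) p).
    by move=> s Ss; rewrite ip_zs; apply: Sp; exists s.
  have Dp : D p by rewrite -(zs0 p) -[0](subrr (1 : int)) -zs_zs; exact: Dz.
  have xp0 : nm (x - p) = 0.
    apply: no; first exact: (subspaceB (orth_subspace S h)).
    by move=> y Dy; apply: pP => _ [s Ss <-]; rewrite ip_zs_zs; exact: Dy.
  move=> s Ss; have -> : x = p + (x - p) by rewrite addrC subrK.
  by rewrite zsD (hermD h) Dp' // add0r ip0l // nm_zs.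
have Dk k : D (zs (- k%:Z) c).
  elim: k => [|k IH]; first by rewrite oppr0 zs0.
  by rewrite (_ : - k.+1%:Z = -1 + - k%:Z); [rewrite -zs_zs; exact: Dzi|lia].
move/eqP: c0; apply; apply: ip_eb_unique => l i.
(* Division by z^(|l| + 1) moves frequency l to a negative one, where elements of D have no
   coefficient. *)
have /HpP/(_ (l - (absz l).+1%:Z) i) := DHp _ (Dk (absz l).+1).
by rewrite ip_zs opprK zs_eb (_ : _ + (l - _) = l); [apply; lia|lia].
Qed.

Lemma cmeas_if (A : set T) : measurable A -> cmeas (fun z => (z \in A)%:R : C).
Proof.
move=> mA; have -> : (fun z => (z \in A)%:R : C) = (fun z => (\1_A z)%:C).
  by apply/funext => z; rewrite indicE; case: (z \in A).
by apply: cmeas_real; exact: measurable_indic.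
Qed.

Lemma Linf_if n (A : set T) : measurable A -> Linf (fun z : T => (z \in A)%:R *: 1%:M : 'M[C]_n).
Proof.
move=> mA; apply/Linf_boundP; split.
  apply/mx_measurableP => i j; under eq_fun do rewrite mxE.
  by apply: cmeasM; [exact: cmeas_if|exact: cmeas_cst].
exists 1 => //; apply: aeW => z; apply: mxopnorm_le => // x.
rewrite -scalemxAl mul1mx enormZ; case: (z \in A); first by rewrite normc1.
by rewrite normc0 mul0r mul1r enorm_ge0.
Qed.

(* The closed z-invariant space generated by f has a wandering vector y, of constant
   modulus because all its nonzero Fourier pairings vanish; y vanishes where f does. *)
Lemma Hp_ae_neq0 n (f : L2T R n) : Hp f -> nm f != 0 ->
  {ae mu, forall z, f z != 0}.
Proof.
move=> Hf f0; have h := @ip_herm R n.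
(* The double complement D is the closed space spanned by the z^k f with k >= 0. *)
pose S := orth (@ip R n) [set g | exists2 k : int, 0 <= k & g = zs k f].
pose D := orth (@ip R n) S.
have Dz x : D x -> D (zs 1 x).
  move=> Dx s Ss; rewrite ip_zs; apply: Dx => _ [k k0 ->].
  by rewrite ip_zs zs_zs; apply: Ss; exists (- -1 + k) => //; lia.
have DHp : D `<=` @Hp R n.
  move=> x Dx; apply/HpP => k i k0; apply: Dx => _ [j j0 ->].
  by rewrite (hermC h) ((HpP _).1 (Hp_zs j0 Hf)) ?rmorph0.
have Df : D f.
  move=> s Ss; rewrite (hermC h) -[X in ip s X]zs0 (Ss (zs 0 f)) ?rmorph0 //.
  by exists 0.
have [y [Dy y0 yz]] := wandering_vector Dz DHp Df f0.
have Dzk x (k : nat) : D x -> D (zs k%:Z x).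
  move=> Dx; elim: k => [|k IH]; first by rewrite zs0.
  by rewrite -[k.+1]/(1 + k)%N PoszD -zs_zs; exact: Dz.
have yk (k : nat) : ip y (zs k.+1%:Z y) = 0.
  by rewrite -[k.+1]/(1 + k)%N PoszD -zs_zs; apply: yz; exact: Dzk.
have yy : {ae mu, forall z, dotc (y z) (y z) = ip y y}.
  apply: ae_dotc_cst => -[[//|k]|k] _; first exact: yk.
  by rewrite NegzE (hermC h) ip_zs opprK yk rmorph0.
pose A := [set z | enorm (f z) = 0].
have mA : measurable A.
  by have := measurable_enorm (L2T_meas f) measurableT (measurable_set1 (0 : R)); rewrite setTI.
pose I := MkLinfT (@Linf_if n A mA).
have IE x z : mulL I x z = (z \in A)%:R *: x z by rewrite mulLE /= -scalemxAl mul1mx.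
have IS : S (mulL I y).
  move=> _ [k k0 ->]; apply: (ae_dotc0 _ _).2 => {k k0}.
  apply: aeW => z; rewrite IE (hermZ (dotc_herm R n)).
  case: (boolP (z \in A)) => [/set_mem/enorm_eq0 ->|_]; last by rewrite mul0r.
  by rewrite (herm0r (dotc_herm R n)) mulr0.
(* The restriction of y to the zero set of f lies in S, while y lies in D: its squared norm is the
   pairing of the two. *)
have Iy0 : nm (mulL I y) = 0.
  apply: (@qf_nrm0 _ _ _ _); rewrite /qf ip_mulL.
  have -> : mulL (li_adj I) (mulL I y) = mulL I y.
    apply: L2T_ext => z; rewrite [LHS]mulLE IE /= adjmxZ adjmx1 -scalemxAl mul1mx scalerA.
    by rewrite conjc_nat -natrM mulnb andbb.
  by rewrite Dy.
have /nm_eq0 Iy := Iy0.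
apply: filterS2 yy Iy => z yyz; rewrite IE; apply: contraPN => /eqP fz.
have -> : z \in A by rewrite inE /A /= fz enorm0.
rewrite scale1r => yz0.
move: yyz y0; rewrite yz0 (herm0l (dotc_herm R n)) /nm /nrm /qf => <-.
by rewrite /= sqrtr0 eqxx.
Qed.

(* The analytic vectors c with c^T f = 0 almost everywhere. *)
Definition annih n (f : L2T R n) : set (L2T R n) :=
  [set c | Hp c /\ {ae mu, forall z, dotc (c z) (cj f z) = 0}].

(* For d one less than the dimension of f, the last clause says that [annih f] is
   X H^2; such X are the co-inner completions of f. *)
Definition coinner n (f : L2T R n) d (X : LinfT R n d) : Prop :=
  [/\ Hinf X, {ae mu, forall z, adjmx (X z) *m X z = 1%:M},
      {ae mu, forall z, adjmx (X z) *m cj f z = 0} &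
      forall c, annih f c -> Hp (mulL (li_adj X) c)].

Lemma isometry_Linf m n (F : mfunT R m n) : mx_measurable F ->
  {ae mu, forall z, adjmx (F z) *m F z = 1%:M} -> Linf F.
Proof.
move=> mF iF; apply/Linf_boundP; split=> //; exists 1 => //.
by apply: filterS iF => z iF; apply: mxopnorm_le => // x; rewrite enorm_isometry // mul1r.
Qed.

Lemma annih_sub n (f c d : L2T R n) : annih f c -> annih f d -> annih f (c - d).
Proof.
move=> [Hc fc] [Hd fd]; split; first exact: (subspaceB (@Hp_sub R n) Hc Hd).
by apply: filterS2 fc fd => z fc fd; rewrite L2valB (hermBl (dotc_herm R n)) fc fd subrr.
Qed.

Lemma annih_proj n (f : L2T R n) d (X : LinfT R n d) c : coinner f X -> annih f c ->
  annih f (mulL X (mulL (li_adj X) c)).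
Proof.
move=> [HX _ fX HXc] fc; split; first by apply: Hp_mulL => //; exact: HXc.
apply: filterS fX => z fX; rewrite !mulLE dotc_adj [adjmx _ *m _]fX.
by rewrite (herm0r (dotc_herm R d)).
Qed.

Lemma delta_mul m n (x : 'cV[C]_n) (i : 'I_m) j :
  delta_mx i j *m x = x j ord0 *: delta_mx i ord0.
Proof.
apply/matrixP => k l; rewrite ord1 mxE (bigD1 j) //= big1 ?addr0 => [|a aj].
  by rewrite !mxE !eqxx !andbT mulrC.
by rewrite mxE (negbTE aj) andbF mul0r.
Qed.

(* The vectors f_j e_i - f_i e_j span, wherever f does not vanish, the n-dimensional
   space of x with x^T f = 0, which forces n columns by [cross_rank]. *)
Lemma annih_cross n (f : L2T R n) i j : Hp f ->
  annih f (mulL (li_cst (delta_mx i j - delta_mx j i)) f).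
Proof.
move=> Hf; split; first by apply: Hp_mulL => //; exact: Hinf_cst.
apply: aeW => z; rewrite mulLE /= mulmxBl (hermBl (dotc_herm R n)).
have e a b : dotc (delta_mx a b *m f z) (cj f z) = f z b ord0 * f z a ord0.
  rewrite delta_mul (hermZ (dotc_herm R n)) (hermC (dotc_herm R n)) dotc_delta.
  by rewrite cjE mxE conjcK.
by rewrite !e mulrC subrr.
Qed.

(** Up to sign the cross vectors are the columns of x_i I - e_i x^T. Fixed by X P, this matrix has
    rank at most d, and one more rank-one term restores x_i I, which is invertible. *)
Lemma cross_rank d n (x : 'cV[C]_n.+1) (X : 'M[C]_(n.+1, d)) (P : 'M[C]_(d, n.+1)) :
  x != 0 -> (forall i j, (delta_mx i j - delta_mx j i) *m x
                         = X *m P *m ((delta_mx i j - delta_mx j i) *m x)) -> (n <= d)%N.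
Proof.
move=> x0 XP; have [i xi] : exists i, x i ord0 != 0.
  apply/existsP; apply: contraNT x0; rewrite negb_exists => /forallP x0.
  by apply/eqP/matrixP => i j; rewrite ord1 mxE; apply/eqP; have := x0 i; rewrite negbK.
pose G := (x i ord0)%:M - delta_mx i ord0 *m x^T.
have GE j : col j G = - ((delta_mx i j - delta_mx j i) *m x).
  rewrite mulmxBl !delta_mul; apply/matrixP => k l; rewrite ord1 !mxE big_ord1 !mxE.
  by rewrite eqxx !andbT -mulr_natr; ring.
have GXP : G = X *m P *m G.
  apply/matrixP => k j; have : col j G = X *m P *m col j G by rewrite GE mulmxN -XP.
  clearbody G; rewrite [in RHS]colE mulmxA -colE => /matrixP/(_ k ord0).
  by rewrite [in LHS]mxE [in RHS]mxE.
have : (\rank ((x i ord0)%:M : 'M[C]_n.+1) <= d + 1)%N.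
  rewrite (_ : _%:M = G + delta_mx i ord0 *m x^T); last by rewrite subrK.
  apply: leq_trans (mxrank_add _ _) _; apply: leq_add.
    rewrite GXP -mulmxA; apply: leq_trans (mxrankM_maxl _ _) _; exact: rank_leq_col.
  by apply: leq_trans (mxrankM_maxl _ _) _; exact: rank_leq_col.
have -> : \rank ((x i ord0)%:M : 'M[C]_n.+1) = n.+1.
  by rewrite -scalemx1 mxrank_scale_nz // mxrank1.
by rewrite addn1.
Qed.

(* As long as X has fewer than n columns, the space of elements of [annih f]
   pointwise orthogonal to X is nonzero; a wandering vector of it is the next column. *)
Lemma coinner_extend n (f : L2T R n.+1) d (X : LinfT R n.+1 d) :
  Hp f -> nm f != 0 -> coinner f X -> (d < n)%N ->
  exists X' : LinfT R n.+1 d.+1, coinner f X'.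
Proof.
move=> Hf f0 cX dn; have [HX iX fX HXc] := cX; have h := @ip_herm R n.+1.
(* Analyticity, c^T f = 0 and X* c = 0 are all encoded as orthogonality relations in L^2, which
   makes D closed. *)
pose S := @negS R n.+1 `|` [set zs k (cj f) | k in setT]
   `|` [set zs ki.1 (mulL X (cst2 (delta_mx ki.2 ord0))) | ki in [set: int * 'I_d]].
pose D := orth (@ip R n.+1) S.
have DP c : D c <-> annih f c /\ {ae mu, forall z, adjmx (X z) *m c z = 0}.
  split=> [Dc|[[Hc fc] Xc]].
    split; first split.
    - by rewrite Hp_orth => s Ss; apply: Dc; left; left.
    - by apply/ae_dotc0 => k; apply: Dc; left; right; exists k.
    suff : {ae mu, forall z, forall i, dotc (adjmx (X z) *m c z) (delta_mx i ord0) = 0}.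
      by apply: filterS => z H; apply/matrixP => i j; rewrite ord1 -dotc_delta H mxE.
    apply: filter_forall => i.
    have : {ae mu, forall z, dotc (c z) (mulL X (cst2 (delta_mx i ord0)) z) = 0}.
      by apply/ae_dotc0 => k; apply: Dc; right; exists (k, i).
    by apply: filterS => z <-; rewrite dotc_adj adjmxK.
  move=> s [[|[k _ <-]]|[[k i] _ <-]].
  - by move=> Ss; move: Hc; rewrite Hp_orth; apply.
  - by move: k; apply/ae_dotc0.
  - rewrite /=; move: k; apply: (ae_dotc0 _ _).2.
    apply: filterS Xc => z Xc; rewrite mulLE.
    have := dotc_adj (adjmx (X z)) (c z) (cst2 (delta_mx i ord0) z).
    by rewrite adjmxK => <-; rewrite Xc (herm0l (dotc_herm R d)).
have Dproj c : annih f c -> D (c - mulL X (mulL (li_adj X) c)).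
  move=> fc; apply/DP; split; first by apply: annih_sub => //; exact: annih_proj.
  apply: filterS iX => z iX; rewrite L2valB !mulLE mulmxBr [X in _ - X]mulmxA iX mul1mx.
  by rewrite subrr.
have [c Dc c0] : exists2 c, D c & nm c != 0.
  apply: contrapT => Hno; have no c : D c -> nm c = 0.
    by move=> Dc; apply: contrapT => /eqP c0; apply: Hno; exists c.
  have : {ae mu, forall z, forall i j, (delta_mx i j - delta_mx j i) *m f z
      = X z *m adjmx (X z) *m ((delta_mx i j - delta_mx j i) *m f z)}.
    apply: filter_forall => i; apply: filter_forall => j.
    have /nm_eq0 := no _ (Dproj _ (annih_cross i j Hf)).
    by apply: filterS => z /eqP; rewrite L2valB subr_eq0 !mulLE /= mulmxA => /eqP.
  move=> XXc; have [z [fz0]] := ae_exists (filterI (Hp_ae_neq0 Hf f0) XXc).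
  by move=> /(cross_rank fz0); rewrite leqNgt dn.
have Dz x : D x -> D (zs 1 x).
  move=> /DP[[Hx fx] Xx]; apply/DP; split; first split.
  - exact: Hp_zs.
  - by apply: filterS fx => z fx; rewrite zsE (hermZ (dotc_herm R _)) fx mulr0.
  - by apply: filterS Xx => z Xx; rewrite zsE -scalemxAr Xx scaler0.
have DHp : D `<=` @Hp R n.+1 by move=> x /DP[[]].
have [y0 [Dy0 ny0 y0z]] := wandering_vector Dz DHp Dc c0.
have npos : 0 < nm y0 by rewrite lt_def ny0 nrm_ge0.
pose y := ((nm y0)^-1)%:C *: y0.
have Dy : D y by case: (orth_subspace S h) => _ _; apply.
have yz x : D x -> ip y (zs 1 x) = 0 by move=> Dx; rewrite (hermZ h) y0z // mulr0.
have ny : ip y y = 1.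
  have nmy : nm y = 1.
    rewrite /nm (nrmZ (@ip_psd R n.+1)) normc_real ger0_norm ?invr_ge0 ?nrm_ge0 //.
    by rewrite mulVf.
  by rewrite (hermE h) -(nrm_sq (@ip_psd R n.+1)) -/(nm y) nmy expr1n.
clearbody y; have [[Hy fy] Xy] := (DP y).1 Dy.
(* The orthogonality of y extends from z D to z times all of [annih f]: the component of x in the
   range of X is pointwise orthogonal to y. *)
have yC x : annih f x -> ip y (zs 1 x) = 0.
  move=> fx; rewrite -[x](subrK (mulL X (mulL (li_adj X) x))) zsD (hermDr h) yz ?add0r; last exact: Dproj.
  rewrite -mulL_zs (hermC h) ip_mulL ip0r ?rmorph0 //; exact/nm_eq0.
have yCk (k : nat) x : annih f x -> ip y (zs k.+1%:Z x) = 0.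
  move=> [Hx fx]; rewrite -[k.+1]/(1 + k)%N PoszD -zs_zs; apply: yC; split; first exact: Hp_zs.
  by apply: filterS fx => z fx; rewrite zsE (hermZ (dotc_herm R _)) fx mulr0.
have yy : {ae mu, forall z, dotc (y z) (y z) = 1}.
  rewrite -ny; apply: ae_dotc_cst => -[[//|k]|k] _; first exact: yCk.
  by rewrite NegzE (hermC h) ip_zs opprK yCk ?rmorph0.
pose F z : 'M[C]_(n.+1, 1 + d) := row_mx (y z) (X z).
have iF : {ae mu, forall z, adjmx (F z) *m F z = 1%:M}.
  apply: filterS3 yy iX Xy => z yy iX Xy.
  have -> : adjmx (F z) = col_mx (adjmx (y z)) (adjmx (X z)).
    by rewrite /adjmx tr_row_mx map_col_mx.
  rewrite mul_col_row dotc_mx yy iX Xy (adj_mul0 Xy).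
  exact: esym (@scalar_mx_block _ 1 d 1).
have mF : mx_measurable F.
  apply/mx_measurableP => i j; rewrite /F.
  case: (splitP j) => [k jk|k jk].
    have -> : j = lshift d k by exact: val_inj.
    have -> : (fun z => row_mx (y z) (X z) i (lshift d k)) = (fun z => y z i ord0).
      by apply/funext => z; rewrite row_mxEl ord1.
    exact: L2T_cmeas.
  have -> : j = rshift 1 k by exact: val_inj.
  have -> : (fun z => row_mx (y z) (X z) i (rshift 1 k)) = (fun z => X z i k).
    by apply/funext => z; rewrite row_mxEr.
  exact: LinfT_meas.
pose X' : LinfT R n.+1 d.+1 := MkLinfT (isometry_Linf mF iF).
exists X'; split=> //.
- apply/Hinf_cst2 => j; case: (@splitP 1 d j) => [k jk|k jk].
    have -> : j = lshift d k :> 'I_(1 + d) by exact: val_inj.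
    apply: Hp_ae Hy; apply: aeW => z; rewrite mulLE /= -colE /F.
    rewrite -[RHS]/(@col C n.+1 (1 + d) (lshift d k) (row_mx (y z) (X z))) colKl.
    by apply/matrixP => a b; rewrite !ord1 [in RHS]mxE.
  have -> : j = rshift 1 k :> 'I_(1 + d) by exact: val_inj.
  apply: Hp_ae ((Hinf_cst2 X).1 HX k); apply: aeW => z; rewrite !mulLE /= -!colE /F.
  by rewrite -[RHS]/(@col C n.+1 (1 + d) (rshift 1 k) (row_mx (y z) (X z))) colKr.
- apply: filterS2 fX fy => z fX fy /=.
  have -> : adjmx (F z) = col_mx (adjmx (y z)) (adjmx (X z)).
    by rewrite /adjmx tr_row_mx map_col_mx.
  apply: etrans (mul_col_mx (adjmx (y z)) (adjmx (X z)) (cj f z)) _.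
  by rewrite fX dotc_mx (hermC (dotc_herm R _)) fy rmorph0 raddf0; exact: col_mx0.
- move=> c' fc'; apply/HpP => k j k0; rewrite ip_mulL.
  case: (@splitP 1 d j) => [l jl|l jl].
    have -> : mulL (li_adj (li_adj X')) (eb R k j) = zs k y.
      apply: L2T_ext => z; rewrite mulLE !zsE /= -scalemxAr adjmxK -colE.
      have -> : j = lshift d l :> 'I_(1 + d) by exact: val_inj.
      congr (_ *: _).
      rewrite -[LHS]/(@col C n.+1 (1 + d) (lshift d l) (row_mx (y z) (X z))) colKl.
      apply/matrixP => a b.
     by rewrite !ord1 [in LHS]mxE.
    (* For k < 0 the pairing of c' with z^k y is conjugate to that of y with z^-k c', and -k >=
       1. *)
    rewrite (hermC h) ip_zs; have -> : - k = (absz (k + 1)).+1%:Z by lia.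
    by rewrite yCk ?rmorph0.
  have -> : mulL (li_adj (li_adj X')) (eb R k j) = mulL (li_adj (li_adj X)) (eb R k l).
    apply: L2T_ext => z; rewrite [LHS]mulLE [RHS]mulLE !zsE /= -!scalemxAr !adjmxK -!colE.
    have -> : j = rshift 1 l :> 'I_(1 + d) by exact: val_inj.
    congr (_ *: _).
    by rewrite -[LHS]/(@col C n.+1 (1 + d) (rshift 1 l) (row_mx (y z) (X z))) colKr.
  by rewrite -ip_mulL; apply: (HpP _).1 => //; exact: HXc.
Qed.

Lemma coinner_exists n (f : L2T R n.+1) : Hp f -> nm f != 0 ->
  exists X : LinfT R n.+1 n, coinner f X.
Proof.
move=> Hf f0; suff H d : (d <= n)%N -> exists X : LinfT R n.+1 d, coinner f X.
  exact: (H n).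
elim: d => [_|d IH dn]; last first.
  by have [X cX] := IH (ltnW dn); exact: coinner_extend cX dn.
exists (li_cst 0); split; first exact: Hinf_cst.
- by apply: aeW => z; apply/matrixP => -[].
- by apply: aeW => z; apply/matrixP => -[].
- by move=> c _; apply/HpP => k [].
Qed.

Lemma coinner_split n (f : L2T R n.+1) (X : LinfT R n.+1 n) : nm f != 0 -> Hp f ->
  coinner f X -> {ae mu, forall z, unitary_split ((enorm (f z))^-1%:C *: cj f z) (X z)}.
Proof.
move=> f0 Hf [_ iX fX _]; apply: filterS3 (Hp_ae_neq0 Hf f0) iX fX => z fz iX fX.
apply: normalize_split => //; first by rewrite gt_eqF // enorm_gt0.
rewrite /enorm cjE; congr Num.sqrt; apply: eq_bigr => i _.
by rewrite mxE normc_conjc.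
Qed.

(** Pointwise, X X* is the projection onto the complement of the conjugate of f, where c takes its
    values. *)
Lemma annihE n (f : L2T R n.+1) (X : LinfT R n.+1 n) c : nm f != 0 -> Hp f ->
  coinner f X -> annih f c -> {ae mu, forall z, c z = mulL X (mulL (li_adj X) c) z}.
Proof.
move=> f0 Hf cX [_ fc]; apply: filterS2 (coinner_split f0 Hf cX) fc => z sX fc.
rewrite !mulLE /= -[LHS]mul1mx -(unitary_splitP sX) mulmxDl.
rewrite -mulmxA dotc_mx (hermZr (dotc_herm R _)) fc mulr0 raddf0 mulmx0 add0r.
by rewrite mulmxA.
Qed.

(** The hypothesis says that conj(X) u is in H^2_-, hence by [Hm_cj] that w, which is X applied to
    z^-1 conj(u), is analytic. It is annihilated by f, so the last clause of [coinner] makes X* w,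
    that is z^-1 conj(u), analytic too. *)
Lemma coinner_tr_orth n (f : L2T R n.+1) (X : LinfT R n.+1 n) u : nm f != 0 -> Hp f ->
  coinner f X -> (forall F, Hp F -> ip u (mulL (li_tr X) F) = 0) -> Hm u.
Proof.
move=> f0 Hf cX uX; have [HX iX fX HXc] := cX.
pose w := mulL X (zs (-1) (cj u)).
have ew : w = zs (-1) (cj (mulL (li_conj X) u)).
  rewrite /w mulL_zs; congr zs; apply: L2T_ext => z; rewrite !mulLE !cjE !mulLE /=.
  by rewrite map_mxM /=; congr (_ *m _); apply/matrixP => i j; rewrite !mxE conjcK.
have Hw : Hp w.
  rewrite ew; apply/Hm_cj/HmP => F HF; rewrite ip_mulL.
  apply: etrans (uX F HF); congr ip; apply: L2T_ext => z; rewrite !mulLE /=; congr (_ *m _).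
  by apply/matrixP => i j; rewrite !mxE conjcK.
have fw : annih f w.
  split=> //; apply: filterS fX => z fX; rewrite mulLE dotc_adj fX.
  by rewrite (herm0r (dotc_herm R _)).
apply/Hm_cj; apply: Hp_ae (HXc _ fw); apply: filterS iX => z iX.
by rewrite !mulLE /= mulmxA iX mul1mx.
Qed.

(** So X^T is outer: everything orthogonal to X^T H^2 is in H^2_-, hence orthogonal to u. *)
Lemma coinner_tr_dense n (f : L2T R n.+1) (X : LinfT R n.+1 n) u (e : R) :
  nm f != 0 -> Hp f -> coinner f X -> Hp u -> 0 < e ->
  exists2 F, Hp F & nm (u - mulL (li_tr X) F) <= e.
Proof.
move=> f0 Hf cX Hu e0.
pose K := [set mulL (li_tr X) F | F in @Hp R n.+1].
have sK : subspace K.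
  have [H0 HD HZ] := @Hp_sub R n.+1; split.
  - by exists 0 => //; apply: L2T_ext => z; rewrite mulLE !L2val0 mulmx0.
  - by move=> _ _ [F HF <-] [G HG <-]; exists (F + G); [exact: HD|rewrite mulLD].
  - by move=> a _ [F HF <-]; exists (a *: F); [exact: HZ|rewrite mulLZ].
have [|_ [F HF <-] ?] := orth_dense (@ip_psd R n) (@ip_complete R n) (u := u) sK _ e0; last by exists F.
move=> w wK; apply: ip_HpHm => //; apply: coinner_tr_orth f0 Hf cX _ => F HF.
by apply: wK; exists F.
Qed.

End Beurling.

(** * Pointwise bounds from integral pairings *)

Section BoundedMultipliers.
Variable R : realType.
Local Notation C := R[i].
Local Notation T := (circle R).
Local Notation mu := (circle_measure R).

(* Bounded trigonometric polynomials, described through shifts. *)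
Definition trig n (G : L2T R n) : Prop :=
  [/\ exists M, forall z, enorm (G z) <= M,
      exists N : nat, Hp (zs N%:Z G) & exists N : nat, Hm (zs (- N%:Z) G)].

Lemma Hp_zsW n (f : L2T R n) j k : j <= k -> Hp (zs j f) -> Hp (zs k f).
Proof.
move=> jk Hj; rewrite -[k](subrK j) -zs_zs; apply: Hp_zs => //.
by rewrite subr_ge0.
Qed.

Lemma Hm_zsW n (f : L2T R n) j k : k <= j -> Hm (zs j f) -> Hm (zs k f).
Proof.
move=> jk Hj; rewrite -[k](subrK j) -zs_zs; apply: Hm_zs => //.
by rewrite subr_le0.
Qed.

Lemma trig_sub n : subspace (@trig n).
Proof.
have [p0 pD pZ] := @Hp_sub R n; have [m0 mD mZ] := @Hm_sub R n; split.
- split; [exists 0 => z|exists 0%N|exists 0%N]; rewrite ?zs0 ?oppr0 ?zs0 //.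
  by rewrite enorm0.
- move=> x y [[M xM] [N xN] [N' xN']] [[P yP] [L yL] [L' yL']]; split.
  + exists (M + P) => z; apply: le_trans (enormD _ _) _; exact: (lerD (xM z) (yP z)).
  + exists (N + L)%N; rewrite zsD; apply: pD; [apply: Hp_zsW xN|apply: Hp_zsW yL]; lia.
  + exists (N' + L')%N; rewrite zsD; apply: mD; [apply: Hm_zsW xN'|apply: Hm_zsW yL']; lia.
- move=> a x [[M xM] [N xN] [N' xN']]; split.
  + exists (normc a * M) => z; rewrite enormZ; exact: (ler_wpM2l (normc_ge0 _) (xM z)).
  + by exists N; rewrite zsZ; exact: pZ.
  + by exists N'; rewrite zsZ; exact: mZ.
Qed.

Lemma Hm_eb_neg n (k : int) (i : 'I_n) : k < 0 -> Hm (eb R k i).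
Proof. by move=> k0; apply/Hm_cj; rewrite cj_eb zs_eb; apply: Hp_eb; lia. Qed.

Lemma trig_eb n (k : int) (i : 'I_n) : trig (eb R k i).
Proof.
split.
- exists 1 => z; rewrite zsE enormZ normc_zpow mul1r /=.
  rewrite /enorm (bigD1 i) //= mxE !eqxx normc1 big1 ?addr0 ?expr1n ?sqrtr1 // => j ji.
  by rewrite mxE (negbTE ji) normc0 expr0n.
- by exists (absz k); rewrite zs_eb; apply: Hp_eb; lia.
- by exists (absz k).+1; rewrite zs_eb; apply: Hm_eb_neg; lia.
Qed.

Lemma nm_le_trig n (a : L2T R n) (K : R) : 0 <= K ->
  (forall G, trig G -> normc (ip a G) <= K * nm G) -> nm a <= K.
Proof.
move=> K0 H; have hp := @ip_psd R n; have h := hp.1.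
have [->//|a0] := eqVneq (nm a) 0.
have ap : 0 < nm a by rewrite lt_def a0 nrm_ge0.
rewrite -(ler_pM2r ap) -expr2; apply/ler_addgt0Pr => e e0.
have e1 : 0 < e / (K + nm a) by rewrite divr_gt0 // ltr_wpDl.
have [|G tG aG] := orth_dense hp (@ip_complete R n) (u := a) (@trig_sub n) _ e1.
  move=> w wt; rewrite ip0r //; apply: ip_eb_unique => k i; apply: wt; exact: trig_eb.
have -> : nm a ^+ 2 = Re (ip a G) + Re (ip a (a - G)).
  by rewrite nrm_sq // /qf -ReD -(hermDr h) addrC subrK.
have l1 : Re (ip a G) <= K * nm G.
  by apply: le_trans (ler_norm _) (le_trans (normc_Re _) (H _ tG)).
have l2 : Re (ip a (a - G)) <= nm a * (e / (K + nm a)).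
  apply: le_trans (ler_norm _) (le_trans (Re_form_le hp _ _) _).
  by rewrite ler_wpM2l ?nrm_ge0.
have l3 : nm G <= nm a + e / (K + nm a).
  have -> : G = a - (a - G) by rewrite subKr.
  by apply: le_trans (nrmB hp _ _) _; rewrite lerD2l.
have -> : e = K * (e / (K + nm a)) + nm a * (e / (K + nm a)).
  by rewrite -mulrDl mulrC divfK // gt_eqF // ltr_wpDl.
rewrite addrA -mulrDr; apply: lerD => //; apply: le_trans l1 _.
by rewrite ler_wpM2l.
Qed.

Lemma Linf_of_L2 n (G : L2T R n) (M : R) : (forall z, enorm (G z) <= M) -> Linf G.
Proof.
move=> GM; apply/Linf_boundP; split; first exact: L2T_meas.
have M0 : 0 <= M by apply: le_trans (GM point); exact: enorm_ge0.
exists M => //; apply: aeW => z; apply: le_trans (mxopnorm_le_mxabs _) _.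
by rewrite /mxabs big_ord1 (_ : col _ _ = G z) //; apply/matrixP => i j; rewrite mxE !ord1.
Qed.

(* For bounded G, pairing u with [cdot G w] is integrating the scalar u
   against <w, G>. *)
Definition cdot n (G : LinfT R n 1) (w : L2T R n) : L2T R 1 := cj (mulL (li_adj G) w).

Lemma cdotE n (G : LinfT R n 1) (w : L2T R n) z : cdot G w z = ((dotc (w z) (G z))^*)%:M.
Proof.
rewrite cjE mulLE /= dotc_mx; apply/matrixP => i j; rewrite !ord1 !mxE.
by rewrite eqxx !mulr1n.
Qed.

Lemma ip_cdot n (G : LinfT R n 1) (w : L2T R n) (u : L2T R 1) :
  ip u (cdot G w) = cintegral (fun z => u z ord0 ord0 * dotc (w z) (G z)).
Proof.
rewrite ipE; congr cintegral; apply/funext => z.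
by rewrite /dotc big_ord1 cdotE mxE eqxx mulr1n conjcK.
Qed.

(** Density of trigonometric polynomials first removes u and gives |<w, G>| <= K |G| in L^2 norm.
    Only then can u be the indicator of the set where |w| > K; removing G in turn bounds the norm of
    w over this set by K times that of its indicator, so the set is null. *)
Lemma ae_enorm_le n (w : L2T R n) (K : R) : 0 <= K ->
  (forall u G (tG : trig G) (bG : Linf G), trig u ->
     normc (ip u (cdot (MkLinfT bG) w)) <= K * nm u * nm G) ->
  {ae mu, forall z, enorm (w z) <= K}.
Proof.
move=> K0 H.
have H1 G (tG : trig G) (bG : Linf G) : nm (cdot (MkLinfT bG) w) <= K * nm G.
  apply: nm_le_trig; first by rewrite mulr_ge0 ?nrm_ge0.
  move=> u tu; rewrite (hermC (@ip_herm R 1)) normc_conjc mulrAC; exact: H.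
pose A := [set z | K < enorm (w z)].
have mA : measurable A.
  have := measurable_enorm (L2T_meas w) measurableT (measurable_itv `]K, +oo[).
  by rewrite setTI; congr measurable; apply/seteqP; split=> z; rewrite /= in_itv /= andbT.
pose IA k := MkLinfT (@Linf_if R k _ mA); pose u := mulL (IA 1%N) (cst2 1%:M).
have uE z : u z = (z \in A)%:R%:M.
  by rewrite mulLE /= mulmx1 scalemx1.
have nmu : nm (mulL (IA n) w) <= K * nm u.
  apply: nm_le_trig; first by rewrite mulr_ge0 ?nrm_ge0.
  move=> G tG; have [[M GM] _ _] := tG; have bG := Linf_of_L2 GM.
  have -> : ip (mulL (IA n) w) G = ip u (cdot (MkLinfT bG) w).
    rewrite ip_cdot ipE; congr cintegral; apply/funext => z; rewrite uE mxE eqxx mulr1n.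
    by rewrite mulLE /= -scalemxAl mul1mx (hermZ (dotc_herm R n)).
  apply: le_trans (normc_form_le (@ip_psd R 1) _ _) _.
  apply: le_trans (ler_wpM2l (nrm_ge0 _ _) (H1 _ tG bG)) _.
  by rewrite -/(nm u) mulrCA mulrA.
pose f z : R := (z \in A)%:R * (enorm (w z) ^+ 2 - K ^+ 2).
have f0 z : 0 <= f z.
  rewrite /f; case: (boolP (z \in A)) => zA; last by rewrite mul0r.
  rewrite mul1r subr_ge0 lerXn2r ?nnegrE ?enorm_ge0 //.
  by move: zA; rewrite inE => /ltW.
have fE : f = (fun z => enorm (mulL (IA n) w z) ^+ 2 - K ^+ 2 * enorm (u z) ^+ 2).
  apply/funext => z; rewrite uE mulLE /= -scalemxAl mul1mx enormZ enorm11 mxE eqxx mulr1n /f.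
  by case: (z \in A); rewrite ?normc1 ?normc0 ?mul1r ?mul0r ?expr1n ?expr0n ?mulr1 ?mulr0 ?subrr.
have mf : measurable_fun setT (fun z => (f z)%:E).
  apply/measurable_EFinP; rewrite fE; apply: measurable_funB.
    exact: measurable_enorm_sq (L2T_meas _).
  by apply: measurable_funM => //; exact: measurable_enorm_sq (L2T_meas _).
have : (\int[mu]_z `|(f z)%:E| = 0)%E.
  apply/eqP; rewrite eq_le integral_ge0 ?andbT => [|//].
  under eq_integral => z _ do rewrite abse_EFin ger0_norm ?f0 // fE EFinB EFinM.
  have iu := integrableZl measurableT (K ^+ 2) (L2T_integrable u).
  rewrite (integralB_EFin measurableT (L2T_integrable (mulL (IA n) w)) iu).
  rewrite [X in (_ - X)%E](integralZl measurableT (L2T_integrable u)).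
  rewrite -!qf_ip_EFin -EFinM -EFinB lee_fin subr_le0.
  rewrite -!(nrm_sq (@ip_psd R _)) -exprMn lerXn2r // nnegrE ?mulr_ge0 ?nrm_ge0 //.
move/(ae_eq_integral_abs mu measurableT mf); apply: filterS => z /(_ I) /= [fz].
rewrite leNgt; apply/negP => zA; move: fz; rewrite /f mem_set // mul1r => /eqP.
by rewrite subr_eq0 eqrXn2 ?enorm_ge0 // => /eqP e; move: zA; rewrite e ltxx.
Qed.

Lemma normc_le_ReIm (x : C) : normc x <= `|Re x| + `|Im x|.
Proof.
rewrite -(@ler_pXn2r _ 2) ?nnegrE ?normc_ge0 ?addr_ge0 // normc_sq sqrrD.
by rewrite !real_normK ?num_real // addrAC lerDl mulrn_wge0 // mulr_ge0.
Qed.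

Lemma ratc_approx n (x : 'cV[C]_n) (e : R) : 0 < e ->
  exists q : {ffun 'I_n -> rat * rat},
    enorm (x - \col_i (ratr (q i).1 +i* ratr (q i).2)) <= e.
Proof.
move=> e0; have e1 : 0 < e / (n.+1%:R *+ 2) by rewrite divr_gt0 // mulrn_wgt0 // ltr0n.
have appr (a : R) : exists q : rat, `|a - ratr q| <= e / (n.+1%:R *+ 2).
  have [|q] := @rat_in_itvoo R (a - e / (n.+1%:R *+ 2)) (a + e / (n.+1%:R *+ 2)).
    by rewrite ltrD2l gtrN.
  rewrite in_itv /= => /andP[q1 q2]; exists q.
  by rewrite ler_distlC !ltW.
have /choice[q qP] : forall i, exists q : rat * rat,
    normc (x i ord0 - (ratr q.1 +i* ratr q.2)) <= e / n.+1%:R.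
  move=> i; have [a aP] := appr (Re (x i ord0)); have [b bP] := appr (Im (x i ord0)).
  exists (a, b); apply: le_trans (normc_le_ReIm _) _; rewrite !ReImE /=.
  apply: le_trans (lerD aP bP) _.
  by rewrite -mulr2n -[n.+1%:R *+ 2]mulr_natr invfM mulrA -[X in X <= _]mulr_natr divfK ?pnatr_eq0.
exists [ffun i => q i].
have E : x - \col_i (ratr ([ffun i => q i] i).1 +i* ratr ([ffun i => q i] i).2)
   = \sum_i (x i ord0 - (ratr (q i).1 +i* ratr (q i).2)) *: delta_mx i ord0.
  apply/matrixP => i j; rewrite ord1 summxE (bigD1 i) //= big1 => [|k ki].
    by rewrite !mxE !ffunE !eqxx mulr1 addr0.
  by rewrite !mxE eq_sym (negbTE ki) mulr0.
rewrite E; apply: le_trans (enorm_sum _ _ _) _.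
apply: le_trans (_ : \sum_(i < n) e / n.+1%:R <= _).
  apply: ler_sum => i _; rewrite enormZ.
  have -> : enorm (delta_mx i ord0 : 'cV[C]_n) = 1.
    rewrite /enorm (bigD1 i) //= mxE !eqxx normc1 big1 ?addr0 ?expr1n ?sqrtr1 // => j ji.
    by rewrite mxE (negbTE ji) normc0 expr0n.
  by rewrite mulr1.
rewrite sumr_const card_ord -[X in X <= _]mulr_natr mulrAC ler_pdivrMr ?ltr0n //.
by rewrite ler_wpM2l ?ler_nat // ltW.
Qed.

(** The exceptional set depends on c, so the bounds are collected over the countably many rational
    vectors and extended by density. *)
Lemma ae_mxopnorm_le m n (E : mfunT R m n) (K : R) : 0 <= K ->
  (forall c, {ae mu, forall z, enorm (E z *m c) <= K * enorm c}) ->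
  {ae mu, forall z, mxopnorm (E z) <= K}.
Proof.
move=> K0 H.
have : {ae mu, forall z, forall k : nat, forall q : {ffun 'I_n -> rat * rat},
   unpickle k = Some q ->
   enorm (E z *m (\col_i (ratr (q i).1 +i* ratr (q i).2)))
     <= K * enorm (\col_i ((ratr (q i).1 : R) +i* ratr (q i).2))}.
  apply: ae_foralln => k; case: (unpickle k) => [q|]; last exact: aeW.
  by apply: filterS (H (\col_i ((ratr (q i).1 : R) +i* ratr (q i).2))) => z Hz _ [<-].
apply: filterS => z Hz; apply: mxopnorm_le => // x; apply/ler_addgt0Pr => e e0.
have d0 : 0 < K + mxopnorm (E z) + 1 by rewrite ltr_wpDl // addr_ge0 // mxopnorm_ge0.
have [q qP] := ratc_approx x (divr_gt0 e0 d0).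
have := Hz (pickle q) q (pickleK q); set c := \col_i _ in qP *; move=> Hc.
have -> : E z *m x = E z *m c + E z *m (x - c) by rewrite -mulmxDr addrC subrK.
apply: le_trans (enormD _ _) _.
have l1 : enorm c <= enorm x + e / (K + mxopnorm (E z) + 1).
  have -> : c = x + - (x - c) by rewrite opprB addrC subrK.
  by apply: le_trans (enormD _ _) _; rewrite enormN lerD2l.
have l2 : enorm (E z *m (x - c)) <= mxopnorm (E z) * (e / (K + mxopnorm (E z) + 1)).
  by apply: le_trans (enorm_mulmx _ _) _; rewrite ler_wpM2l ?mxopnorm_ge0.
apply: le_trans (lerD (le_trans Hc (ler_wpM2l K0 l1)) l2) _.
rewrite mulrDr -addrA lerD2l -mulrDl mulrCA ger_pMr // ler_pdivrMr // mul1r.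
by rewrite lerDl.
Qed.

End BoundedMultipliers.

(** * Nehari's theorem *)

Section Nehari.
Variable R : realType.
Local Notation C := R[i].
Local Notation T := (circle R).
Local Notation mu := (circle_measure R).

Lemma L2val_sum n (I : Type) (r : seq I) (F : I -> L2T R n) z :
  (\sum_(i <- r) F i) z = \sum_(i <- r) F i z.
Proof. by elim/big_ind2: _ => // x1 x2 y1 y2 <- <-. Qed.

Lemma cst2E n (c : 'cV[C]_n) : cst2 c = \sum_i c i ord0 *: eb R 0 i.
Proof.
apply: L2T_ext => z; rewrite L2val_sum.
under eq_bigr do rewrite L2valZ zsE expr0z scale1r.
apply/matrixP => i j; rewrite ord1 summxE (bigD1 i) //= big1 ?addr0 => [|k ki].
  by rewrite !mxE !eqxx mulr1.
by rewrite !mxE eq_sym (negbTE ki) mulr0.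
Qed.

Lemma Hp_cst2 n (c : 'cV[C]_n) : Hp (cst2 c).
Proof.
rewrite cst2E; apply: subspace_sum; first exact: Hp_sub.
by move=> i _; case: (@Hp_sub R n) => _ _; apply; exact: Hp_eb.
Qed.

Lemma Hm_cst2 n (c : 'cV[C]_n) : Hm (zs (-1) (cst2 c)).
Proof. by apply/Hm_cj; rewrite cj_zs cj_cst2 zs_zs zs0; exact: Hp_cst2. Qed.

Lemma cint_cst (c : C) : cintegral (fun _ : T => c) = c.
Proof.
have -> : (fun _ : T => c) = (fun z => c * (z : C) ^ (0 : int)).
  by apply/funext => z; rewrite expr0z mulr1.
rewrite cintZ ?cint_zpow ?mulr1 //.
by apply: (@cintble_bounded _ _ 1) => [|z]; [exact: cmeas_zpow|rewrite normc_zpow].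
Qed.

Lemma ip_cst2 n (a b : 'cV[C]_n) : ip (cst2 a) (cst2 b) = dotc a b.
Proof. by apply: etrans (ipE _ _) _; exact: (cint_cst (dotc a b)). Qed.

Lemma ip_zHp_cst2 n (f : L2T R n) c : Hp (zs (-1) f) -> ip f (cst2 c) = 0.
Proof. by move=> Hf; rewrite -(ip_zs_zs (-1)) ip_HpHm //; exact: Hm_cst2. Qed.

Lemma ip_cst2_eb0 n (c : 'cV[C]_n) i : ip (cst2 c) (eb R 0 i) = c i ord0.
Proof. by rewrite /eb zs0 ip_cst2 dotc_delta. Qed.

Lemma Hp_decomp n (f : L2T R n) : Hp f -> exists x, Hp (zs (-1) (f - cst2 x)).
Proof.
have h := @ip_herm R n; move=> Hf; exists (\col_i ip f (eb R 0 i)).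
apply/HpP => k i k0; rewrite ip_zs zs_eb opprK (hermBl h).
have [k1|k1] := eqVneq (1 + k) 0; first by rewrite k1 ip_cst2_eb0 mxE subrr.
have k2 : 1 + k < 0 by lia.
by rewrite ((HpP _).1 Hf) // ((HpP _).1 (Hp_cst2 _)) ?subrr.
Qed.

Lemma zHm_decomp n (g : L2T R n) : Hm g -> exists y, Hm (zs 1 g - cst2 y).
Proof.
have h := @ip_herm R n; move=> Hg; exists (\col_i ip (zs 1 g) (eb R 0 i)).
apply/Hm_eb => k i k0; rewrite (hermBl h).
have [->|k1] := eqVneq k 0; first by rewrite ip_cst2_eb0 mxE subrr.
rewrite ip_zs zs_eb ((Hm_eb _).2 Hg) ?sub0r; last by lia.
by rewrite (hermC h) ip_zHp_cst2 ?rmorph0 ?oppr0 // zs_eb; apply: Hp_eb; lia.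
Qed.

(* For f in H^2 and g in H^2_-, half of the form is
   rho (|f|^2 + |g|^2) / 2 + Re <H_Phi f, g>, so that positivity means that
   the norm of the Hankel operator is at most rho. *)
Definition hpos m n (Phi : LinfT R m n) (rho : R) : Prop :=
  forall f g, Hp f -> Hm g ->
    0 <= rho * qf (@ip R n) f + rho * qf (@ip R m) g + Re (ip (mulL Phi f) g) *+ 2.

(* If M is the next coefficient of the approximant, the problem for the remaining
   coefficients is that for z^-1 (Phi - M). *)
Definition zshift m n (Phi : LinfT R m n) (M : 'M[C]_(m, n)) : LinfT R m n :=
  li_mul (li_z R m (-1)) (li_sub Phi (li_cst M)).

Lemma mulL_zshift m n (Phi : LinfT R m n) M f :
  mulL (zshift Phi M) f = zs (-1) (mulL Phi f - mulL (li_cst M) f).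
Proof. by rewrite -mulL_sub /zs mulLA. Qed.

Lemma mulL_cst m n (M : 'M[C]_(m, n)) c : mulL (li_cst M) (cst2 c) = cst2 (M *m c).
Proof. exact: L2T_ext. Qed.

(** * Choice of one coefficient of the approximant *)

Section Step.
Variables (m n : nat) (Phi : LinfT R m n) (rho : R).
Hypothesis Phi_pos : hpos Phi rho.
Local Notation V := (L2T R n * L2T R m)%type.

Let B (u v : V) : C := rho%:C * ip u.1 v.1 + rho%:C * ip u.2 v.2
  + ip (mulL Phi u.1) v.2 + (ip (mulL Phi v.1) u.2)^*.

Let hB : hermitian B.
Proof.
have hn := @ip_herm R n; have hm := @ip_herm R m; split.
- move=> x y z; rewrite /B mulLD !(hermD hn) !(hermD hm) (hermDr hm) conjcD; ring.
- move=> a x z; rewrite /B mulLZ !(hermZ hn) !(hermZ hm) (hermZr hm) conjcM conjcK; ring.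
- move=> x y; rewrite /B (hermC hn x.1) (hermC hm x.2) !conjcD !conjcM !conjcK conjc_real.
  ring.
Qed.

Let qfBE u1 u2 : qf B (u1, u2)
  = rho * qf (@ip R n) u1 + rho * qf (@ip R m) u2 + Re (ip (mulL Phi u1) u2) *+ 2.
Proof. by rewrite /qf /B !ReImE /=; ring. Qed.

(** K is z H^2 times H^2_-. Adding constants to the first component gives H^2 times H^2_-, where the
    hypothesis applies; adding them to the second gives z times such a pair. Parrott's theorem
    supplies the pairing of the two kinds of constants, that is the coefficient of order 0. *)
Let K (u : V) := Hp (zs (-1) u.1) /\ Hm u.2.

Let sK : subspace K.
Proof.
have [p0 pD pZ] := @Hp_sub R n; have [m0 mD mZ] := @Hm_sub R m; split.
- split=> //=; suff -> : zs (-1) 0 = 0 :> L2T R n by [].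
  by rewrite -(scale0r 0) zsZ !scale0r.
- by move=> x y [x1 x2] [y1 y2]; split; [rewrite /= zsD; exact: pD|exact: mD].
- by move=> a x [x1 x2]; split; [rewrite /= zsZ; exact: pZ|exact: mZ].
Qed.

Let e (i : 'I_n) : V := (eb R 0 i, 0).
Let f (j : 'I_m) : V := (0, eb R 0 j).

Let combe x : \sum_i x i *: e i = (cst2 (\col_i x i), 0).
Proof.
rewrite cst2E [LHS]surjective_pairing !raddf_sum /=; congr pair.
  by apply: eq_bigr => i _; rewrite mxE.
by rewrite big1 // => i _; rewrite scaler0.
Qed.

Let combf y : \sum_i y i *: f i = (0, cst2 (\col_i y i)).
Proof.
rewrite cst2E [LHS]surjective_pairing !raddf_sum /=; congr pair.
  by rewrite big1 // => i _; rewrite scaler0.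
by apply: eq_bigr => i _; rewrite mxE.
Qed.

Let addE (a c : L2T R n) (b d : L2T R m) : (a, b) + (c, d) = (a + c, b + d) :> V.
Proof. by []. Qed.

Lemma nehari_step : exists M, hpos (zshift Phi M) rho.
Proof.
have hn := @ip_herm R n; have hm := @ip_herm R m.
have Ke k x : K k -> 0 <= qf B (k + \sum_i x i *: e i).
  case: k => k1 k2 [Hk1 Hk2]; rewrite combe addE qfBE addr0; apply: Phi_pos Hk2.
  case: (@Hp_sub R n) => _ HD _; apply: HD; last exact: Hp_cst2.
  by rewrite -(zs0 k1) -[0](subrr (1 : int)) -zs_zs; exact: Hp_zs.
have Kf k x : K k -> 0 <= qf B (k + \sum_i x i *: f i).
  case: k => k1 k2 [Hk1 Hk2]; rewrite combf addE qfBE addr0.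
  set g := k2 + _; have -> : qf (@ip R m) g = qf (@ip R m) (zs (-1) g) by rewrite /qf ip_zs_zs.
  have -> : qf (@ip R n) k1 = qf (@ip R n) (zs (-1) k1) by rewrite /qf ip_zs_zs.
  rewrite -(ip_zs_zs (-1)) -mulL_zs; apply: (Phi_pos Hk1).
  rewrite zsD; case: (@Hm_sub R m) => _ HD _; apply: HD; last exact: Hm_cst2.
  exact: Hm_zs.
have [X XP] := parrott hB sK Ke Kf.
(* The form is taken at F and z g, with constant terms x and y. Subtracting M from Phi changes the
   pairing by -<M x, y>, which for M = -X^T is Parrott's correction. *)
exists (- X^T) => F g HF Hg.
have [x Hx] := Hp_decomp HF; have [y Hy] := zHm_decomp Hg.
have := XP (F - cst2 x, zs 1 g - cst2 y) (fun i => x i ord0) (fun j => y j ord0) (conj Hx Hy).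
rewrite combe addE combf addE.
have -> : (\col_i x i ord0) = x by apply/matrixP => i j; rewrite mxE [j]ord1.
have -> : (\col_i y i ord0) = y by apply/matrixP => i j; rewrite mxE [j]ord1.
rewrite qfBE !addr0 !subrK; have -> : qf (@ip R m) (zs 1 g) = qf (@ip R m) g by rewrite /qf ip_zs_zs.
move=> l; suff E : Re (ip (mulL (zshift Phi (- X^T)) F) g) = Re (ip (mulL Phi F) (zs 1 g))
   + Re (\sum_i \sum_j x i ord0 * (y j ord0)^* * X i j).
  by move: l; rewrite E; move: (Re _) (Re _) (_ + _ * _) => a b c; lra.
move=> {l}.
rewrite mulL_zshift ip_zs opprK (hermBl hm) -ReD; congr Re; congr (_ + _).
have -> : ip (mulL (li_cst (- X^T)) F) (zs 1 g) = dotc (- X^T *m x) y.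
  rewrite -[zs 1 g](subrK (cst2 y)) (hermDr hm) (ip_HpHm _ Hy) ?add0r; last first.
    by apply: Hp_mulL => //; exact: Hinf_cst.
  rewrite -[F](subrK (cst2 x)) mulLD (hermD hm) mulL_cst ip_cst2 ip_zHp_cst2 ?add0r //.
  by rewrite -mulL_zs; apply: Hp_mulL => //; exact: Hinf_cst.
rewrite mulNmx (hermNl (dotc_herm R m)) opprK /dotc exchange_big /=.
apply: eq_bigr => j _; rewrite mxE mulr_suml; apply: eq_bigr => i _.
by rewrite mxE; ring.
Qed.

End Step.

Lemma Re_scale (t : R) (x : C) : Re (t%:C * x) = t * Re x.
Proof. by rewrite ReM /= mul0r subr0. Qed.

(** One direction optimizes over the real scaling of f after a unimodular rotation; the other is 2
    |f| |g| <= |f|^2 + |g|^2. *)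
Lemma hposP m n (Phi : LinfT R m n) (rho : R) : 0 <= rho ->
  hpos Phi rho <-> forall f g, Hp f -> Hm g -> normc (ip (mulL Phi f) g) <= rho * nm f * nm g.
Proof.
move=> r0; have pn := @ip_psd R n; have pm := @ip_psd R m; split=> H f g Hf Hg; last first.
  have HgN : Hm (- g) by rewrite -scaleN1r; case: (@Hm_sub R m) => _ _; apply.
  have := le_trans (le_trans (ler_norm _) (normc_Re _)) (H f (- g) Hf HgN).
  rewrite (hermNr pm.1) ReN {2}/nm (nrmN pm) -/(nm g) -!(nrm_sq pn) -!(nrm_sq pm) -/(nm f) -/(nm g).
  move=> l; have := sqr_ge0 (nm f - nm g).
  move: l; set a := Re _; set u := nm f; set v := nm g => l s.
  have : 0 <= rho * (u - v) ^+ 2 by rewrite mulr_ge0.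
  by rewrite sqrrB mulr2n; nra.
apply: le_normc_unimodular => u u1.
have q : forall t : R, 0 <= rho * qf (@ip R n) f * t ^+ 2 + Re (u * ip (mulL Phi f) g) * t *+ 2 + rho * qf (@ip R m) g.
  move=> t; have := H ((t%:C * u) *: f) g _ Hg.
  rewrite (qfZ pn.1) mulLZ (hermZ pm.1) normcM u1 mulr1.
  rewrite normc_real real_normK ?num_real // -[_ * u * _]mulrA Re_scale => l.
  apply: le_trans (l _) _; first by case: (@Hp_sub R n) => _ _; apply.
  by rewrite le_eqVlt; apply/orP; left; apply/eqP; ring.
have := quadratic_discr (mulr_ge0 r0 (pn.2 f)) q.
rewrite -!(nrm_sq pn) -!(nrm_sq pm) -/(nm f) -/(nm g) => l.
have l2 : `|Re (u * ip (mulL Phi f) g)| ^+ 2 <= (rho * nm f * nm g) ^+ 2.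
  by rewrite real_normK ?num_real //; apply: le_trans l _; rewrite le_eqVlt; apply/orP; left; apply/eqP; ring.
apply: le_trans (ler_norm _) _; rewrite -(@ler_pXn2r _ 2) ?nnegrE ?normr_ge0 //.
by rewrite !mulr_ge0 ?nrm_ge0.
Qed.

Lemma nm_mulL m n (A : LinfT R m n) (K : R) (f : L2T R n) : 0 <= K ->
  {ae mu, forall z, mxopnorm (A z) <= K} -> nm (mulL A f) <= K * nm f.
Proof.
move=> K0 AK; apply: nrm_le; first by rewrite mulr_ge0 ?nrm_ge0.
rewrite exprMn (nrm_sq (@ip_psd R n)) -lee_fin EFinM !qf_ip_EFin.
rewrite -(integralZl measurableT (L2T_integrable f)).
apply: ae_ge0_le_integral => //.
- by move=> z _; rewrite lee_fin sqr_ge0.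
- by apply/measurable_EFinP; exact: measurable_enorm_sq (L2T_meas _).
- by move=> z _; rewrite -EFinM lee_fin mulr_ge0 ?sqr_ge0.
- apply/measurable_EFinP; apply: measurable_funM => //.
  exact: measurable_enorm_sq (L2T_meas _).
- apply: filterS AK => z AK _; rewrite -EFinM lee_fin -exprMn lerXn2r ?nnegrE ?mulr_ge0 ?enorm_ge0 //.
  by apply: le_trans (enorm_mulmx _ _) _; rewrite ler_wpM2r ?enorm_ge0.
Qed.

Lemma nm_cj n (f : L2T R n) : nm (cj f) = nm f.
Proof. by rewrite /nm /nrm /qf ip_cj cjK Re_conjc. Qed.

Lemma nondecreasing_cauchy (s : nat -> R) (M : R) :
  (forall a b, (a <= b)%N -> s a <= s b) -> (forall a, s a <= M) ->
  forall e, 0 < e -> exists N, forall a b, (N <= a)%N -> (N <= b)%N -> `|s a - s b| <= e.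
Proof.
move=> ms sM e e0.
have : cvgn s.
  by apply: nondecreasing_is_cvgn => [a b /ms//|]; exists M => _ [a _ <-].
move=> /cvgrPdist_le/(_ (e / 2%:R)) [|N _ HN]; first by rewrite divr_gt0.
exists N => a b Na Nb; have := HN a Na; have := HN b Nb => /= hb ha.
have -> : s a - s b = (limn s - s b) - (limn s - s a) by ring.
by apply: le_trans (ler_normB _ _) _; rewrite (splitr e) lerD.
Qed.

(** * The approximant as a limit of matrix polynomials *)

Section Approximant.
Variables (m n : nat) (Phi : LinfT R m n) (rho : R).
Variable step : LinfT R m n -> 'M[C]_(m, n).
Hypothesis rho0 : 0 <= rho.
(** [A k] is z^-k times what is left of Phi after subtracting the terms M 0, ..., z^(k-1) M (k-1),
    as [AE] records. *)
Let A k := iter k (fun A => zshift A (step A)) Phi.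
Hypothesis A_pos : forall k, hpos (A k) rho.
Let M k := step (A k).
Let S c k : L2T R m := \sum_(l < k) zs l%:Z (cst2 (M l *m c)).

Let AE k (z : T) : (z : C) ^ k%:Z *: A k z = Phi z - \sum_(l < k) (z : C) ^ l%:Z *: M l.
Proof.
elim: k => [|k IH]; first by rewrite expr0z scale1r big_ord0 subr0.
rewrite big_ord_recr /= opprD addrA -IH -scalerBr.
rewrite -scalemxAl mul1mx scalerA -expfzDr ?circle_neq0 //.
by rewrite (_ : _ + _ = k%:Z); last lia.
Qed.

Let SE c k z : S c k z = (\sum_(l < k) (z : C) ^ l%:Z *: M l) *m c.
Proof.
rewrite L2val_sum mulmx_suml; apply: eq_bigr => l _.
by rewrite zsE -scalemxAl.
Qed.

Let AS c k : zs k%:Z (mulL (A k) (cst2 c)) = mulL Phi (cst2 c) - S c k.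
Proof.
by apply: L2T_ext => z; rewrite zsE L2valB !mulLE SE scalemxAl AE mulmxBl.
Qed.

Let S_recr c k : S c k.+1 = S c k + zs k%:Z (cst2 (M k *m c)).
Proof. by rewrite /S big_ord_recr. Qed.

Let HmS c k : Hm (zs (- k%:Z) (S c k)).
Proof.
rewrite /zs mulL_sum; apply: subspace_sum; first exact: Hm_sub.
move=> l _; rewrite -/(zs _ _) zs_zs; apply: Hm_zsW (Hm_cst2 _).
by have := ltn_ord l; lia.
Qed.

Let HpS c k : Hp (S c k).
Proof.
apply: subspace_sum; first exact: Hp_sub.
by move=> l _; apply: Hp_zs => //; exact: Hp_cst2.
Qed.

(** Pair z^-k S with itself: it lies in H^2_-, where [hpos] controls the contribution of [A k]. *)
Let S_le c k : nm (S c k) <= nm (mulL Phi (cst2 c)) + rho * nm (cst2 c : L2T R n).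
Proof.
have h := @ip_psd R m; set g := zs (- k%:Z) (S c k).
have -> : nm (S c k) = nm g by rewrite /g nm_zs.
have [->|g0] := eqVneq (nm g) 0; first by rewrite addr_ge0 ?mulr_ge0 ?nrm_ge0.
have gp : 0 < nm g by rewrite lt_def g0 nrm_ge0.
rewrite -(ler_pM2r gp) -expr2 (nrm_sq h) mulrDl.
have -> : qf (@ip R m) g = Re (ip (zs (- k%:Z) (mulL Phi (cst2 c))) g) - Re (ip (mulL (A k) (cst2 c)) g).
  rewrite -[mulL (A k) _](zsK k%:Z) AS zsB -/g -ReN -ReD -(hermNl h.1) -(hermD h.1).
  by rewrite opprB addrC subrK.
apply: lerD.
  apply: le_trans (ler_norm _) (le_trans (Re_form_le h _ _) _).
  by rewrite -!/(nm _) nm_zs.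
rewrite -ReN; apply: le_trans (ler_norm _) (le_trans (normc_Re _) _); rewrite normcN.
by apply: (hposP (A k) rho0).1 (HmS c k) => //; exact: Hp_cst2.
Qed.

(** The difference has only frequencies >= a, and S c a only frequencies below a. *)
Let S_orth c a b : (a <= b)%N -> ip (S c a) (S c b - S c a) = 0.
Proof.
have h := @ip_herm R m; elim: b => [|b IH]; first by rewrite leqn0 => /eqP ->; rewrite subrr (herm0r h).
rewrite leq_eqVlt => /orP[/eqP ->|]; first by rewrite subrr (herm0r h).
rewrite ltnS => ab; rewrite S_recr addrAC (hermDr h) IH // add0r.
rewrite -[b%:Z]opprK -ip_zs (HmP _).1 //; last exact: Hp_cst2.
by apply: Hm_zsW (HmS c a); lia.
Qed.

Let qfS c a b : (a <= b)%N -> qf (@ip R m) (S c b - S c a) = qf (@ip R m) (S c b) - qf (@ip R m) (S c a).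
Proof.
move=> ab; have h := @ip_herm R m.
have := qfD h (S c b - S c a) (S c a).
rewrite subrK (hermC h (S c a)) S_orth // rmorph0 mul0rn addr0 => ->.
by rewrite addrK.
Qed.

(** By orthogonality the squared norms of the partial sums increase, and they are bounded. *)
Let S_cauchy c : cauchy_form (@ip R m) (S c).
Proof.
have h := @ip_psd R m; move=> e e0.
have [|||N NP] := @nondecreasing_cauchy (fun k => qf (@ip R m) (S c k))
    ((nm (mulL Phi (cst2 c)) + rho * nm (cst2 c : L2T R n)) ^+ 2) _ _ (e ^+ 2).
- by move=> a b ab; rewrite -subr_ge0 -qfS //; exact: h.2.
- by move=> a; rewrite -(nrm_sq h) lerXn2r ?nnegrE ?addr_ge0 ?mulr_ge0 ?nrm_ge0 //; exact: S_le.
- by rewrite exprn_gt0.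
exists N => a b; wlog ab : a b / (b <= a)%N.
  move=> H Na Nb; case: (leqP b a) => ab; first exact: H.
  by rewrite -(nrmN h) opprB; apply: H => //; exact: ltnW.
move=> Na Nb; apply: nrm_le; first exact: ltW.
by rewrite qfS //; apply: le_trans (ler_norm _) _; exact: NP.
Qed.

Let S_lin c k : S c k = \sum_j c j ord0 *: S (delta_mx j ord0) k.
Proof.
apply: L2T_ext => z; rewrite [LHS]SE L2val_sum.
have e j : (c j ord0 *: S (delta_mx j ord0) k) z
    = (\sum_(l < k) (z : C) ^ l%:Z *: M l) *m (c j ord0 *: delta_mx j ord0).
  by rewrite -[LHS]/(c j ord0 *: S _ k z) SE scalemxAr.
rewrite (eq_bigr _ (fun j _ => e j)) -mulmx_sumr; congr (_ *m _); apply/matrixP => i j; rewrite [j]ord1 summxE (bigD1 i) //=.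
rewrite big1 ?addr0 => [|l li]; first by rewrite !mxE !eqxx mulr1.
by rewrite !mxE eq_sym (negbTE li) mulr0.
Qed.

Lemma nehari_limit : exists Q : LinfT R m n, Hinf Q /\
  {ae mu, forall z, mxopnorm (Phi z - Q z) <= rho}.
Proof.
have h := @ip_psd R m.
have /choice[q qP] : forall j, exists l, cvg_form (@ip R m) (S (delta_mx j ord0)) l.
  by move=> j; exact: ip_complete (S_cauchy _).
pose Q z : 'M[C]_(m, n) := \matrix_(i, j) q j z i ord0.
have mQ : mx_measurable Q.
  apply/mx_measurableP => i j; under eq_fun do rewrite mxE.
  exact: L2T_cmeas.
pose w c : L2T R m := mulL Phi (cst2 c) - \sum_j c j ord0 *: q j.
have wE c z : w c z = (Phi z - Q z) *m c.
  rewrite L2valB L2val_sum mulLE mulmxBl; congr (_ - _).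
  apply/matrixP => i l; rewrite [l]ord1 summxE mxE; apply: eq_bigr => j _.
  by rewrite L2valZ !mxE mulrC.
have w_lim c e : 0 < e -> exists N, forall k, (N <= k)%N ->
    nm (w c - zs k%:Z (mulL (A k) (cst2 c))) <= e.
  move=> e0; have e1 : 0 < e / (\sum_j normc (c j ord0) + 1).
    by rewrite divr_gt0 // ltr_wpDl // sumr_ge0 // => j _; exact: normc_ge0.
  have /choice[N NP] : forall j, exists N, forall k, (N <= k)%N ->
     nm (S (delta_mx j ord0) k - q j) <= e / (\sum_j normc (c j ord0) + 1).
    by move=> j; exact: qP.
  exists (\max_j N j)%N => k Nk; rewrite AS /w opprB addrC addrA subrK S_lin -sumrB.
  apply: le_trans (nrm_sum h _ _ _) _.
  apply: le_trans (_ : \sum_j normc (c j ord0) * (e / (\sum_j normc (c j ord0) + 1)) <= _).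
    apply: ler_sum => j _; rewrite -scalerBr (nrmZ h) ler_wpM2l ?normc_ge0 //.
    by apply: NP; apply: leq_trans Nk; exact: leq_bigmax.
  rewrite -mulr_suml mulrCA ger_pMr // ler_pdivrMr ?mul1r ?lerDl //.
  by rewrite ltr_wpDl // sumr_ge0 // => j _; exact: normc_ge0.
have E_le : {ae mu, forall z, mxopnorm (Phi z - Q z) <= rho}.
  apply: ae_mxopnorm_le => // c.
  suff : {ae mu, forall z, enorm (w c z) <= rho * enorm c}.
    by apply: filterS => z; rewrite wE.
  apply: ae_enorm_le; first by rewrite mulr_ge0 ?enorm_ge0.
  move=> u G tG bG tu; apply/ler_addgt0Pr => e e0.
  pose Gl := MkLinfT bG; have [K K0 GK] := LinfT_bound (li_adj Gl).
  pose F := mulL (li_cst c) u.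
  have nF : nm F <= enorm c * nm u.
    apply: nm_mulL; first exact: enorm_ge0.
    apply: aeW => z; apply: le_trans (mxopnorm_le_mxabs _) _; rewrite /mxabs big_ord1 /=.
    by rewrite (_ : col _ _ = c) //; apply/matrixP => i j; rewrite mxE !ord1.
  have [_ [N HN] [N' HN']] := tu; have [_ [L HL] [L' HL']] := tG.
  have d0 : 0 < nm u * K + 1 by rewrite ltr_wpDl // mulr_ge0 // nrm_ge0.
  have [P HP] := w_lim c _ (divr_gt0 e0 d0).
  (* Large enough for z^(N-k) G to be in H^2_- while z^N F is analytic, so that [hpos] for [A k]
     bounds the pairing, and for [wk] to be close to [w c]. *)
  pose k := maxn P (N + L').
  have Pk : (P <= k)%N by exact: leq_maxl.
  have kNL : (N + L' <= k)%N by exact: leq_maxr.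
  pose wk := zs k%:Z (mulL (A k) (cst2 c)).
  have cdotB v v' : cdot Gl (v - v') = cdot Gl v - cdot Gl v'.
    rewrite /cdot mulLB; apply: L2T_ext => z; apply/matrixP => i j.
    by rewrite L2valB !cjE !mxE conjcB.
  have -> : ip u (cdot Gl (w c)) = ip u (cdot Gl wk) + ip u (cdot Gl (w c - wk)).
    rewrite (cdotB (w c) wk) [in RHS](hermBr (@ip_herm R 1) (cdot Gl (w c))).
    by move: (ip u (cdot Gl (w c))) (ip u (cdot Gl wk)) => x y; rewrite addrC subrK.
  apply: le_trans (le_normcD _ _) _; apply: lerD; last first.
    apply: le_trans (normc_form_le (@ip_psd R 1) _ _) _; rewrite -!/(nm _) nm_cj.
    apply: le_trans (ler_wpM2l (nrm_ge0 _ _) (nm_mulL _ K0 GK)) _.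
    apply: le_trans (_ : nm u * K * (e / (nm u * K + 1)) <= _).
      by rewrite -mulrA ler_wpM2l ?nrm_ge0 // ler_wpM2l // HP.
    by rewrite mulrCA ger_pMr // ler_pdivrMr // mul1r lerDl.
  have -> : ip u (cdot Gl wk) = ip (mulL (A k) (zs N%:Z F)) (zs (N%:Z - k%:Z) G).
    rewrite mulL_zs -zs_zs ip_zs_zs -ip_zs ip_cdot ipE; congr cintegral; apply/funext => z.
    rewrite -(hermZ (dotc_herm R m)); congr dotc; rewrite !zsE !mulLE /= scalerA mulrC -scalerA.
    congr (_ *: _); rewrite scalemxAr; congr (_ *m _).
    by apply/matrixP => i j; rewrite !mxE big_ord1 mulrC ord1.
  apply: le_trans ((hposP (A k) rho0).1 (A_pos k) _ _ _ _) _.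
  - have -> : zs N%:Z F = mulL (li_cst c) (zs N%:Z u) by rewrite mulL_zs.
    by apply: Hp_mulL; [exact: Hinf_cst|exact: HN].
  - by apply: Hm_zsW HL'; lia.
  by rewrite !nm_zs ler_wpM2r ?nrm_ge0 // -mulrA ler_wpM2l.
have bQ : Linf Q.
  apply/Linf_boundP; split=> //.
  have [K K0 PK] := LinfT_bound Phi; exists (K + rho); first exact: addr_ge0.
  apply: filterS2 PK E_le => z PK EK; rewrite -[Q z](subKr (Phi z)).
  by apply: le_trans (mxopnormD _ _) _; rewrite mxopnormN lerD.
exists (MkLinfT bQ); split=> //; apply/Hinf_cst2 => j.
apply: (@Hp_ae _ _ (q j)).
  by apply: aeW => z; rewrite mulLE /= -colE; apply/matrixP => i l; rewrite !mxE ord1.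
rewrite Hp_orth; apply: cvg_form_orth h (qP j) _ => k; rewrite -Hp_orth; exact: HpS.
Qed.

End Approximant.

Lemma nehari m n (Phi : LinfT R m n) (rho : R) : 0 <= rho -> hpos Phi rho ->
  exists Q : LinfT R m n, Hinf Q /\ {ae mu, forall z, mxopnorm (Phi z - Q z) <= rho}.
Proof.
move=> rho0 Ppos.
have /choice[step stepP] : forall A : LinfT R m n, exists M, hpos A rho -> hpos (zshift A M) rho.
  move=> A; case: (pselect (hpos A rho)) => HA; last first.
    by exists (0 : 'M[C]_(m, n)) => Hp0; case: (HA Hp0).
  by have [M HM] := nehari_step HA; exists M.
apply: (@nehari_limit _ _ Phi rho step rho0) => k.
by elim: k => [|k IH]; [exact: Ppos|exact: (stepP _ IH)].
Qed.

End Nehari.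

(** * Hankel operators *)

Section HankelForm.
Variable R : realType.
Local Notation C := R[i].
Local Notation T := (circle R).
Local Notation mu := (circle_measure R).

Lemma ip_PmPm n (a b : L2T R n) : ip (Pm a) (Pm b) = ip a (Pm b).
Proof.
by rewrite [a in RHS]PpPm [RHS](hermD (@ip_herm R n)) (ip_HpHm (Pp_Hp a) (Pm_Hm b)) add0r.
Qed.

Lemma ip_PpPp n (a b : L2T R n) : ip (Pp a) (Pp b) = ip a (Pp b).
Proof.
have e : ip (Pm a) (Pp b) = 0 by apply: (HmP _).1 (Pm_Hm a) _ (Pp_Hp b).
by rewrite [a in RHS]PpPm [RHS](hermD (@ip_herm R n)) e addr0.
Qed.

Lemma nm_Pm n (f : L2T R n) : nm (Pm f) <= nm f.
Proof.
apply: nrm_le; first exact: nrm_ge0.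
rewrite (nrm_sq (@ip_psd R n)) [leRHS]qf_PpPm lerDr; exact: (@ip_psd R n).2.
Qed.

Lemma nm_Pp n (f : L2T R n) : nm (Pp f) <= nm f.
Proof.
apply: nrm_le; first exact: nrm_ge0.
rewrite (nrm_sq (@ip_psd R n)) [leRHS]qf_PpPm lerDl; exact: (@ip_psd R n).2.
Qed.

Lemma nm_PmB n (x y : L2T R n) : nm (Pm x - Pm y) <= nm (x - y).
Proof.
have h := @ip_psd R n; set v := Pm x - Pm y.
have [->|v0] := eqVneq (nm v) 0; first exact: nrm_ge0.
have vp : 0 < nm v by rewrite lt_def v0 nrm_ge0.
rewrite -(ler_pM2r vp) -expr2 (nrm_sq h).
have -> : qf (@ip R n) v = Re (ip (x - y) (Pm v)).
  by rewrite /qf {1}/v (hermBl h.1) !ip_Pm -(hermBl h.1).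
apply: le_trans (ler_norm _) (le_trans (Re_form_le h _ _) _).
by rewrite ler_wpM2l ?nrm_ge0 // nm_Pm.
Qed.

Lemma nm_Pm_ae n (x y : L2T R n) : {ae mu, forall z, x z = y z} -> nm (Pm x) = nm (Pm y).
Proof.
move=> /ae_eq_nm xy; apply/eqP; rewrite -subr_eq0 -normr_le0.
apply: le_trans (nrm_dist (@ip_psd R n) _ _) _.
by apply: le_trans (nm_PmB x y) _; rewrite xy.
Qed.

Lemma Pp_id n (f : L2T R n) : Hp f -> {ae mu, forall z, Pp f z = f z}.
Proof.
move=> Hf; suff : {ae mu, forall z, f z = Pp f z} by apply: filterS => z.
apply/ae_eq_nm; rewrite -PmE; have h := @ip_psd R n.
have H1 : Hp (Pm f) by rewrite PmE; apply: (subspaceB (@Hp_sub R n)) => //; exact: Pp_Hp.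
by apply: (@qf_nrm0 _ _ _ _); rewrite /qf ip_HpHm //; exact: Pm_Hm.
Qed.

(* The Hankel operator precomposed with the projection on H^2, so that its form
   lives on all of the complete space L^2. *)
Definition hank m n (Phi : LinfT R m n) (f : L2T R n) : L2T R m := Pm (mulL Phi (Pp f)).

(** All operators stand in the second argument so that linearity in F is exact: [Pp] and [Pm] are
    chosen representatives, linear only almost everywhere. *)
Definition hform m n (Phi : LinfT R m n) (F G : L2T R n) : C :=
  ip F (Pp (mulL (li_adj Phi) (hank Phi G))).

Lemma hformE m n (Phi : LinfT R m n) F G : hform Phi F G = ip (hank Phi F) (hank Phi G).
Proof. by rewrite /hform /hank ip_PmPm ip_mulL ip_Pp. Qed.

Lemma hform_psd m n (Phi : LinfT R m n) : psd (hform Phi).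
Proof.
have h := @ip_herm R n; split; last by move=> x; rewrite /qf hformE; exact: (@ip_psd R m).2.
split=> [x y z|a x z|x y]; rewrite ?hformE; last by rewrite (hermC (@ip_herm R m)).
  by rewrite -!hformE /hform (hermD h).
by rewrite -!hformE /hform (hermZ h).
Qed.

Lemma qf_hform m n (Phi : LinfT R m n) F : qf (hform Phi) F = nm (hank Phi F) ^+ 2.
Proof. by rewrite /qf hformE (nrm_sq (@ip_psd R m)). Qed.

Lemma nm_hank m n (Phi : LinfT R m n) F : Hp F -> nm (hank Phi F) = nm (Pm (mulL Phi F)).
Proof.
move=> HF; apply: nm_Pm_ae; apply: filterS (Pp_id HF) => z PF.
by rewrite !mulLE PF.
Qed.

(** Q F is analytic, hence orthogonal to every value of [Pm]. *)
Lemma nm_Pm_sub m n (Phi Q : LinfT R m n) F : Hinf Q -> Hp F ->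
  nm (Pm (mulL (li_sub Phi Q) F)) = nm (Pm (mulL Phi F)).
Proof.
move=> HQ HF; have h := @ip_psd R m; rewrite mulL_sub.
have E x : ip (mulL Phi F - mulL Q F) (Pm x) = ip (mulL Phi F) (Pm x).
  by rewrite (hermBl h.1) (ip_HpHm (Hp_mulL HQ HF) (Pm_Hm x)) subr0.
have /eqP : nm (Pm (mulL Phi F - mulL Q F) - Pm (mulL Phi F)) = 0.
  apply: (@qf_nrm0 _ _ _ _); rewrite /qf; set v := Pm _ - _.
  by rewrite {1}/v (hermBl h.1) !ip_Pm E subrr.
rewrite eq_le => /andP[v0 _]; apply/eqP; rewrite -subr_eq0 -normr_le0.
exact: le_trans (nrm_dist h _ _) v0.
Qed.

Definition hankel_le m n (Phi : LinfT R m n) (t : R) : Prop :=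
  forall F, qf (hform Phi) F <= t ^+ 2 * qf (@ip R n) F.

Lemma hankel_le_nm m n (Phi : LinfT R m n) (t : R) F : 0 <= t -> hankel_le Phi t ->
  Hp F -> nm (Pm (mulL Phi F)) <= t * nm F.
Proof.
move=> t0 Ht HF; rewrite -nm_hank // -(@ler_pXn2r _ 2) ?nnegrE ?mulr_ge0 ?nrm_ge0 //.
by rewrite -qf_hform exprMn (nrm_sq (@ip_psd R n)).
Qed.

Lemma hankel_le_hpos m n (Phi : LinfT R m n) (t : R) : 0 <= t -> hankel_le Phi t -> hpos Phi t.
Proof.
move=> t0 Ht; apply/hposP => // f g Hf Hg.
have -> : ip (mulL Phi f) g = ip (Pm (mulL Phi f)) g.
  rewrite [mulL Phi f in LHS]PpPm (hermD (@ip_herm R m)) ip_HpHm ?add0r //.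
  exact: Pp_Hp.
apply: le_trans (normc_form_le (@ip_psd R m) _ _) _.
by rewrite ler_wpM2r ?nrm_ge0 //; exact: hankel_le_nm.
Qed.

Lemma hankel_le_approx m n (Phi Q : LinfT R m n) (t : R) : 0 <= t -> Hinf Q ->
  {ae mu, forall z, mxopnorm (Phi z - Q z) <= t} -> hankel_le Phi t.
Proof.
move=> t0 HQ Et F; rewrite qf_hform -!(nrm_sq (@ip_psd R n)) -exprMn.
rewrite lerXn2r ?nnegrE ?mulr_ge0 ?nrm_ge0 //.
have HF := Pp_Hp F; rewrite /hank -(nm_Pm_sub Phi HQ HF).
apply: le_trans (nm_Pm _) _; apply: le_trans (@nm_mulL _ _ _ (li_sub Phi Q) _ _ t0 Et) _.
by rewrite ler_wpM2l // nm_Pp.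
Qed.

(** t^2 is the supremum of the form over unit vectors; these exist because there is at least one
    column. *)
Lemma hankel_norm m n (Phi : LinfT R m n.+1) : exists t : R, [/\ 0 <= t, hankel_le Phi t &
  forall e, 0 < e -> exists2 a, qf (@ip R n.+1) a = 1 & t ^+ 2 - e <= qf (hform Phi) a].
Proof.
have [M M0 PM] := LinfT_bound Phi; have h := @ip_psd R n.+1.
have HM F : qf (hform Phi) F <= M ^+ 2 * qf (@ip R n.+1) F.
  have PM0 : {ae mu, forall z, mxopnorm (Phi z - li_cst 0 z) <= M}.
    by apply: filterS PM => z; rewrite subr0.
  exact: (hankel_le_approx M0 (@Hinf_cst R m n.+1 0) PM0).
pose S := [set qf (hform Phi) F | F in [set F | qf (@ip R n.+1) F = 1]].
have supS : has_sup S.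
  split.
    exists (qf (hform Phi) (cst2 (delta_mx ord0 ord0))), (cst2 (delta_mx ord0 ord0)) => //=.
    by rewrite /qf ip_cst2 dotc_delta mxE !eqxx.
  by exists (M ^+ 2) => _ [F /= F1 <-]; apply: le_trans (HM F) _; rewrite F1 mulr1.
have S0 : 0 <= sup S.
  have [[x [F F1 Fx]] _] := supS; apply: le_trans (_ : x <= _).
    by rewrite -Fx; exact: (hform_psd Phi).2.
  by apply: sup_upper_bound => //; exists F.
exists (Num.sqrt (sup S)); rewrite sqrtr_ge0 /hankel_le sqr_sqrtr //; split=> // [F|e e0].
  have [F0|F0] := eqVneq (qf (@ip R n.+1) F) 0.
    by apply: le_trans (HM F) _; rewrite F0 !mulr0.
  have Fp : 0 < qf (@ip R n.+1) F by rewrite lt_def F0 h.2.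
  have np : 0 < nm F by rewrite /nm /nrm sqrtr_gt0.
  have nE : normc ((nm F)^-1)%:C ^+ 2 = (qf (@ip R n.+1) F)^-1.
    by rewrite normc_real real_normK ?num_real // exprVn (nrm_sq h).
  have : qf (hform Phi) (((nm F)^-1)%:C *: F) <= sup S.
    apply: sup_upper_bound => //; exists (((nm F)^-1)%:C *: F) => //=.
    by rewrite (qfZ h.1) nE mulVf.
  by rewrite (qfZ (hform_psd Phi).1) nE mulrC ler_pdivrMr.
have [_ [a a1 <-] la] := sup_adherent e0 supS; exists a => //; exact: ltW.
Qed.

(* On H^2 this says that the Hankel operator has norm at most sqrt c up to a
   perturbation of rank N. *)
Definition hankel_dim m n (Phi : LinfT R m n) (c : R) (N : nat) : Prop := 0 <= c /\
  forall F : 'I_N.+1 -> L2T R n, (forall i, Hp (F i)) -> forall e, 0 < e ->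
  exists2 x : 'I_N.+1 -> C, \sum_i normc (x i) ^+ 2 = 1 &
    nm (Pm (mulL Phi (\sum_i x i *: F i))) ^+ 2 <= c * nm (\sum_i x i *: F i) ^+ 2 + e.

(** Projecting the family onto H^2 leaves the Hankel form unchanged and can only decrease the
    norm. *)
Lemma hankel_dim_bound m n (Phi : LinfT R m n) c N :
  hankel_dim Phi c N -> dim_bound (@ip R n) (hform Phi) c N.
Proof.
move=> [c0 H] F e e0; have [x x1 xP] := H (fun i => Pp (F i)) (fun i => Pp_Hp (F i)) e e0.
exists x => //; have h := @ip_psd R n; set G := \sum_i _ in xP; set S := \sum_i _.
have GS : nm (Pp S - G) = 0.
  apply: (@qf_nrm0 _ _ _ _); rewrite /qf; set v := _ - _.
  rewrite {1}/v (hermBl h.1) ip_Pp /S /G !(herm_suml h.1).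
  rewrite -sumrB big1 // => i _.
  by rewrite !(hermZ h.1) ip_Pp subrr.
have aeGS : {ae mu, forall z, G z = Pp S z}.
  by apply/ae_eq_nm; rewrite -[G - _]opprB /nm (nrmN h).
rewrite qf_hform /hank -(nrm_sq h).
have <- : nm (Pm (mulL Phi G)) = nm (Pm (mulL Phi (Pp S))).
  by apply: nm_Pm_ae; apply: filterS aeGS => z e1; rewrite !mulLE e1.
apply: le_trans xP _; rewrite lerD2r ler_wpM2l // (nm_ae aeGS).
by rewrite lerXn2r ?nnegrE ?nrm_ge0 // nm_Pp.
Qed.

Lemma Hm_ae n (f g : L2T R n) : {ae mu, forall z, f z = g z} -> Hm f -> Hm g.
Proof. by move=> fg /HmP H; apply/HmP => k Hk; rewrite -(ip_ae _ fg) H. Qed.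

(** The difference of the squares is nonnegative with zero integral. *)
Lemma ae_enorm_eq m n (u : L2T R m) (v : L2T R n) (K : R) : 0 <= K ->
  {ae mu, forall z, enorm (u z) <= K * enorm (v z)} -> nm u = K * nm v ->
  {ae mu, forall z, enorm (u z) = K * enorm (v z)}.
Proof.
move=> K0 uv nuv; pose f z : R := K ^+ 2 * enorm (v z) ^+ 2 - enorm (u z) ^+ 2.
have mf : measurable_fun setT (fun z => (f z)%:E).
  apply/measurable_EFinP; apply: measurable_funB; last exact: measurable_enorm_sq (L2T_meas _).
  by apply: measurable_funM => //; exact: measurable_enorm_sq (L2T_meas _).
have f0 : {ae mu, forall z, 0 <= f z}.
  apply: filterS uv => z uv; rewrite subr_ge0 -exprMn.
  by rewrite lerXn2r ?nnegrE ?mulr_ge0 ?enorm_ge0.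
have : (\int[mu]_z `|(f z)%:E| = 0)%E.
  rewrite (@ae_eq_integral _ _ _ mu setT (fun z => (f z)%:E)) //; last first.
  - by apply: filterS f0 => z f0 _; rewrite abse_EFin ger0_norm.
  - exact: measurableT_comp.
  have iv := integrableZl measurableT (K ^+ 2) (L2T_integrable v).
  rewrite (integralB_EFin measurableT iv (L2T_integrable u)).
  rewrite [X in (X - _)%E](integralZl measurableT (L2T_integrable v)).
  rewrite -!qf_ip_EFin -EFinM -EFinB -!(nrm_sq (@ip_psd R _)) -/(nm u) nuv exprMn.
  by rewrite -/(nm v) subrr.
move/(ae_eq_integral_abs mu measurableT mf); apply: filterS => z /(_ I) /= [/eqP].
rewrite subr_eq0 -exprMn eqrXn2 ?mulr_ge0 ?enorm_ge0 // => /eqP ->.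
by [].
Qed.

(* By hankel_dim the norm t of the Hankel operator is attained at some f; as
   |Phi - Q| <= t, the vector (Phi - Q) f is then H_Phi f and has modulus t |f|. *)
Lemma maximizing_vector m n (Phi : LinfT R m n.+1) (t c : R) N :
  0 < t -> hankel_le Phi t ->
  (forall e, 0 < e -> exists2 a, qf (@ip R n.+1) a = 1 & t ^+ 2 - e <= qf (hform Phi) a) ->
  c < t ^+ 2 -> hankel_dim Phi c N ->
  exists f : L2T R n.+1, [/\ Hp f, nm f != 0 &
    forall Q : LinfT R m n.+1, Hinf Q -> {ae mu, forall z, mxopnorm (Phi z - Q z) <= t} ->
      Hm (mulL (li_sub Phi Q) f) /\
      {ae mu, forall z, enorm (mulL (li_sub Phi Q) f z) = t * enorm (f z)}].
Proof.
move=> t0 Ht Hmax ct D; have h := @ip_psd R n.+1.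
have [a a1 at2] := form_attains h (hform_psd Phi) (@ip_complete R n.+1) ct Ht Hmax (hankel_dim_bound D).
have Hf := Pp_Hp a; set f := Pp a in Hf.
have na : nm a = 1 by rewrite /nm /nrm a1 sqrtr1.
have nH : nm (Pm (mulL Phi f)) = t.
  apply/eqP; rewrite -(@eqrXn2 _ 2) ?nrm_ge0 ?(ltW t0) //.
  by rewrite -at2 qf_hform.
have nf : nm f = 1.
  apply/eqP; rewrite eq_le -{1}na nm_Pp -(ler_pM2l t0) mulr1 -{1}nH.
  exact: hankel_le_nm (ltW t0) Ht Hf.
exists f; split=> //; first by rewrite nf oner_neq0.
move=> Q HQ Et; set E := li_sub Phi Q.
have nE : nm (mulL E f) <= t by have := @nm_mulL _ _ _ E _ f (ltW t0) Et; rewrite nf mulr1.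
have hm := @ip_psd R m.
have nPm : nm (Pm (mulL E f)) = t by rewrite nm_Pm_sub.
(* The co-analytic part of E f already has norm t, which is all that |E f| <= t allows. *)
have nPp : qf (@ip R m) (Pp (mulL E f)) = 0.
  apply/eqP; rewrite eq_le hm.2 andbT.
  have : nm (mulL E f) ^+ 2 <= t ^+ 2 by rewrite lerXn2r ?nnegrE ?nrm_ge0 ?(ltW t0).
  by rewrite (nrm_sq hm) qf_PpPm -[X in _ + X](nrm_sq hm) -/(nm _) nPm gerDr.
split.
  apply: Hm_ae (Pm_Hm (mulL E f)).
  have /nm_eq0 := qf_nrm0 nPp; apply: filterS => z.
  by rewrite PmE L2valB => ->; rewrite subr0.
apply: ae_enorm_eq; first exact: ltW.
  apply: filterS Et => z Et; apply: le_trans (enorm_mulmx _ _) _.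
  by rewrite ler_wpM2r ?enorm_ge0.
apply/eqP; rewrite nf mulr1 eq_le nE /= -{1}nPm; exact: nm_Pm.
Qed.

End HankelForm.

(** * Reduction to a smaller symbol *)

Section Arithmetic.
Variable R : realType.

(* The estimate of [hankel_dim_reduction] in numbers: D bounds all approximation
   errors, S and u' are the norms of F and L^T F, u that of the vector
   approximated by L^T F, and Y, P those of the projections of Psi L^T F. *)
Lemma transfer_arith (t c e D B a Y P u u' S : R) :
  0 <= c -> c <= t ^+ 2 -> 0 <= t -> 0 <= D -> D <= 1 -> 0 <= P -> P <= t * u' ->
  0 <= Y -> Y <= t * u' -> 0 <= u -> u <= B -> 0 <= u' -> u' <= u + D -> u' <= S ->
  0 <= a -> a <= Y + t * D ->
  Y ^+ 2 + P ^+ 2 + t ^+ 2 * (S ^+ 2 - u' ^+ 2) <= c * S ^+ 2 + e / 2%:R + (P + D *+ 2) ^+ 2 ->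
  D * (4%:R * t * (B + 1) + 4%:R + 2%:R * t ^+ 2 * (B + 1) + t ^+ 2 + c * (2%:R * B + 1)) <= e / 2%:R ->
  a ^+ 2 <= c * u ^+ 2 + e.
Proof.
move=> c0 ct t0 D0 D1 P0 Pu Y0 Yu u0 uB u'0 u'u u'S a0 aY H K.
have B1 : u' <= B + 1 by lra.
have B0 : 0 <= B + 1 by lra.
have PB : P <= t * (B + 1) by apply: le_trans Pu _; rewrite ler_wpM2l.
have YB : Y <= t * (B + 1) by apply: le_trans Yu _; rewrite ler_wpM2l.
have DD : D ^+ 2 <= D by rewrite expr2 -[leRHS]mulr1 ler_wpM2l.
have t2 : 0 <= t ^+ 2 by rewrite sqr_ge0.
have s1 : 0 <= (t ^+ 2 - c) * (S ^+ 2 - u' ^+ 2).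
  rewrite mulr_ge0 ?subr_ge0 // lerXn2r ?nnegrE //; exact: le_trans u'S.
have s2 : P * D <= t * (B + 1) * D by rewrite ler_wpM2r.
have s3 : Y * (t * D) <= t * (B + 1) * (t * D) by rewrite ler_wpM2r // mulr_ge0.
have s4 : t ^+ 2 * D ^+ 2 <= t ^+ 2 * D by rewrite ler_wpM2l.
have s5 : u' ^+ 2 <= (u + D) ^+ 2 by rewrite lerXn2r ?nnegrE // addr_ge0.
have s6 : u * D <= B * D by rewrite ler_wpM2r.
have s7 : c * u' ^+ 2 <= c * (u ^+ 2 + 2%:R * (B * D) + D).
  by rewrite ler_wpM2l //; apply: le_trans s5 _; rewrite sqrrD; lra.
have s8 : a ^+ 2 <= (Y + t * D) ^+ 2 by rewrite lerXn2r ?nnegrE // addr_ge0 // mulr_ge0.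
have -> : c * u ^+ 2 + e = c * u ^+ 2 + e / 2%:R + e / 2%:R by lra.
apply: le_trans (lerD (lexx _) K); apply: le_trans s8 _.
have e8 : (Y + t * D) ^+ 2 = Y ^+ 2 + 2%:R * (Y * (t * D)) + t ^+ 2 * D ^+ 2 by ring.
rewrite e8; move: H s1 s2 s3 s4 s7.
have -> : (P + D *+ 2) ^+ 2 = P ^+ 2 + 4%:R * (P * D) + 4%:R * D ^+ 2 by ring.
have -> : t * (B + 1) * (t * D) = t ^+ 2 * (B + 1) * D by ring.
nra.
Qed.

End Arithmetic.

Section Reduction.
Variable R : realType.
Local Notation C := R[i].
Local Notation T := (circle R).
Local Notation mu := (circle_measure R).

(** L^T H^2 is dense in H^2, and since A is bounded, analyticity passes to the limit. *)
Lemma Hp_mulL_dense n k (f : L2T R n.+1) (L : LinfT R n.+1 n) (A : LinfT R k n) :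
  nm f != 0 -> Hp f -> coinner f L ->
  (forall F, Hp F -> Hp (mulL A (mulL (li_tr L) F))) -> Hinf A.
Proof.
move=> f0 Hf cL HA; apply/Hinf_cst2 => j; set psi := cst2 _.
have Hpsi : Hp psi by exact: Hp_cst2.
have h := @ip_psd R k; have [M M0 AM] := LinfT_bound A.
rewrite Hp_orth => s Ss; apply/eq0_normc/le_anti; rewrite normc_ge0 andbT.
apply/ler_addgt0Pr => e e0; rewrite add0r.
have K0 : 0 < M * nm s + 1 by rewrite ltr_wpDl // mulr_ge0 ?nrm_ge0.
have [F HF psiF] := coinner_tr_dense f0 Hf cL Hpsi (divr_gt0 e0 K0).
have AF0 : ip (mulL A (mulL (li_tr L) F)) s = 0.
  by have := HA F HF; rewrite Hp_orth; apply.
have -> : ip (mulL A psi) s = ip (mulL A (psi - mulL (li_tr L) F)) s.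
  by rewrite mulLB (hermBl h.1) AF0 subr0.
apply: le_trans (normc_form_le h _ _) _; rewrite -!/(nm _).
apply: le_trans (ler_wpM2r (nrm_ge0 _ _) (nm_mulL _ M0 AM)) _.
apply: le_trans (_ : M * (e / (M * nm s + 1)) * nm s <= _).
  by rewrite ler_wpM2r ?nrm_ge0 // ler_wpM2l.
rewrite mulrAC mulrCA ger_pMr // ler_pdivrMr // mul1r.
by rewrite lerDl.
Qed.

Variables (m n : nat) (Phi Q0 : LinfT R m.+1 n.+1) (t : R) (f : L2T R n.+1).
Hypotheses (t0 : 0 < t) (HQ0 : Hinf Q0).
Hypothesis Q0t : {ae mu, forall z, mxopnorm (Phi z - Q0 z) <= t}.
Hypotheses (Hf : Hp f) (f0 : nm f != 0).
Hypothesis fmax : forall Q : LinfT R m.+1 n.+1, Hinf Q ->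
  {ae mu, forall z, mxopnorm (Phi z - Q z) <= t} ->
  Hm (mulL (li_sub Phi Q) f) /\
  {ae mu, forall z, enorm (mulL (li_sub Phi Q) f z) = t * enorm (f z)}.
Let E0 := li_sub Phi Q0.
Let g := mulL E0 f.
(** The analytic counterpart of g: as [cj h] is z g, a co-inner completion of h is pointwise
    orthogonal to g. *)
Let h := zs (-1) (cj g).
Variables (L : LinfT R n.+1 n) (X : LinfT R m.+1 m).
Hypotheses (cL : coinner f L) (cX : coinner h X).

Let Hg : Hm g. Proof. by case: (fmax HQ0 Q0t). Qed.
Let gE : {ae mu, forall z, enorm (g z) = t * enorm (f z)}.
Proof. by case: (fmax HQ0 Q0t). Qed.
Let cjh : cj h = zs 1 g. Proof. by rewrite /h cj_zs cjK. Qed.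
Let Hh : Hp h. Proof. exact/Hm_cj. Qed.

Let f_ae : {ae mu, forall z, f z != 0}. Proof. exact: Hp_ae_neq0. Qed.

Lemma hankel_conj_neq0 : nm h != 0.
Proof.
apply/negP; rewrite /h nm_zs nm_cj => /eqP/nm_eq0 gz.
have [z [[fz gfz] gz0]] := ae_exists (filterI (filterI f_ae gE) gz).
move: gfz; rewrite gz0 enorm0 => /esym/eqP; rewrite mulf_eq0 gt_eqF //=.
by rewrite gt_eqF // enorm_gt0.
Qed.
Let h0 := hankel_conj_neq0.

Let V := li_conj L.
Let VT z : adjmx (V z) = (L z)^T.
Proof. by apply/matrixP => i j; rewrite !mxE conjcK. Qed.

Let V_iso : {ae mu, forall z, adjmx (V z) *m V z = 1%:M}.
Proof.
have [_ iL _ _] := cL; apply: filterS iL => z /(congr1 (map_mx conjc)).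
rewrite map_mxM map_mx1; congr (_ *m _ = _).
by apply/matrixP => i j; rewrite !mxE.
Qed.

Let Vf : {ae mu, forall z, adjmx (V z) *m f z = 0}.
Proof.
have [_ _ fL _] := cL; apply: filterS fL => z /(congr1 (map_mx conjc)).
rewrite map_mxM map_mx0; congr (_ *m _ = _); apply/matrixP => i j; rewrite !mxE //; exact: conjcK.
Qed.

Let X_iso : {ae mu, forall z, adjmx (X z) *m X z = 1%:M}.
Proof. by case: cX. Qed.

Let Xg : {ae mu, forall z, adjmx (X z) *m g z = 0}.
Proof.
have [_ _ gX _] := cX; apply: filterS gX => z; rewrite cjh zsE -scalemxAr => /eqP.
by rewrite scaler_eq0 expfz_eq0 (negbTE (circle_neq0 z)) andbF /= => /eqP.
Qed.

Definition red_v z : 'cV[C]_n.+1 := ((enorm (f z))^-1)%:C *: f z.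
Definition red_w z : 'cV[C]_m.+1 := ((t * enorm (f z))^-1)%:C *: g z.

Lemma reduction_unitary_split :
  {ae mu, forall z, unitary_split (red_v z) (V z) /\ unitary_split (red_w z) (X z)}.
Proof.
apply: filterS2 (filterI (filterI f_ae gE) (filterI V_iso Vf)) (filterI X_iso Xg).
move=> z [[fz gz] [Vz Vfz]] [Xz Xgz]; have fp := enorm_gt0 fz.
by split; apply: normalize_split => //; rewrite gt_eqF // mulr_gt0.
Qed.

(** Both images (Phi - Q) f and g lie in H^2_-, while their difference (Q0 - Q) f is analytic. *)
Let approx_mul_f (Q : LinfT R m.+1 n.+1) : Hinf Q ->
  {ae mu, forall z, mxopnorm (Phi z - Q z) <= t} ->
  {ae mu, forall z, (Phi z - Q z) *m f z = g z}.
Proof.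
move=> HQ Qt; have [HE _] := fmax HQ Qt.
suff : {ae mu, forall z, mulL (li_sub Phi Q) f z = g z} by [].
apply/ae_eq_nm; set d := _ - _.
have Hd : Hm d by apply: (subspaceB (@Hm_sub R m.+1)).
have Hd' : Hp d.
  apply: (@Hp_ae _ _ (mulL (li_sub Q0 Q) f)); last by apply: Hp_mulL => //; exact: Hinf_sub.
  apply: aeW => z; rewrite L2valB !mulLE /= -mulmxBl; congr (_ *m _).
  by rewrite opprB [RHS]addrC addrA subrK.
by apply: (@qf_nrm0 _ _ _ _); rewrite /qf ip_HpHm.
Qed.

Definition red_symbol : LinfT R m n := li_mul (li_adj X) (li_mul E0 V).

Let split_approx (Q : LinfT R m.+1 n.+1) : Hinf Q ->
  {ae mu, forall z, mxopnorm (Phi z - Q z) <= t} ->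
  {ae mu, forall z, Phi z - Q z = t%:C *: (red_w z *m adjmx (red_v z))
     + X z *m (adjmx (X z) *m (Phi z - Q z) *m V z) *m adjmx (V z)}.
Proof.
move=> HQ Qt.
apply: filterS3 (filterI (filterI f_ae gE) (filterI V_iso Vf)) (filterI X_iso Xg)
  (filterI (approx_mul_f HQ Qt) Qt).
move=> z [[fz gz] [Vz Vfz]] [Xz Xgz] [Ef Ez].
rewrite {1}(@attaining_split R m n (Phi z - Q z) t (f z) (V z) (X z)) ?Ef //.
Qed.

Lemma red_symbol_le : {ae mu, forall z, mxopnorm (red_symbol z) <= t}.
Proof.
apply: filterS3 reduction_unitary_split V_iso Q0t => z [_ sX] Vz Ez.
apply: mxopnorm_le => [|x]; first exact: ltW.
rewrite -[red_symbol z]/(adjmx (X z) *m ((Phi z - Q0 z) *m V z)) -!mulmxA.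
apply: le_trans (enorm_adj_split_le _ sX) _; apply: le_trans (enorm_mulmx _ _) _.
by rewrite -(enorm_isometry x Vz) ler_wpM2r ?enorm_ge0.
Qed.

(** The rank-one terms cancel in D = Q - Q0, so D = X M V* pointwise and G L^T F = X* D F. As D F is
    analytic and annihilated by h, the co-inner property of X makes X* D F analytic, and density of
    L^T H^2 does the rest. *)
Lemma reduction_down (Q : LinfT R m.+1 n.+1) : Hinf Q ->
  {ae mu, forall z, mxopnorm (Phi z - Q z) <= t} ->
  exists2 G : LinfT R m n, Hinf G &
  {ae mu, forall z, Phi z - Q z = t%:C *: (red_w z *m adjmx (red_v z))
     + X z *m (red_symbol z - G z) *m adjmx (V z)}.
Proof.
move=> HQ Qt; pose D := li_sub Q Q0.
have HD : Hinf D by exact: Hinf_sub.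
pose G := li_mul (li_adj X) (li_mul D V); exists G; last first.
  have e z : Phi z - Q0 z - (Q z - Q0 z) = Phi z - Q z by rewrite opprB addrA subrK.
  apply: filterS (split_approx HQ Qt) => z E.
  rewrite [LHS]E -[red_symbol z]/(adjmx (X z) *m ((Phi z - Q0 z) *m V z)).
  rewrite -[G z]/(adjmx (X z) *m ((Q z - Q0 z) *m V z)).
  rewrite -(mulmxBr (adjmx (X z))) -(mulmxBl (Phi z - Q0 z)) e.
  by rewrite (mulmxA (adjmx (X z))).
have D_split : {ae mu, forall z, exists M, D z = X z *m M *m adjmx (V z)}.
  apply: filterS2 (split_approx HQ Qt) (split_approx HQ0 Q0t) => z EQ EQ0.
  have -> : D z = (Phi z - Q0 z) - (Phi z - Q z) by rewrite opprB addrC addrA subrK.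
  rewrite EQ EQ0; eexists; rewrite opprD addrACA subrr add0r -mulmxBl -mulmxBr.
  by [].
apply: (Hp_mulL_dense f0 Hf cL) => F HF.
have [_ _ hX HX] := cX.
apply: (@Hp_ae _ _ (mulL (li_adj X) (mulL D F))).
  apply: filterS2 D_split V_iso => z [M DE] Vz.
  rewrite [LHS]mulLE [mulL D F z]mulLE [RHS]mulLE [mulL (li_tr L) F z]mulLE.
  rewrite -[G z]/(adjmx (X z) *m (D z *m V z)) -[li_tr L z]/((L z)^T) -VT DE -!mulmxA.
  by rewrite [adjmx (V z) *m (V z *m _)]mulmxA Vz mul1mx.
apply: HX; split; first exact: Hp_mulL.
apply: filterS2 D_split hX => z [M DE] hXz.
by rewrite mulLE DE -!mulmxA dotc_adj hXz (herm0r (dotc_herm R m)).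
Qed.

Lemma reduction_up (G : LinfT R m n) : Hinf G ->
  exists2 Q : LinfT R m.+1 n.+1, Hinf Q &
  {ae mu, forall z, Phi z - Q z = t%:C *: (red_w z *m adjmx (red_v z))
     + X z *m (red_symbol z - G z) *m adjmx (V z)}.
Proof.
move=> HG; have [HX _ _ _] := cX; have [HL _ _ _] := cL.
(* This is Q0 + X G L^T. *)
pose Q := li_sub Q0 (li_mul X (li_mul (li_sub (li_cst 0) G) (li_tr L))).
exists Q.
  apply: Hinf_sub => //; apply: Hinf_mul => //; apply: Hinf_mul; last exact: Hinf_tr.
  by apply: Hinf_sub => //; exact: Hinf_cst.
apply: filterS (split_approx HQ0 Q0t) => z EQ0.
have -> : Phi z - Q z = (Phi z - Q0 z) - X z *m (G z *m adjmx (V z)).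
  rewrite -[Q z]/(Q0 z - X z *m ((0 - G z) *m (L z)^T)) -VT sub0r mulNmx mulmxN opprK.
  by rewrite opprD addrA.
rewrite EQ0 -addrA; congr (_ + _); rewrite [X z *m (G z *m _)]mulmxA -mulmxBl -mulmxBr.
by congr (_ *m (_ - _) *m _); rewrite /= mulmxA.
Qed.

Let Lt := li_tr L.

(* L^T F determines F up to [fibre]. Subtracting from F an element of [fibre] turns
   E0 F into a vector orthogonal to [span] plus a term in H^2_- and a small error. *)
Let fibre : set (L2T R n.+1) :=
  [set a | Hp a /\ {ae mu, forall z, (L z)^T *m a z = 0}].

Let span : set (L2T R m.+1) := [set x | exists2 a, fibre a & Hm (x - mulL E0 a)].

Let fibre_sub : subspace fibre.
Proof.
have [p0 pD pZ] := @Hp_sub R n.+1; split.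
- by split=> //; apply: aeW => z; rewrite mulmx0.
- move=> x y [Hx xL] [Hy yL]; split; first exact: pD.
  by apply: filterS2 xL yL => z xL yL; rewrite L2valD mulmxDr xL yL addr0.
- move=> a x [Hx xL]; split; first exact: pZ.
  by apply: filterS xL => z xL; rewrite L2valZ -scalemxAr xL scaler0.
Qed.

Let span_sub : subspace span.
Proof.
have [p0 pD pZ] := fibre_sub; have [m0 mD mZ] := @Hm_sub R m.+1; split.
- by exists 0; [exact: p0|rewrite mulL0 subrr; exact: m0].
- move=> x y [a Fa xa] [b Fb yb]; exists (a + b); first exact: pD.
  rewrite mulLD; move: (mulL E0 a) (mulL E0 b) xa yb => p q xp yq.
  by rewrite opprD addrACA; exact: mD.
- move=> c x [a Fa xa]; exists (c *: a); first exact: pZ.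
  by rewrite mulLZ -scalerBr; exact: mZ.
Qed.

Let span_Hm x : Hm x -> span x.
Proof.
have [p0 _ _] := fibre_sub; move=> Hx; exists 0 => //.
by rewrite mulL0 subr0.
Qed.

(** b is the projection of E0 F onto the complement of [span]. The rest is within e of an element of
    [span], that is of E0 a up to H^2_-, and F - a has the same image under L^T as F. *)
Let decompose F e : Hp F -> 0 < e -> exists F' b s eta,
  [/\ Hp F', {ae mu, forall z, mulL Lt F' z = mulL Lt F z},
      mulL E0 F' = b + eta + s, orth (@ip R m.+1) span b & Hm eta /\ nm s <= e].
Proof.
move=> HF e0; have hp := @ip_psd R m.+1.
have [b Kb ub] := @projection_orth _ _ _ span hp (@ip_complete R m.+1) (mulL E0 F).
have [k [a [Ha aL] ka] sk] := orth_dense hp (@ip_complete R m.+1) span_sub ub e0.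
exists (F - a), b, (mulL E0 F - b - k), (k - mulL E0 a).
have abel (W : zmodType) (u v x y : W) : u - v = x + (y - v) + (u - x - y).
  by rewrite addrACA [x + _]addrC subrK [y - v]addrC addrK.
split; [exact: (subspaceB (@Hp_sub R n.+1) HF Ha)| |by rewrite mulLB; exact: abel|exact: Kb|by split].
by apply: filterS aL => z aL; rewrite !mulLE L2valB mulmxBr -[Lt z]/((L z)^T) aL subr0.
Qed.

(** [span] contains H^2_-, whence analyticity, and every z^(k+1) g: for k + 1 >= 0 because z^(k+1) f
    is in [fibre], otherwise because g is in H^2_-. *)
Let span_orth_annih b : orth (@ip R m.+1) span b -> annih h b.
Proof.
move=> Kb; split.
  rewrite Hp_orth => _ [[k i] k0 <-] /=; apply: Kb; apply: span_Hm; exact: Hm_eb_neg.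
rewrite cjh; apply/ae_dotc0 => k; rewrite zs_zs; apply: Kb.
have [k0|k0] := leP 0 (k + 1); last by apply: span_Hm; apply: Hm_zs => //; exact: ltW.
exists (zs (k + 1) f); last first.
  by rewrite mulL_zs subrr; case: (@Hm_sub R m.+1).
split; first exact: Hp_zs.
by apply: filterS Vf => z Vfz; rewrite zsE -scalemxAr -VT Vfz scaler0.
Qed.

(** X* removes the rank-one term, because X* w = 0. *)
Let red_symbolE : {ae mu, forall z, adjmx (X z) *m E0 z = red_symbol z *m (L z)^T}.
Proof.
apply: filterS3 reduction_unitary_split (split_approx HQ0 Q0t) V_iso => z [sv sw] EQ Vz.
have [XX Xw _] := sw; rewrite -[E0 z]/(Phi z - Q0 z) {1}EQ mulmxDr -scalemxAr !mulmxA Xw.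
by rewrite mul0mx scaler0 add0r XX mul1mx -VT -!mulmxA.
Qed.

(** Up to s, the analytic part of E0 F is b, and b = X beta with beta analytic and |beta| <= |b|. Up
    to <s, b>, |b|^2 is thus the pairing of Psi L^T F with beta, which sees only the analytic part
    of Psi L^T F. *)
Let Pp_E0_le F b eta s : Hp F -> mulL E0 F = b + eta + s ->
  orth (@ip R m.+1) span b -> Hm eta ->
  nm (Pp (mulL E0 F)) <= nm (Pp (mulL red_symbol (mulL Lt F))) + nm s *+ 2.
Proof.
move=> HF EF Kb Heta; have hp := @ip_psd R m.+1; have hc := hp.1.
have Ab := span_orth_annih Kb.
set y := mulL red_symbol (mulL Lt F).
have le_of (x K : R) : (x = 0 -> 0 <= K) -> 0 <= x -> x ^+ 2 <= K * x -> x <= K.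
  move=> K0 x0; have [x1|x1] := eqVneq x 0; first by move=> _; rewrite x1 K0.
  by rewrite expr2 ler_pM2r // lt_def x1.
have n0 k (x : L2T R k) : 0 <= nm x by exact: nrm_ge0.
have leP1 : nm (Pp (mulL E0 F)) <= nm b + nm s.
  apply: le_of => [_||]; [by rewrite addr_ge0|exact: n0|].
  set p := Pp (mulL E0 F).
  have -> : nm p ^+ 2 = Re (ip b p) + Re (ip s p).
    rewrite (nrm_sq hp) /qf /p ip_PpPp {1}EF !(hermD hc) !ReD ((HmP _).1 Heta) ?addr0 //.
    exact: Pp_Hp.
  rewrite mulrDl; apply: lerD; apply: le_trans (ler_norm _) _; exact: Re_form_le.
apply: le_trans leP1 _; rewrite mulr2n addrA lerD2r.
apply: le_of => [_||]; [by rewrite addr_ge0|exact: n0|].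
have bX := annihE h0 Hh cX Ab; set beta := mulL (li_adj X) b in bX.
have Hbeta : Hp beta by have [_ _ _ HX] := cX; exact: HX.
have nbeta : nm beta <= nm b.
  rewrite -[leRHS]mul1r; apply: nm_mulL => //.
  apply: filterS reduction_unitary_split => z [_ sX]; apply: mxopnorm_le => // x.
  by rewrite mul1r; exact: (enorm_adj_split_le _ sX).
have e1 : ip (mulL E0 F) b = ip (Pp y) beta.
  rewrite ip_Pp (hermC hc) (ip_ae _ bX) (hermC hc) conjcK.
  have -> : ip (mulL E0 F) (mulL X beta) = ip (mulL (li_adj X) (mulL E0 F)) beta.
    by rewrite [RHS]ip_mulL; congr (ip _ _); apply: L2T_ext => z; rewrite !mulLE /= adjmxK.
  have -> : ip (mulL (li_adj X) (mulL E0 F)) beta = ip y beta.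
    apply: ip_ae; apply: filterS red_symbolE => z e.
    by rewrite /y !mulLE -[li_adj X z]/(adjmx (X z)) !mulmxA e.
  rewrite (hermC (@ip_herm R m)) -(ip_ae _ (Pp_id Hbeta)).
  by rewrite (hermC (@ip_herm R m)) conjcK.
have -> : nm b ^+ 2 = Re (ip (Pp y) beta) - Re (ip s b).
  rewrite -e1 EF (nrm_sq hp) /qf !(hermD hc) !ReD.
  have -> : ip eta b = 0 by rewrite (hermC hc) Kb ?rmorph0 //; exact: span_Hm.
  by rewrite addr0 addrK.
rewrite mulrDl; apply: lerD.
  apply: le_trans (ler_norm _) (le_trans (Re_form_le (@ip_psd R m) _ _) _).
  by rewrite -!/(nm _) ler_wpM2l.
have -> : nm s = nm (- s) by rewrite /nm (nrmN hp).
by rewrite -ReN -(hermNl hc); apply: le_trans (ler_norm _) _; exact: Re_form_le.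
Qed.

(* The pointwise unitary completions split both |F|^2 and |E0 F|^2. *)
Let energy F (psi := mulL Lt F) :
  nm (mulL E0 F) ^+ 2 = t ^+ 2 * (nm F ^+ 2 - nm psi ^+ 2) + nm (mulL red_symbol psi) ^+ 2.
Proof.
set y := mulL red_symbol psi.
suff E : ip (mulL E0 F) (mulL E0 F)
    = (t ^+ 2)%:C * ip F F + (- t ^+ 2)%:C * ip psi psi + ip y y.
  rewrite !(nrm_sq (@ip_psd R _)) /qf E !ReD !Re_scale mulrBr mulNr.
  by [].
have i k (x : L2T R k) := cintble_dotc x x.
rewrite !ipE.
transitivity (cintegral (fun z => (t ^+ 2)%:C * dotc (F z) (F z)
    + (- t ^+ 2)%:C * dotc (psi z) (psi z) + dotc (y z) (y z))); last first.
  rewrite cintD; [|by apply: cintbleD; apply: cintbleZ; exact: i|exact: i].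
  by rewrite cintD; [|by apply: cintbleZ; exact: i..]; rewrite !cintZ //; exact: i.
apply: cint_ae; first exact: cintble_cmeas (i _ _).
  apply: cmeasD; last exact: cintble_cmeas (i _ _).
  by apply: cmeasD; apply: cmeasM; try exact: cmeas_cst; exact: cintble_cmeas (i _ _).
apply: filterS2 reduction_unitary_split (split_approx HQ0 Q0t) => z [sv sw] EQ.
rewrite !dotcxx -!rmorphM -!rmorphD; congr (_%:C).
have -> : enorm (mulL E0 F z) ^+ 2 = enorm ((Phi z - Q0 z) *m F z) ^+ 2 by [].
rewrite {1}EQ (split_enorm _ _ sw _ (ltW t0)).
have -> : enorm (F z) ^+ 2 = normc (dotc (F z) (red_v z)) ^+ 2 + enorm (psi z) ^+ 2.
  by rewrite (enorm_split (F z) sv) VT.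
rewrite /y mulLE -[psi z]/((L z)^T *m F z) -VT.
have -> : red_symbol z = adjmx (X z) *m (Phi z - Q0 z) *m V z by rewrite -mulmxA.
ring.
Qed.

(** Each psi i is approximated by some L^T F i, then F i is replaced by the F' i of [decompose]. The
    coefficients x that the hypothesis on Phi provides for F' also serve psi, by [energy] and
    [Pp_E0_le]. *)
Lemma hankel_dim_reduction c N : hankel_dim Phi c N -> hankel_dim red_symbol c N.
Proof.
move=> [c0 D]; split=> // psi Hpsi e e0.
have n0 k (x : L2T R k) : 0 <= nm x by exact: nrm_ge0.
have redle y : nm (mulL red_symbol y) <= t * nm y by apply: nm_mulL; [exact: ltW|exact: red_symbol_le].
(* For c > t^2 the pointwise bound t on Psi gives the estimate for any unit x. *)
have [ct|tc] := leP c (t ^+ 2); last first.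
  exists (fun i => (i == ord0)%:R).
    rewrite (bigD1 ord0) // eqxx normc1 expr1n big1; first exact: addr0.
    by move=> i /negbTE ->; rewrite normc0 expr0n.
  set y := \sum_i _; have yl : nm (Pm (mulL red_symbol y)) <= t * nm y by exact: le_trans (nm_Pm _) (redle y).
  apply: le_trans (_ : (t * nm y) ^+ 2 <= _); first by rewrite lerXn2r ?nnegrE ?mulr_ge0 // ltW.
  by rewrite exprMn; apply: ler_wpDr; [exact: ltW|rewrite ler_wpM2r ?sqr_ge0 // ltW].
(* B bounds every combination with coefficients of modulus at most 1. K is the constant of
   [transfer_arith]; the total error d will be shared equally by the N + 1 vectors. *)
pose B := \sum_i nm (psi i).
have B0 : 0 <= B by apply: sumr_ge0.
pose K := 4%:R * t * (B + 1) + 4%:R + 2%:R * t ^+ 2 * (B + 1) + t ^+ 2 + c * (2%:R * B + 1).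
have K0 : 0 <= K by rewrite /K !addr_ge0 // !mulr_ge0 ?addr_ge0 ?sqr_ge0 ?mulr_ge0 // ltW.
pose d := Num.min 1 (e / 2%:R / (K + 1)).
have d0 : 0 < d by rewrite lt_min ltr01 !divr_gt0 // ltr_wpDl.
have dK : d * K <= e / 2%:R.
  apply: le_trans (_ : e / 2%:R / (K + 1) * K <= _).
    by rewrite ler_wpM2r // ge_min lexx orbT.
  rewrite mulrAC ler_pdivrMr ?ltr_wpDl // ler_wpM2l ?lerDl //.
  by rewrite divr_ge0 // ltW.
pose r := d / N.+1%:R.
have r0 : 0 < r by rewrite divr_gt0 // ltr0n.
have /choice[F FP] : forall i, exists F, Hp F /\ nm (psi i - mulL Lt F) <= r.
  by move=> i; have [F HF lF] := coinner_tr_dense f0 Hf cL (Hpsi i) r0; exists F.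
have /choice[F' F'P] : forall i, exists F', exists b s eta,
    [/\ Hp F', {ae mu, forall z, mulL Lt F' z = mulL Lt (F i) z},
      mulL E0 F' = b + eta + s, orth (@ip R m.+1) span b & Hm eta /\ nm s <= r].
  by move=> i; have := decompose (FP i).1 r0.
have /choice[b bP] := F'P; have /choice[s sP] := bP; have /choice[eta etaP] := sP.
have HF' i : Hp (F' i) by case: (etaP i).
have [x x1 xP] := D F' HF' _ (divr_gt0 e0 (ltr0Sn R 1)).
exists x => //.
have nx i : normc (x i) <= 1.
  rewrite -(@ler_pXn2r _ 2) ?nnegrE ?normc_ge0 // expr1n -x1 (bigD1 i) //= lerDl.
  by apply: sumr_ge0 => j _; exact: sqr_ge0.
have small k (y : 'I_N.+1 -> L2T R k) : (forall i, nm (y i) <= r) -> nm (\sum_i x i *: y i) <= d.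
  move=> yr; apply: le_trans (nrm_sum (@ip_psd R k) _ _ _) _.
  apply: le_trans (_ : \sum_(i < N.+1) r <= _).
    apply: ler_sum => i _; rewrite (nrmZ (@ip_psd R k)) -[leRHS]mul1r.
    by apply: ler_pM => //; [exact: normc_ge0|exact: nrm_ge0|exact: yr].
  by rewrite sumr_const card_ord -[X in X <= _]mulr_natr divfK ?pnatr_eq0.
set psx := \sum_i _; pose SF := \sum_i x i *: F' i; pose psy := mulL Lt SF.
have HSF : Hp SF.
  apply: subspace_sum => [|i _]; first exact: Hp_sub.
  by case: (@Hp_sub R n.+1) => _ _; apply; exact: HF'.
have sE : mulL E0 SF = \sum_i x i *: b i + \sum_i x i *: eta i + \sum_i x i *: s i.
  rewrite mulL_sum -!big_split /=; apply: eq_bigr => i _.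
  by rewrite mulLZ; case: (etaP i) => _ _ -> _ _; rewrite !scalerDr.
have Pb : orth (@ip R m.+1) span (\sum_i x i *: b i).
  apply: subspace_sum => [|i _]; first exact: (orth_subspace _ (@ip_herm R m.+1)).
  have [_ _ OZ] := orth_subspace span (@ip_herm R m.+1).
  by apply: OZ; case: (etaP i).
have Peta : Hm (\sum_i x i *: eta i).
  apply: subspace_sum => [|i _]; first exact: Hm_sub.
  by case: (@Hm_sub R m.+1) => _ _; apply; case: (etaP i) => _ _ _ _ [].
have ns : nm (\sum_i x i *: s i) <= d by apply: small => i; case: (etaP i) => _ _ _ _ [].
have npsi : nm (psx - psy) <= d.
  have -> : nm (psx - psy) = nm (\sum_i x i *: (psi i - mulL Lt (F i))).
    apply: nm_ae.
    have : {ae mu, forall z, forall i, mulL Lt (F' i) z = mulL Lt (F i) z}.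
      by apply: filter_forall => i; case: (etaP i).
    apply: filterS => z e1.
    rewrite L2valB /psx /psy mulL_sum !L2val_sum -sumrB; apply: eq_bigr => i _.
    by rewrite mulLZ !L2valZ L2valB -scalerBr e1.
  by apply: small => i; case: (FP i).
have LtM : {ae mu, forall z, mxopnorm (Lt z) <= 1}.
  apply: filterS reduction_unitary_split => z [sv _]; apply: mxopnorm_le => // y.
  by rewrite mul1r -[Lt z]/((L z)^T) -VT; exact: (enorm_adj_split_le _ sv).
apply: (@transfer_arith R t c e d B (nm (Pm (mulL red_symbol psx)))
   (nm (Pm (mulL red_symbol psy))) (nm (Pp (mulL red_symbol psy))) (nm psx) (nm psy) (nm SF)) => //.
- exact: ltW.
- exact: ltW.
- by rewrite ge_min lexx.
- exact: le_trans (nm_Pp _) (redle _).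
- exact: le_trans (nm_Pm _) (redle _).
- apply: le_trans (nrm_sum (@ip_psd R n) _ _ _) _; apply: ler_sum => i _.
  by rewrite (nrmZ (@ip_psd R n)) -[leRHS]mul1r ler_wpM2r ?nrm_ge0.
- have -> : psy = psx - (psx - psy) by rewrite subKr.
  by apply: le_trans (nrmB (@ip_psd R n) _ _) _; rewrite lerD2l.
- by rewrite -[leRHS]mul1r; exact: nm_mulL.
- have := nm_PmB (mulL red_symbol psx) (mulL red_symbol psy).
  rewrite -mulLB => l; rewrite -lerBlDl.
  apply: le_trans (ler_norm _) (le_trans (nrm_dist (@ip_psd R m) _ _) _).
  apply: le_trans l _; apply: le_trans (redle _) _.
  by rewrite ler_wpM2l // ltW.
- have nsp k (y : L2T R k) : nm y ^+ 2 = nm (Pp y) ^+ 2 + nm (Pm y) ^+ 2.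
    by rewrite !(nrm_sq (@ip_psd R k)) qf_PpPm.
  have en : nm (mulL E0 SF) ^+ 2 = t ^+ 2 * (nm SF ^+ 2 - nm psy ^+ 2)
    + nm (mulL red_symbol psy) ^+ 2 := energy SF.
  rewrite (nsp _ (mulL E0 SF)) (nsp _ (mulL red_symbol psy)) (nm_Pm_sub Phi HQ0 HSF) in en.
  have lP : nm (Pp (mulL E0 SF)) ^+ 2 <= (nm (Pp (mulL red_symbol psy)) + d *+ 2) ^+ 2.
    rewrite lerXn2r ?nnegrE ?addr_ge0 ?mulrn_wge0 ?(ltW d0) //.
    apply: le_trans (Pp_E0_le HSF sE Pb Peta) _.
    by rewrite lerD2l lerMn2r ns.
  move: xP en lP; rewrite -/SF.
  move: (nm (Pm (mulL Phi SF)) ^+ 2) (c * nm SF ^+ 2) => a1 a2.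
  move: (nm (Pp (mulL E0 SF)) ^+ 2) ((_ + _ *+ 2) ^+ 2) => a3 a4.
  move: (t ^+ 2 * _) => a5; lra.
Qed.

End Reduction.

(** * The essential norm *)

Section EssentialNorm.
Variable R : realType.
Local Notation C := R[i].
Local Notation T := (circle R).
Local Notation mu := (circle_measure R).

(** [Pm] shows that the choice made by [xget] has a candidate, and two candidates differ by a null
    vector. *)
Lemma hankelE m n (Phi : LinfT R m n) (f : L2T R n) :
  H2minus (hankel Phi f) /\ {ae mu, forall z, hankel Phi f z = Pm (mulL Phi f) z}.
Proof.
set F := mulL Phi f.
have ex : exists g : vfunT R m, H2minus g /\ forall h, H2minus h -> inner (fun z => F z - g z) h = 0.
  exists (Pm F); split; first exact: (Pm_Hm F).
  move=> h Hh; have := ip_inner (F - Pm F) (mkL2 Hh.1) => /= <-.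
  by rewrite (_ : F - Pm F = Pp F) ?ip_HpHm //; [exact: Pp_Hp|rewrite PmE subKr].
have [Hh hP] : H2minus (hankel Phi f) /\ forall h, H2minus h ->
    inner (fun z => F z - hankel Phi f z) h = 0.
  by rewrite /hankel /orthproj; case: xgetP => [y -> //|/(_ _)]; case: ex => g gP /(_ g).
split=> //; pose k : L2T R m := mkL2 Hh.1.
suff : {ae mu, forall z, k z = Pm F z} by [].
apply/ae_eq_nm; set d := k - Pm F; have h := @ip_herm R m.
have Hd : Hm d by apply: (subspaceB (@Hm_sub R m)) => //; exact: Pm_Hm.
apply: (@qf_nrm0 _ _ _ _); rewrite /qf.
have -> : ip d d = ip (Pp F - (F - k)) d.
  by congr (ip _ _); rewrite /d PmE !opprB addrCA.
rewrite (hermBl h).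
have -> : ip (F - k) d = 0 by rewrite ip_inner; exact: (hP d Hd).
by rewrite subr0 ip_HpHm //; exact: Pp_Hp.
Qed.

(** * Compact operators on finite families of vectors *)

Section CompactOperator.
Variables (m n : nat) (K : vfunT R n -> vfunT R m).
Hypothesis cK : is_compact K.

Let KT : exists KT : L2T R n -> L2T R m, forall f, Hp f -> Hm (KT f) /\ forall z, KT f z = K f z.
Proof.
have [[KH _ _] _] := cK.
have /choice[KT KTP] : forall f : L2T R n, exists g : L2T R m, Hp f -> Hm g /\ forall z, g z = K f z.
  move=> f; case: (pselect (Hp f)) => Hf; last by exists (0 : L2T R m) => Hf'; case: (Hf Hf').
  by exists (mkL2 (KH f Hf).1) => _; split; [exact: KH|].
by exists KT.
Qed.

(** Transports K to [L2T], where norms and inner products are available; outside H^2 its values are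
    arbitrary. *)
Definition compact_lift : L2T R n -> L2T R m := sval (cid KT).
Local Notation k := compact_lift.

Lemma compact_liftE f : Hp f -> Hm (k f) /\ forall z, k f z = K f z.
Proof. exact: (svalP (cid KT)). Qed.

Lemma compact_lift_lin a f g : Hp f -> Hp g -> {ae mu, forall z, k (a *: f + g) z = (a *: k f + k g) z}.
Proof.
move=> Hf Hg; have [_ HD HZ] := @Hp_sub R n.
have Hfg : Hp (a *: f + g) by apply: HD => //; exact: HZ.
have [[_ _ Klin] _] := cK; have := Klin a f g Hf Hg; apply: filterS => z e.
have [_ kfg] := compact_liftE Hfg; have [_ kf] := compact_liftE Hf; have [_ kg] := compact_liftE Hg.
by rewrite kfg L2valD L2valZ kf kg -e.
Qed.

Lemma compact_lift_null f : Hp f -> nm f = 0 -> nm (k f) = 0.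
Proof.
move=> Hf f0; have [H0 _ _] := @Hp_sub R n.
have := compact_lift_lin (-1) H0 H0; rewrite scaleN1r oppr0 add0r => k0.
have [[_ Kae _] _] := cK; have := Kae f (0 : L2T R n) Hf H0 ((nm_eq0 f).1 f0).
have [_ kf] := compact_liftE Hf; have [_ k0E] := compact_liftE H0.
move=> e; apply/nm_eq0; apply: filterS2 e k0 => z e.
by rewrite kf e -k0E L2valD L2valZ scaleN1r addNr.
Qed.

Lemma compact_liftZ a f : Hp f -> {ae mu, forall z, k (a *: f) z = (a *: k f) z}.
Proof.
move=> Hf; have [H0 _ _] := @Hp_sub R n.
have := compact_lift_null H0 (nrm0 (@ip_psd R n)) => /nm_eq0 k0.
have := compact_lift_lin a Hf H0; rewrite addr0; apply: filterS2 k0 => z k0 ->.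
by rewrite L2valD k0 addr0.
Qed.

Lemma compact_lift_sum N (F : 'I_N -> L2T R n) (x : 'I_N -> C) : (forall i, Hp (F i)) ->
  {ae mu, forall z, k (\sum_i x i *: F i) z = (\sum_i x i *: k (F i)) z}.
Proof.
have [H0 _ HZ] := @Hp_sub R n.
elim: N F x => [|N IH] F x HF.
  rewrite !big_ord0; exact/nm_eq0/(compact_lift_null H0)/(nrm0 (@ip_psd R n)).
rewrite !big_ord_recl.
have HS : Hp (\sum_i x (lift ord0 i) *: F (lift ord0 i)).
  by apply: subspace_sum => [|i _]; [exact: Hp_sub|apply: HZ; exact: HF].
have := compact_lift_lin (x ord0) (HF ord0) HS.
have := IH (fun i => F (lift ord0 i)) (fun i => x (lift ord0 i)) (fun i => HF _).
apply: filterS2 => z e ->.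
by rewrite !L2valD e.
Qed.

(** There are N + 1 unknowns for N equations. *)
Lemma kernel_vector N (A : 'M[C]_(N.+1, N)) :
  exists2 x : 'I_N.+1 -> C, \sum_i normc (x i) ^+ 2 = 1 &
    forall j, \sum_i x i * A i j = 0.
Proof.
have : kermx A != 0.
  rewrite -mxrank_eq0 mxrank_ker subn_eq0 -ltnNge ltnS.
  exact: rank_leq_col.
move=> /rowV0Pn[v /sub_kermxP vA v0].
have e0 : 0 < enorm v^T by rewrite enorm_gt0 // trmx_eq0.
exists (fun i => ((enorm v^T)^-1)%:C * v ord0 i).
  under eq_bigr => i _ do rewrite normcM exprMn normc_real.
  rewrite -mulr_sumr real_normK ?num_real // exprVn.
  have -> : \sum_i normc (v ord0 i) ^+ 2 = enorm v^T ^+ 2.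
    by rewrite enorm_sqE; apply: eq_bigr => i _; rewrite mxE.
  by rewrite mulVf // expf_neq0 // gt_eqF.
move=> j; under eq_bigr => i _ do rewrite -mulrA.
rewrite -mulr_sumr; have := congr1 (fun B : 'rV_N => B ord0 j) vA.
by rewrite !mxE => ->; rewrite mulr0.
Qed.

(* Otherwise one builds unit vectors whose images are mutually orthogonal and
   of norm at least d. *)
Lemma compact_small_family (d : R) : 0 < d -> exists N, forall F : 'I_N.+1 -> L2T R n,
  (forall i, Hp (F i)) -> exists2 x : 'I_N.+1 -> C, \sum_i normc (x i) ^+ 2 = 1 &
    nm (k (\sum_i x i *: F i)) <= d * nm (\sum_i x i *: F i).
Proof.
move=> d0; apply: contrapT => Hno; have h := @ip_psd R m.
have [_ _ HZ] := @Hp_sub R n.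
have step (s : seq (L2T R n)) : exists y, [/\ Hp y, nm y <= 1, d <= nm (k y) &
    forall i, (i < size s)%N -> ip (k y) (k (nth 0 s i)) = 0].
  pose N := size s.
  have [F [HF Fx]] : exists F : 'I_N.+1 -> L2T R n, (forall i, Hp (F i)) /\
     forall x, \sum_i normc (x i) ^+ 2 = 1 ->
       d * nm (\sum_i x i *: F i) < nm (k (\sum_i x i *: F i)).
    apply: contrapT => H; apply: Hno; exists N => F HF; apply: contrapT => H'.
    apply: H; exists F; split=> // x x1; rewrite ltNge; apply/negP => l.
    by apply: H'; exists x.
  (* Coefficients for which the image is orthogonal to the images of all vectors found so far; the
     failure of the claim makes that image large. *)
  have [x x1 xA] := kernel_vector (\matrix_(i < N.+1, j < N) ip (k (F i)) (k (nth 0 s j))).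
  have yl := Fx x x1; set y := \sum_i _ in yl.
  have Hy : Hp y by apply: subspace_sum => [|i _]; [exact: Hp_sub|apply: HZ; exact: HF].
  have y0 : nm y != 0.
    by apply: contraTneq yl => y0; rewrite y0 (compact_lift_null Hy y0) mulr0 ltxx.
  have yp : 0 < nm y by rewrite lt_def y0 nrm_ge0.
  have ny a : normc (((nm y)^-1)%:C : C) * a = (nm y)^-1 * a.
    by rewrite normc_real ger0_norm // invr_ge0 ltW.
  have kz := compact_liftZ ((nm y)^-1)%:C Hy.
  exists (((nm y)^-1)%:C *: y); split; first exact: HZ.
  - by rewrite /nm (nrmZ (@ip_psd R n)) ny mulVf.
  - rewrite (nm_ae kz) /nm (nrmZ h) ny mulrC ler_pdivlMr //; exact: ltW.
  - move=> i iN; rewrite (ip_ae _ kz) (hermZ h.1) (ip_ae _ (compact_lift_sum x HF)).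
    have := xA (Ordinal iN); under eq_bigr => j _ do rewrite mxE.
    rewrite (herm_suml h.1) /= => e; rewrite -[X in _ * X]/(_).
    under eq_bigr => j _ do rewrite (hermZ h.1).
    by rewrite e mulr0.
have [y yP] := choice step.
(* Each vector depends on all earlier ones, hence a recursion on lists. *)
pose l := fix l j := if j is j'.+1 then rcons (l j') (y (l j')) else [::].
pose u j := y (l j).
have sl j : size (l j) = j by elim: j => //= j IH; rewrite size_rcons IH.
have nl i j : (i < j)%N -> nth 0 (l j) i = u i.
  elim: j => //= j IH; rewrite ltnS leq_eqVlt nth_rcons sl => /orP[/eqP ->|ij].
    by rewrite ltnn eqxx.
  by rewrite ij IH.
have uu i j : (i < j)%N -> ip (k (u j)) (k (u i)) = 0.
  by move=> ij; have [_ _ _ H] := yP (l j); rewrite -(nl i j ij) H // sl.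
have Hu j : Hp (u j) by case: (yP (l j)).
have [_ /(_ (fun j => u j) Hu)] := cK.
move=> [|phi [phim [g Hg cg]]].
  by exists 1 => j; rewrite norm2_nm lee_fin; case: (yP (l j)).
pose G : L2T R m := mkL2 Hg.1.
have e0 : 0 < d / 2%:R by rewrite divr_gt0.
have cg' : (fun j => nm (k (u (phi j)) - G)) @ \oo --> (0 : R).
  have E : (fun j => norm2 (fun z => K (u (phi j)) z - g z)) = (fun j => (nm (k (u (phi j)) - G))%:E).
    apply/funext => j; rewrite -norm2_nm; congr norm2; apply/funext => z.
    by have [_ kE] := compact_liftE (Hu (phi j)); rewrite L2valB kE.
  by have := cg; rewrite E => /fine_cvg.
have /cvgrPdist_le/(_ _ e0)[N _ HN] := cg'.
have small j : (N <= j)%N -> nm (k (u (phi j)) - G) <= d / 2%:R.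
  by move=> /HN /=; rewrite sub0r normrN ger0_norm ?nrm_ge0.
pose a := k (u (phi N)); pose b := k (u (phi N.+1)).
have ab : nm (b - a) <= d.
  rewrite (_ : b - a = (b - G) - (a - G)); last by rewrite opprB addrA subrK.
  apply: le_trans (nrmB h _ _) _; rewrite (splitr d); apply: lerD; exact: small.
(* By orthogonality the two images are at least sqrt(2) d apart, whereas convergence puts them
   within d. *)
have : d ^+ 2 + d ^+ 2 <= nm (b - a) ^+ 2.
  rewrite (nrm_sq h) (qfB h.1) (uu (phi N) (phi N.+1)) ?phim // mul0rn subr0 -!(nrm_sq h).
  have dk j : d ^+ 2 <= nm (k (u j)) ^+ 2.
    by rewrite lerXn2r ?nnegrE ?nrm_ge0 ?(ltW d0) //; case: (yP (l j)).
  by apply: lerD; exact: dk.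
apply/negP; rewrite -ltNge; apply: le_lt_trans (_ : d ^+ 2 < _).
  by rewrite lerXn2r ?nnegrE ?nrm_ge0 ?(ltW d0).
by rewrite ltrDl exprn_gt0.
Qed.

End CompactOperator.

Lemma PmZ_ae n (a : C) (x : L2T R n) : {ae mu, forall z, Pm (a *: x) z = (a *: Pm x) z}.
Proof.
have h := @ip_herm R n; apply/ae_eq_nm; set d := _ - _.
apply: (@qf_nrm0 _ _ _ _); rewrite /qf.
have -> : ip d d = ip (Pm (a *: x) - a *: Pm x) d by [].
by rewrite (hermBl h) (hermZ h) !ip_Pm (hermZ h) subrr.
Qed.

(** Take a compact K with |H_Phi - K| = r < t. By [compact_small_family] any N + 1 vectors have a
    combination y with |K y| <= d |y|; with d half of the gap t - r, c = (r + d)^2 is still below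
    t^2. *)
Lemma essnorm_hankel_dim m n (Phi : LinfT R m n) (t : R) :
  (essnorm (hankel Phi) < t%:E)%E -> exists c N, c < t ^+ 2 /\ hankel_dim Phi c N.
Proof.
move=> /ereal_inf_lt [_ [K cK <-] Kt].
have h := @ip_psd R m; have hn := @ip_psd R n; pose k := compact_lift cK.
have [H0 _ HZ] := @Hp_sub R n.
have ok f : Hp f -> nm f <= 1 ->
    ((nm (Pm (mulL Phi f) - k f))%:E <= opnorm (fun f z => (hankel Phi f z - K f z)%R))%E.
  move=> Hf f1; apply: ereal_sup_ubound.
  exists f; first by split; [exact: Hf|rewrite norm2_nm lee_fin].
  have [Hh hP] := hankelE Phi f; have [Hk kf] := compact_liftE cK Hf.
  pose H : L2T R m := mkL2 Hh.1.
  transitivity (norm2 (H - k f)).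
    by congr norm2; apply/funext => z; rewrite L2valB kf.
  rewrite norm2_nm; congr EFin; apply: nm_ae; apply: filterS hP => z e.
  by rewrite !L2valB -e.
move: (opnorm _) Kt ok => [r|//|_ ok]; last by have := ok _ H0; rewrite /nm (nrm0 hn) => /(_ ler01).
rewrite lte_fin => rt ok.
have r0 : 0 <= r.
  have := ok _ H0; rewrite /nm (nrm0 hn) => /(_ ler01); rewrite lee_fin.
  by apply: le_trans; exact: nrm_ge0.
have {}ok f : Hp f -> nm (Pm (mulL Phi f) - k f) <= r * nm f.
  move=> Hf; have [f0|f0] := eqVneq (nm f) 0.
    have [M M0 PM] := LinfT_bound Phi.
    rewrite f0 mulr0; apply: le_trans (nrmB h _ _) _.
    rewrite -!/(nm _) (compact_lift_null cK Hf f0) addr0.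
    by apply: le_trans (nm_Pm _) (le_trans (nm_mulL _ M0 PM) _); rewrite f0 mulr0.
  have fp : 0 < nm f by rewrite lt_def f0 nrm_ge0.
  have ny a : normc (((nm f)^-1)%:C : C) * a = (nm f)^-1 * a.
    by rewrite normc_real ger0_norm // invr_ge0 ltW.
  have := ok _ (HZ ((nm f)^-1)%:C _ Hf); rewrite {1}/nm (nrmZ hn) ny -/(nm f) mulVf // => /(_ (lexx _)).
  rewrite lee_fin.
  have -> : nm (Pm (mulL Phi (((nm f)^-1)%:C *: f)) - k (((nm f)^-1)%:C *: f))
     = nm (((nm f)^-1)%:C *: (Pm (mulL Phi f) - k f)).
    apply: nm_ae; apply: filterS2 (PmZ_ae ((nm f)^-1)%:C (mulL Phi f)) (compact_liftZ cK ((nm f)^-1)%:C Hf).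
    by move=> z e1 e2; rewrite mulLZ L2valB e1 e2 !L2valZ L2valB scalerBr.
  by rewrite {1}/nm (nrmZ h) ny mulrC ler_pdivrMr.
pose d := (t - r) / 2%:R; have d0 : 0 < d by rewrite divr_gt0 // subr_gt0.
have [N NP] := compact_small_family cK d0.
exists ((r + d) ^+ 2), N; split.
  have t0 : 0 <= t by apply: le_trans r0 (ltW rt).
  by rewrite ltr_pXn2r ?nnegrE ?addr_ge0 ?(ltW d0) // /d; lra.
split=> [|F HF e e0]; first exact: sqr_ge0.
have [x x1 xk] := NP F HF; exists x => //; set y := \sum_i _ in xk *.
have Hy : Hp y by apply: subspace_sum => [|i _]; [exact: Hp_sub|apply: HZ; exact: HF].
apply: ler_wpDr; first exact: ltW.
rewrite -exprMn lerXn2r ?nnegrE ?mulr_ge0 ?addr_ge0 ?nrm_ge0 ?(ltW d0) //.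
rewrite -[Pm (mulL Phi y)](subrK (k y)); apply: le_trans (nrmD h _ _) _.
by rewrite mulrDl; apply: lerD; [exact: ok|exact: xk].
Qed.

End EssentialNorm.

(** * Superoptimal approximation *)

Section Superoptimal.
Variable R : realType.
Local Notation C := R[i].
Local Notation T := (circle R).
Local Notation mu := (circle_measure R).

Lemma normoo_le m n (F : mfunT R m n) (c : R) :
  (normoo F <= c%:E)%E <-> {ae mu, forall z, mxopnorm (F z) <= c}.
Proof.
split=> [/ess_supP|H]; last by apply/ess_supP; apply: filterS H => z; rewrite lee_fin.
by apply: filterS => z; rewrite lee_fin.
Qed.

Lemma sup_sing0 m n (F : mfunT R m n) : sup_sing 0 F = normoo F.
Proof. by apply: eq_ess_sup; apply: aeW => z; rewrite mxsing0. Qed.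

Lemma sup_sing_ge0 m n j (F : mfunT R m n) : (0 <= sup_sing j F)%E.
Proof.
have mu0 : (0 < mu setT)%E by rewrite probability_setT lte01.
by apply: (ess_sup_gee mu0); apply: aeW => z; rewrite lee_fin mxsing_ge0.
Qed.

Lemma sup_sing_ae m n p q j l (F : mfunT R m n) (G : mfunT R p q) :
  {ae mu, forall z, mxsing j (F z) = mxsing l (G z)} -> sup_sing j F = sup_sing l G.
Proof. by move=> FG; apply: eq_ess_sup; apply: filterS FG => z ->. Qed.

Lemma Omega_sub m n (Phi : mfunT R m n) j Q : Omega Phi j Q -> Omega Phi 0 Q.
Proof. by elim: j => [|j IH]; [|case=> /IH]. Qed.

Lemma Omega_Hinf m n (Phi : mfunT R m n) j Q : Omega Phi j Q -> Hinf Q.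
Proof. by move=> /Omega_sub[]. Qed.

(** * Best approximations and the norm of the Hankel operator *)

Section Nearest.
Variables (m n : nat) (Phi : LinfT R m n.+1) (t : R).
Hypotheses (t0 : 0 <= t) (Ht : hankel_le Phi t).
Hypothesis Hmax :
  forall e, 0 < e -> exists2 a, qf (@ip R n.+1) a = 1 & t ^+ 2 - e <= qf (hform Phi) a.

(** An error r < t would bound the Hankel form by r^2, below its supremum t^2. *)
Lemma hankel_norm_le (Q : LinfT R m n.+1) : Hinf Q -> (t%:E <= normoo (fun z => (Phi z - Q z)%R))%E.
Proof.
move=> HQ; rewrite leNgt; apply/negP => lt_t.
have [r [r0 rt Qr]] : exists r : R, [/\ 0 <= r, r < t & {ae mu, forall z, mxopnorm (Phi z - Q z) <= r}].
  have := sup_sing_ge0 0 (fun z => (Phi z - Q z)%R); rewrite sup_sing0.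
  case E : (normoo _) lt_t => [r| |] //; rewrite lte_fin lee_fin => rt r0.
  by exists r; split=> //; apply/normoo_le; rewrite E.
have Hr := hankel_le_approx r0 HQ Qr.
have d0 : 0 < (t ^+ 2 - r ^+ 2) / 2%:R.
  by rewrite divr_gt0 // subr_gt0 ltr_pXn2r ?nnegrE.
have [a a1 la] := Hmax d0; have := Hr a; rewrite a1 mulr1 => lr.
by have := le_trans la lr; move: d0; move: (t ^+ 2) (r ^+ 2) => u v; lra.
Qed.

Lemma Omega0P (Q : LinfT R m n.+1) :
  Omega Phi 0 Q <-> Hinf Q /\ {ae mu, forall z, mxopnorm (Phi z - Q z) <= t}.
Proof.
have [Q0 [HQ0 Q0t]] := nehari t0 (hankel_le_hpos t0 Ht).
split=> [[HQ Qmin]|[HQ Qt]]; split; try exact: HQ.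
  by apply/normoo_le; apply: le_trans (Qmin Q0 HQ0) _; apply/normoo_le.
move=> P HP; apply: le_trans (_ : t%:E <= _)%E; first exact/normoo_le.
exact: (@hankel_norm_le (MkLinfT HP.1)).
Qed.

Lemma superopt_value0 : superopt_value Phi 0 t%:E.
Proof.
have [Q0 [HQ0 Q0t]] := nehari t0 (hankel_le_hpos t0 Ht).
exists Q0; first exact/Omega0P.
by rewrite sup_sing0; apply/eqP; rewrite eq_le hankel_norm_le //=; exact/normoo_le.
Qed.

End Nearest.

Definition superopt_thm m n (Phi : mfunT R m n) : Prop :=
  exists Q, [/\ superoptimal Phi Q,
      forall Q', superoptimal Phi Q' -> {ae mu, forall z, Q' z = Q z} &
      forall j, (j < minn m n)%N ->
        exists c : R, {ae mu, forall z, mxsing j (Phi z - Q z) = c}].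

(** Every best approximation equals Phi almost everywhere, so the later minimizations compare equal
    values. *)
Lemma superopt_thm_analytic m n (Phi : LinfT R m n.+1) : hankel_le Phi 0 ->
  (forall e, 0 < e -> exists2 a, qf (@ip R n.+1) a = 1 & 0 ^+ 2 - e <= qf (hform Phi) a) ->
  superopt_thm Phi.
Proof.
move=> H0 Hmax; have O0 := Omega0P (lexx 0) H0 Hmax.
have [Q0 [HQ0 Q0t]] := nehari (lexx 0) (hankel_le_hpos (lexx 0) H0).
have O0eq (Q : mfunT R m n.+1) : Omega Phi 0 Q -> {ae mu, forall z, Phi z - Q z = 0}.
  move=> OQ; have [_ Qt] := (O0 (MkLinfT (Omega_Hinf OQ).1)).1 OQ.
  apply: filterS Qt => z Qt; apply: mxopnorm_eq0.
  by apply/le_anti; rewrite Qt mxopnorm_ge0.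
have OQ0 : Omega Phi 0 Q0 by exact/O0.
have OQ j : Omega Phi j Q0.
  elim: j => [|j IH]; first exact: OQ0.
  split; first exact: IH.
  move=> P /Omega_sub OP; rewrite le_eqVlt; apply/orP; left; apply/eqP.
  apply: sup_sing_ae; apply: filterS2 (O0eq _ OP) (O0eq _ OQ0) => z -> ->.
  by [].
exists Q0; split=> [|Q' OQ'|j _]; first exact: OQ.
  apply: filterS2 (O0eq _ (Omega_sub OQ')) (O0eq _ OQ0) => z e e0.
  by rewrite -[Q' z](subKr (Phi z)) e subr0 -[Q0 z](subKr (Phi z)) e0 subr0.
exists 0; apply: filterS (O0eq _ OQ0) => z ->.
apply/le_anti; rewrite mxsing_ge0 andbT.
by apply: le_trans (mxsing_le_opnorm _ _) _; rewrite mxopnorm0.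
Qed.

(** Collects what the induction uses; from here on [V] and [X] matter only as pointwise
    isometries. *)
Lemma reduction m n (Phi : LinfT R m.+1 n.+1) (t c : R) N :
  0 < t -> hankel_le Phi t ->
  (forall e, 0 < e -> exists2 a, qf (@ip R n.+1) a = 1 & t ^+ 2 - e <= qf (hform Phi) a) ->
  c < t ^+ 2 -> hankel_dim Phi c N ->
  exists v w (V : LinfT R n.+1 n) (X : LinfT R m.+1 m) (Psi : LinfT R m n),
  let split (Q : LinfT R m.+1 n.+1) (G : LinfT R m n) :=
    {ae mu, forall z, Phi z - Q z = t%:C *: (w z *m adjmx (v z))
       + X z *m (Psi z - G z) *m adjmx (V z)} in
  [/\ {ae mu, forall z, unitary_split (v z) (V z) /\ unitary_split (w z) (X z)},
      {ae mu, forall z, mxopnorm (Psi z) <= t},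
      forall Q : LinfT R m.+1 n.+1, Hinf Q -> {ae mu, forall z, mxopnorm (Phi z - Q z) <= t} ->
        exists2 G : LinfT R m n, Hinf G & split Q G,
      forall G : LinfT R m n, Hinf G -> exists2 Q : LinfT R m.+1 n.+1, Hinf Q & split Q G &
      forall c N, hankel_dim Phi c N -> hankel_dim Psi c N].
Proof.
move=> t0 Ht Hmax ct D; have [f [Hf f0 fmax]] := maximizing_vector t0 Ht Hmax ct D.
have [Q0 [HQ0 Q0t]] := nehari (ltW t0) (hankel_le_hpos (ltW t0) Ht).
have h0 := hankel_conj_neq0 t0 HQ0 Q0t Hf f0 fmax.
have [Hg _] := fmax Q0 HQ0 Q0t.
have [L cL] := coinner_exists Hf f0.
have [X cX] := coinner_exists ((Hm_cj _).1 Hg) h0.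
exists (red_v f), (red_w Phi Q0 t f), (li_conj L), X, (red_symbol Phi Q0 L X) => /=; split.
- exact: (reduction_unitary_split t0 HQ0 Q0t Hf f0 fmax cL cX).
- exact: (red_symbol_le t0 HQ0 Q0t Hf f0 fmax cL cX).
- by move=> Q HQ Qt; exact: (reduction_down t0 HQ0 Q0t Hf f0 fmax cL cX).
- by move=> G HG; exact: (reduction_up t0 HQ0 Q0t Hf f0 fmax cL cX).
- by move=> c' N'; exact: (hankel_dim_reduction t0 HQ0 Q0t Hf f0 fmax cL cX).
Qed.

Lemma split_tail m n (v : 'cV[C]_n.+1) (V : 'M[C]_(n.+1, n)) (w : 'cV[C]_m.+1)
    (W : 'M[C]_(m.+1, m)) (t : R) (E1 : 'M[C]_(m, n)) :
  unitary_split v V -> unitary_split w W ->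
  adjmx W *m (t%:C *: (w *m adjmx v) + W *m E1 *m adjmx V) *m V = E1.
Proof.
move=> [VV Vv vv] [WW Ww ww].
rewrite mulmxDr mulmxDl -scalemxAr !mulmxA Ww mul0mx scaler0 mul0mx add0r WW mul1mx.
by rewrite -mulmxA VV mulmx1.
Qed.

(** * Correspondence between the superoptimal problems for Phi and Psi *)

Section InductionStep.
Variables (m n : nat) (Phi : LinfT R m.+1 n.+1) (t : R).
Hypotheses (t0 : 0 < t) (Ht : hankel_le Phi t).
Hypothesis Hmax :
  forall e, 0 < e -> exists2 a, qf (@ip R n.+1) a = 1 & t ^+ 2 - e <= qf (hform Phi) a.
Variables (v : T -> 'cV[C]_n.+1) (w : T -> 'cV[C]_m.+1).
Variables (V : LinfT R n.+1 n) (X : LinfT R m.+1 m) (Psi : LinfT R m n).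
Let split (Q : LinfT R m.+1 n.+1) (G : LinfT R m n) :=
  {ae mu, forall z, Phi z - Q z = t%:C *: (w z *m adjmx (v z))
     + X z *m (Psi z - G z) *m adjmx (V z)}.
Hypothesis sVX : {ae mu, forall z, unitary_split (v z) (V z) /\ unitary_split (w z) (X z)}.
Hypothesis Psi_le : {ae mu, forall z, mxopnorm (Psi z) <= t}.
Hypothesis down : forall Q : LinfT R m.+1 n.+1, Hinf Q ->
  {ae mu, forall z, mxopnorm (Phi z - Q z) <= t} -> exists2 G : LinfT R m n, Hinf G & split Q G.
Hypothesis up : forall G : LinfT R m n, Hinf G ->
  exists2 Q : LinfT R m.+1 n.+1, Hinf Q & split Q G.

Let O0 := Omega0P (ltW t0) Ht Hmax.

(** The bound t on Psi - G is what makes the corresponding Q a best approximation of Phi. *)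
Let rel (Q : LinfT R m.+1 n.+1) (G : LinfT R m n) :=
  [/\ Hinf Q, Hinf G, split Q G & {ae mu, forall z, mxopnorm (Psi z - G z) <= t}].

Let rel_opnorm Q G : rel Q G -> {ae mu, forall z, mxopnorm (Phi z - Q z) = t}.
Proof.
move=> [_ _ QG Gt]; apply: filterS3 sVX QG Gt => z [sv sw] -> Gt.
exact: (split_opnorm sv sw (ltW t0) Gt).
Qed.

Let rel_mxsing Q G j : rel Q G ->
  {ae mu, forall z, mxsing j.+1 (Phi z - Q z) = mxsing j (Psi z - G z)}.
Proof.
move=> [_ _ QG Gt]; apply: filterS3 sVX QG Gt => z [sv sw] -> Gt.
exact: (split_mxsingS sv sw (ltW t0) Gt).
Qed.

Let rel_Omega0 Q G : rel Q G -> Omega Phi 0 Q.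
Proof.
move=> QG; apply/O0; split; first by case: QG.
by apply: filterS (rel_opnorm QG) => z ->.
Qed.

Let rel_down (Q : LinfT R m.+1 n.+1) : Omega Phi 0 Q -> exists G, rel Q G.
Proof.
move=> /O0[HQ Qt]; have [G HG QG] := down HQ Qt; exists G.
split; [exact: HQ|exact: HG|exact: QG|].
apply: filterS3 sVX QG Qt => z [sv sw] QG Qt.
have <- : adjmx (X z) *m (Phi z - Q z) *m V z = Psi z - G z by rewrite QG split_tail.
apply: mxopnorm_le => [|x]; first exact: ltW.
have [VV _ _] := sv; rewrite -!mulmxA.
have adjX y : enorm (adjmx (X z) *m y) <= enorm y.
  rewrite -(@ler_pXn2r _ 2) ?nnegrE ?enorm_ge0 // (enorm_split y sw) lerDr.
  exact: sqr_ge0.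
apply: le_trans (adjX _) _; apply: le_trans (enorm_mulmx _ _) _.
by rewrite (enorm_isometry x VV) ler_wpM2r ?enorm_ge0.
Qed.

Let rel_up (G : LinfT R m n) : Hinf G -> {ae mu, forall z, mxopnorm (Psi z - G z) <= t} ->
  exists Q, rel Q G.
Proof. by move=> HG Gt; have [Q HQ QG] := up HG; exists Q. Qed.

(** For related pairs s_(k+1)(Phi - Q) = s_k(Psi - G), so the minimizations agree level by level. A
    competitor P can be lifted to Phi only if |Psi - P| <= t; at the first level the others lose to
    G anyway, and at later levels every competitor is already a best approximation of Psi. *)
Lemma Omega_shift j Q G : rel Q G -> Omega Phi j.+1 Q <-> Omega Psi j G.
Proof.
have ss k P P' : rel P P' ->
    sup_sing k.+1 (fun z => (Phi z - P z)%R) = sup_sing k (fun z => (Psi z - P' z)%R).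
  by move=> PP'; apply: sup_sing_ae; exact: rel_mxsing.
elim: j Q G => [|j IH] Q G QG.
  have [HQ HG QG' Gt] := QG; split=> [[_ Qmin]|[_ Gmin]].
    split; first exact: HG.
    move=> P HP; rewrite -!sup_sing0 -(ss 0%N _ _ QG).
    have [Pt|Pt] := leP (normoo (fun z => (Psi z - P z)%R)) t%:E.
      have [Q' QP] := rel_up (G := MkLinfT HP.1) HP ((normoo_le _ _).1 Pt).
      by rewrite -(ss 0%N _ _ QP); apply: Qmin; exact: rel_Omega0 QP.
    rewrite (ss 0%N _ _ QG) !sup_sing0; apply: le_trans (ltW Pt); exact/normoo_le.
  split=> [|P OP]; first exact: rel_Omega0 QG.
  have [G' PG] := rel_down (Q := MkLinfT (Omega_Hinf OP).1) OP.
  rewrite (ss 0%N _ _ QG) [leRHS](ss 0%N _ _ PG) !sup_sing0; apply: Gmin.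
  by case: PG.
split=> [[OQ Qmin]|[OG Gmin]].
  split=> [|P OP]; first exact/(IH Q G QG).
  have [_ Pmin] := Omega_sub OP; have [HQ HG QG' Gt] := QG.
  have Pt : {ae mu, forall z, mxopnorm (Psi z - P z) <= t}.
    by apply/normoo_le; apply: le_trans (Pmin G HG) _; exact/normoo_le.
  have [Q' QP] := rel_up (G := MkLinfT (Omega_Hinf OP).1) (Omega_Hinf OP) Pt.
  rewrite -(ss _ _ _ QG) -[leRHS](ss _ _ _ QP); apply: Qmin.
  exact/(IH _ _ QP).
split=> [|P OP]; first exact/(IH Q G QG).
have [G' PG] := rel_down (Q := MkLinfT (Omega_Hinf OP).1) (Omega_sub OP).
rewrite (ss _ _ _ QG) [leRHS](ss _ _ _ PG); apply: Gmin.
exact/(IH _ _ PG).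
Qed.

(** A best approximation G of Psi can be lifted, because comparison with the competitor 0 gives |Psi
    - G| <= t. *)
Lemma superopt_value_shift j s : superopt_value Psi j s -> superopt_value Phi j.+1 s.
Proof.
move=> [G OG ->]; have [_ Gmin] := Omega_sub OG; have HG := Omega_Hinf OG.
have Gt : {ae mu, forall z, mxopnorm (Psi z - G z) <= t}.
  apply/normoo_le; apply: le_trans (Gmin (li_cst 0) (@Hinf_cst R m n 0)) _.
  by apply/normoo_le; apply: filterS Psi_le => z; rewrite subr0.
have [Q QG] := rel_up (G := MkLinfT HG.1) HG Gt; exists Q.
  exact/(Omega_shift _ QG).
by apply/esym/sup_sing_ae; exact: rel_mxsing QG.
Qed.

Let rel_eq Q G Q' G' : rel Q G -> rel Q' G' -> {ae mu, forall z, G' z = G z} ->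
  {ae mu, forall z, Q' z = Q z}.
Proof.
move=> [_ _ QG _] [_ _ QG' _] GG; apply: filterS3 QG QG' GG => z e e' g.
by rewrite -[Q' z](subKr (Phi z)) e' g -e subKr.
Qed.

Lemma superopt_thm_base : minn m n = 0%N -> superopt_thm Phi.
Proof.
move=> mn0; have [Q0 OQ0 _] := superopt_value0 (ltW t0) Ht Hmax.
have HQ0 := Omega_Hinf OQ0; have [G0 QG0] := rel_down (Q := MkLinfT HQ0.1) OQ0.
have mE : minn m.+1 n.+1 = 1%N by rewrite minnSS mn0.
exists Q0; rewrite /superoptimal mE; split=> // [Q' OQ'|[|//] _]; last first.
  by exists t; apply: filterS (rel_opnorm QG0) => z <-; rewrite mxsing0.
have [G' QG'] := rel_down (Q := MkLinfT (Omega_Hinf OQ').1) OQ'.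
(* One of the sizes of G is 0, so all such G coincide. *)
apply: (rel_eq QG0 QG'); apply: aeW => z; apply/matrixP => i j.
by exfalso; have := ltn_ord i; have := ltn_ord j; lia.
Qed.

Lemma superopt_thm_step : (0 < minn m n)%N -> superopt_thm Psi -> superopt_thm Phi.
Proof.
move=> mn0 [G [OG Guniq Gcst]].
have e1 : (minn m.+1 n.+1).-1 = (minn m n).-1.+1 by rewrite minnSS prednK.
have [_ Gmin] := Omega_sub OG; have HG := Omega_Hinf OG.
have Gt : {ae mu, forall z, mxopnorm (Psi z - G z) <= t}.
  apply/normoo_le; apply: le_trans (Gmin (li_cst 0) (@Hinf_cst R m n 0)) _.
  by apply/normoo_le; apply: filterS Psi_le => z; rewrite subr0.
have [Q QG] := rel_up (G := MkLinfT HG.1) HG Gt; exists Q.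
rewrite /superoptimal e1; split.
- exact/(Omega_shift _ QG).
- move=> Q' OQ'; have [G' QG'] := rel_down (Q := MkLinfT (Omega_Hinf OQ').1) (Omega_sub OQ').
  by apply: (rel_eq QG QG'); apply: Guniq; exact/(Omega_shift _ QG').
- move=> [_|j]; first by exists t; apply: filterS (rel_opnorm QG) => z <-; rewrite mxsing0.
  rewrite minnSS ltnS => jmn; have [c Gc] := Gcst j jmn; exists c.
  by apply: filterS2 Gc (rel_mxsing j QG) => z <-.
Qed.

End InductionStep.

(** The essential norm enters only through [hankel_dim], which [reduction] passes on to Psi, while
    [superopt_value_shift] turns the value of index j for Psi into that of index j + 1 for Phi. The
    counter k is one less than the smaller size of Phi. *)
Lemma superopt_induction k : forall m n (Phi : LinfT R m.+1 n.+1), minn m n = k ->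
  (forall j (s : R), (j < minn m.+1 n.+1)%N -> superopt_value Phi j s%:E -> s != 0 ->
     exists c N, c < s ^+ 2 /\ hankel_dim Phi c N) -> superopt_thm Phi.
Proof.
elim: k => [|k IH] m n Phi mnk dimP.
  have [t [t0 Ht Hmax]] := hankel_norm Phi.
  have [te0|tn0] := eqVneq t 0.
    by rewrite te0 in Ht Hmax; exact: superopt_thm_analytic.
  have tp : 0 < t by rewrite lt_def tn0.
  have [|c [N [ct D]]] := dimP 0%N t _ (superopt_value0 t0 Ht Hmax) tn0; first by rewrite minnSS.
  have [v [w [V [X [Psi [sVX Psit down up _]]]]]] := reduction tp Ht Hmax ct D.
  exact: (superopt_thm_base tp Ht Hmax sVX down mnk).
case: m n Phi mnk dimP => [|m] [|n] Phi mnk dimP; try by move: mnk; rewrite ?min0n ?minn0.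
have [t [t0 Ht Hmax]] := hankel_norm Phi.
have [te0|tn0] := eqVneq t 0.
  by rewrite te0 in Ht Hmax; exact: superopt_thm_analytic.
have tp : 0 < t by rewrite lt_def tn0.
have [|c [N [ct D]]] := dimP 0%N t _ (superopt_value0 t0 Ht Hmax) tn0; first by rewrite minnSS.
have [v [w [V [X [Psi [sVX Psit down up dimPsi]]]]]] := reduction tp Ht Hmax ct D.
apply: (superopt_thm_step tp Ht Hmax sVX Psit down up); first by rewrite minnSS.
apply: IH; first by move: mnk; rewrite minnSS => -[].
move=> j s jmn sj s0.
have [|c' [N' [cs D']]] := dimP j.+1 s _ (superopt_value_shift tp Ht Hmax sVX Psit down up sj) s0.
  by rewrite minnSS.
by exists c', N'; split; [exact: cs|exact: dimPsi].
Qed.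

End Superoptimal.

Theorem theorem2p2 (R : realType) (m n : nat) (m_gt0 : (0 < m)%N)
    (n_gt0 : (0 < n)%N) (Phi : circle R -> 'M[R[i]]_(m, n))
    (Phi_bounded : Linf Phi)
    (ess_lt : forall (j : nat) (t : \bar R), (j < minn m n)%N ->
       superopt_value Phi j t -> t != 0%E -> (essnorm (hankel Phi) < t)%E) :
  exists Q : circle R -> 'M[R[i]]_(m, n),
    [/\ superoptimal Phi Q,
        forall Q' : circle R -> 'M[R[i]]_(m, n), superoptimal Phi Q' ->
          {ae circle_measure R, forall z, Q' z = Q z}
      & forall j : nat, (j < minn m n)%N ->
          exists c : R,
            {ae circle_measure R, forall z, mxsing j (Phi z - Q z) = c}].
Proof.
case: m n m_gt0 n_gt0 Phi Phi_bounded ess_lt => [//|m] [//|n] _ _ Phi PhiL ess_lt.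
apply: (@superopt_induction R _ m n (MkLinfT PhiL) erefl) => j s jmn sj s0.
by apply: essnorm_hankel_dim; apply: (ess_lt j).
Qed.
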